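(* Let $H,K:\mathbb{R}^{2n}\to\mathbb{R}$ be compactly supported (autonomous) Hamiltonians of class $C^{1,1}$. If $H$ and $K$ $C^0$-commute, then weak commutativity of their Hamiltonian vector fields holds: $\llbracket X_H,X_K\rrbracket=0$, i.e. $\llbracket X_H,X_K\rrbracket(x)=\{0\}$ for every $x\in\mathbb{R}^{2n}$. Conversely, if $\llbracket X_H,X_K\rrbracket=0$ then $\{H,K\}=0$ identically; in particular $H$ and $K$ $C^0$-commute.
   Context: Coordinates on $\mathbb{R}^{2n}$ are $(q,p)=(q_1,\dots,q_n,p_1,\dots,p_n)$; $\mathbb{E}=\begin{pmatrix}0&I\\-I&0\end{pmatrix}$ is the standard symplectic matrix; $DF$ is the gradient of $F$; $X_F=\mathbb{E}\,DF$ is the Hamiltonian vector field of a $C^1$ function $F$; and $\{F,G\}=\sum_{k}\left(\frac{\partial F}{\partial q_k}\frac{\partial G}{\partial p_k}-\frac{\partial F}{\partial p_k}\frac{\partial G}{\partial q_k}\right)$ for $C^1$ functions $F,G$. A function is of class $C^{1,1}$ if it is $C^1$ with Lipschitz first derivatives. All Hamiltonians are compactly supported. $C^0$-commutation: two autonomous Hamiltonians $H,K$ $C^0$-commute if there exist sequences $H_j,K_j$ of $C^1$ Hamiltonians converging uniformly ($C^0$) to $H$ and $K$ respectively, such that $\{H_j,K_j\}\to 0$ uniformly as $j\to\infty$. Weak Hamiltonian vector field: for a compactly supported Lipschitz function $F:\mathbb{R}^{2n}\to\mathbb{R}$, let $\mathrm{Diff}(F)$ be the set of points where $F$ is differentiable.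 The weak Hamiltonian vector field $\mathbb{X}_F$ is the set-valued map defined by $\mathbb{X}_F(x)=\{\mathbb{E}\,DF(x)\}$ if $x\in\mathrm{Diff}(F)$, and otherwise $\mathbb{X}_F(x)$ is the convex hull of the set of all vectors $v=\lim_{j\to\infty}\mathbb{E}\,DF(x_j)$, over all sequences $(x_j)$ in $\mathrm{Diff}(F)$ with $x_j\to x$ for which the limit exists. Weak Lie brackets: for compactly supported $H,K$ of class $C^{1,1}$ (so that $\{H,K\}$ is Lipschitz with compact support), $\llbracket X_H,X_K\rrbracket:=\mathbb{X}_{\{H,K\}}$. *)

(* Defs.v *)
From HB Require Import structures.
From mathcomp Require Import all_boot all_order all_algebra.
From mathcomp Require Import all_classical all_reals all_analysis.

Set Implicit Arguments.
Unset Strict Implicit.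
Unset Printing Implicit Defensive.

Import Order.TTheory GRing.Theory Num.Theory.
Import numFieldNormedType.Exports.

Local Open Scope classical_set_scope.
Local Open Scope ring_scope.

(* A point (q, p) of R^2n is the row vector row_mx q p : 'rV[R]_(n + n), with
   the library's sup norm: q_k has index lshift n k and p_k index rshift n k. *)
Definition partial (R : realType) (m : nat) (i : 'I_m) (F : 'rV[R]_m -> R)
  (x : 'rV[R]_m) : R := 'D_(delta_mx ord0 i) F x.

(* A row vector, like the points; meaningful only where F is differentiable. *)
Definition gradient (R : realType) (m : nat) (F : 'rV[R]_m -> R)
  (x : 'rV[R]_m) : 'rV[R]_m := \row_i partial i F x.

Definition compactly_supported (R : realType) (m : nat)
  (F : 'rV[R]_m -> R) : Prop := compact (closure [set x | F x != 0]).

Definition C1 (R : realType) (m : nat) (F : 'rV[R]_m -> R) : Prop :=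
  (forall x, differentiable F x) /\ continuous (gradient F).

Definition C11 (R : realType) (m : nat) (F : 'rV[R]_m -> R) : Prop :=
  C1 F /\ lipschitz (gradient F).

Definition symplectic_mx (R : realType) (n : nat) : 'M[R]_(n + n) :=
  block_mx 0 1%:M (- 1%:M) 0.

(* The matrix acts on column vectors, hence the transpositions. *)
Definition hamiltonian_vf (R : realType) (n : nat) (F : 'rV[R]_(n + n) -> R)
  (x : 'rV[R]_(n + n)) : 'rV[R]_(n + n) :=
  (symplectic_mx R n *m (gradient F x)^T)^T.

Definition poisson (R : realType) (n : nat) (F G : 'rV[R]_(n + n) -> R)
  (x : 'rV[R]_(n + n)) : R :=
  \sum_(k < n) (partial (lshift n k) F x * partial (rshift n k) G x
                - partial (rshift n k) F x * partial (lshift n k) G x).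

Definition C0_commute (R : realType) (n : nat)
  (H K : 'rV[R]_(n + n) -> R) : Prop :=
  exists H_ K_ : nat -> 'rV[R]_(n + n) -> R,
    [/\ forall j, C1 (H_ j) /\ compactly_supported (H_ j),
        forall j, C1 (K_ j) /\ compactly_supported (K_ j),
        {uniform, H_ @ \oo --> H},
        {uniform, K_ @ \oo --> K} &
        {uniform, (fun j => poisson (H_ j) (K_ j)) @ \oo --> cst 0}].

Definition convex_hull (R : realType) (V : lmodType R) (A : set V) : set V :=
  smallest (fun C : set V => convex_set (C : set (convex_lmodType V))) A.

Definition limiting_hamiltonian_vf (R : realType) (n : nat)
  (F : 'rV[R]_(n + n) -> R) (x : 'rV[R]_(n + n)) : set 'rV[R]_(n + n) :=
  [set v | exists x_ : nat -> 'rV[R]_(n + n),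
    [/\ forall j, differentiable F (x_ j),
        x_ j @[j --> \oo] --> x &
        hamiltonian_vf F (x_ j) @[j --> \oo] --> v]].

Definition weak_hamiltonian_vf (R : realType) (n : nat)
  (F : 'rV[R]_(n + n) -> R) (x : 'rV[R]_(n + n)) : set 'rV[R]_(n + n) :=
  if `[< differentiable F x >] then [set hamiltonian_vf F x]
  else convex_hull (limiting_hamiltonian_vf F x).

(* The weak Lie bracket of X_H and X_K, as a function of H and K. *)
Definition weak_lie_bracket (R : realType) (n : nat)
  (H K : 'rV[R]_(n + n) -> R) : 'rV[R]_(n + n) -> set 'rV[R]_(n + n) :=
  weak_hamiltonian_vf (poisson H K).

(* Main.v *)
(** Rigidity. Suppose {K, H} > 0 at [x0], and let [H_j], [K_j] be nearly commuting
    approximations of [H], [K]. Following [H_j] for the time T and then [- H] for the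
    time T is a motion generated by a Hamiltonian which is small along its own orbits:
    [K_j] and [H_j] are almost preserved in the first half and [H] in the second, and
    [H_j] is uniformly close to [H]. But in the second half [K] changes by a definite
    amount, so that this loop displaces a ball around [x0]. Displacement is obstructed
    by the minimax value of the action: add first the loop and then a bump supported
    in the ball to the discretised action of periodic sequences of points, and remove
    the loop again. The minimax value over the bounded continuous deformations of the
    negative eigenspace stays almost nonpositive, because the critical points with the
    loop switched on avoid the ball and have small loop energy; without the loop,
    Brouwer's theorem yields a point of the deformed eigenspace with a definite
    positive action.

    Converse. The Poisson bracket is Lipschitz with compact support and its gradient
    vanishes wherever it is differentiable. By induction on the dimension (Fubini,
    Lebesgue's theorem on lines, density points), Lipschitz functions are
    differentiable at almost every point; hence on almost every line parallel to the
    first axis the bracket is constant, thus zero. *)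
Require Import Defs.
From HB Require Import structures.
From mathcomp Require Import all_boot all_order all_algebra all_fingroup.
From mathcomp Require Import all_classical all_reals all_analysis.
From mathcomp Require Import measurable_realfun.
From mathcomp Require Import zify ring lra.

Set Implicit Arguments.
Unset Strict Implicit.
Unset Printing Implicit Defensive.

Import Order.TTheory GRing.Theory Num.Theory.
Import numFieldNormedType.Exports.

(** * Brouwer's fixed point theorem *)

(** The approximations converge only uniformly: the gradients of [H_j] and [K_j] have no bound
    independent of [j], so neither their vector fields nor their orbits need converge. The final
    inequalities therefore involve only values of these functions and of their bracket, never the
    size of their gradients. This dictates the order of choices: the time, the ball and the bump
    depend on [H] and [K] alone, then [j] is taken, and last the number of time steps, as a function
    of the gradients at this [j]. Orbits of a C^1 Hamiltonian need not be unique and second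
    derivatives are missing. Hence orbits are replaced by approximate solutions of an Euler scheme,
    which are points where the gradient of the discretised action is small, and Taylor estimates by
    uniform continuity. Working with nearly critical points instead of critical ones also avoids any
    compactness condition on the action, whose domain is the whole space of polygons. *)

Section Parity.
Variable T : finType.

Lemma even_card_involution (t : T -> T) (A : {set T}) :
  involutive t -> (forall x, x \in A -> t x \in A) ->
  (forall x, x \in A -> t x != x) -> ~~ odd #|A|.
Proof.
move=> tK; elim/(@ltn_ind): {A}#|A| {-2}A (erefl #|A|) => N IH A cA tA fA.
have [->|[x xA]] := set_0Vmem A; first by rewrite cards0.
have txx := fA _ xA.
have cA2 : #|A| = #|A :\ x :\ t x|.+2.
  rewrite (cardsD1 x A) xA (cardsD1 (t x) (A :\ x)) !inE txx tA //.
rewrite cA2 /= negbK; apply: (IH _ _ _ erefl); first by rewrite -cA cA2.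
- move=> y; rewrite !inE => /and3P[y1 y2 yA].
  by rewrite tA // andbT (inj_eq (can_inj tK)) y2 -(inj_eq (can_inj tK)) tK y1.
- by move=> y; rewrite !inE => /and3P[_ _ yA]; exact: fA.
Qed.

Lemma odd_cardsU_diff (A B : {set T}) :
  odd #|[set x | (x \in A) (+) (x \in B)]| = odd #|A| (+) odd #|B|.
Proof.
have -> : [set x | (x \in A) (+) (x \in B)] = (A :\: B) :|: (B :\: A).
  by apply/setP => x; rewrite !inE; case: (x \in A); case: (x \in B).
rewrite cardsU; have -> : (A :\: B) :&: (B :\: A) = finset.set0.
  by apply/setP => x; rewrite !inE; case: (x \in A); case: (x \in B).
rewrite cards0 subn0 -(cardsID B A) -(cardsID A B) finset.setIC !oddD.
by case: (odd _); case: (odd _); case: (odd _).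
Qed.

End Parity.

(** Double counting modulo two: only the points with an odd fibre contribute. *)
Lemma odd_card_pair (T U : finType) (P : T -> U -> bool) :
  odd #|[set x : T * U | P x.1 x.2]| =
  odd #|[set x | odd #|[set y | P x y]|]|.
Proof.
have := sum1dep_card (fun x => odd #|[set y | P x y]|); rewrite /= => <-.
rewrite -sum1dep_card.
have -> : \sum_(x : T * U | P x.1 x.2) 1 = \sum_x \sum_(y | P x y) 1.
  by rewrite pair_big_dep /=; apply: eq_bigl.
rewrite [in RHS]big_mkcond /= !(big_morph odd oddD (erefl _)).
by apply: eq_bigr => x _; rewrite sum1dep_card; case: odd.
Qed.

(** * Sperner's lemma on the Freudenthal triangulation of a cube *)

Section Sperner.
Variables (k m : nat).
Local Notation d := k.+1.

Implicit Types (v : {ffun 'I_d -> 'I_m.+1}) (r : {perm 'I_d}).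

(** Freudenthal triangulation of the cube [0, m+1]^d: the pair [(v, r)] codes the simplex whose
    vertices climb from [v] to [v + (1, ..., 1)], raising one coordinate at a time in the order
    prescribed by [r]. *)
Definition vert v r (j : nat) : {ffun 'I_d -> nat} := [ffun c => v c + (r c < j)].

(** A facet has d vertices, so on a good one each label below d occurs exactly once: these are the
    doors of Sperner's argument. *)
Definition good_facet (lab : {ffun 'I_d -> nat} -> 'I_d.+1) v r (i : 'I_d.+1) :=
  [forall l : 'I_d, exists j : 'I_d.+1,
    (j != i) && (lab (vert v r j) == l :> nat)].

Definition full (lab : {ffun 'I_d -> nat} -> 'I_d.+1) v r :=
  [forall l : 'I_d.+1, exists j : 'I_d.+1, lab (vert v r j) == l].

Definition cyc : {perm 'I_d} := perm (@ord_pred_inj d).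

Definition shift_up v r := [ffun c => inord (v c + (r c == ord0)) : 'I_m.+1].
Definition shift_down v r := [ffun c => inord (v c - (r c == ord_max)) : 'I_m.+1].

Local Notation facet := ({ffun 'I_d -> 'I_m.+1} * {perm 'I_d} * 'I_d.+1)%type.

(** The same facet seen from the simplex on its other side. Dropping the first or the last vertex
    moves the base point by one unit; dropping an inner vertex exchanges the two coordinates raised
    just before and just after it. The fixed points are the facets on the boundary of the cube. *)
Definition flip (x : facet) : facet :=
  let: (v, r, i) := x in
  if i == ord0 then
    if v ((r^-1)%g ord0) < m then (shift_up v r, (r * cyc)%g, ord_max) else x
  else if i == ord_max then
    if 0 < v ((r^-1)%g ord_max) then (shift_down v r, (r * cyc^-1)%g, ord0)
    else x
  else (v, (r * tperm (inord i.-1) (inord i))%g, i).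

Lemma cycE (x : 'I_d) : cyc x = (if x == 0 :> nat then k else x.-1) :> nat.
Proof.
rewrite permE; case: x => -[|x] lx; first by rewrite /= modn_small.
by rewrite [LHS]/= modnDr modn_small // ltnW.
Qed.

Lemma cycVE (x : 'I_d) : (cyc^-1)%g x = (if x == k :> nat then 0 else x.+1) :> nat.
Proof.
have := cycE ((cyc^-1)%g x); rewrite permKV.
by have := ltn_ord ((cyc^-1)%g x); have := ltn_ord x; case: eqP; case: eqP; lia.
Qed.

Lemma flipK : involutive flip.
Proof.
move=> [[v r] i]; rewrite /flip.
have [->|i0] := eqVneq i ord0.
  case: ifPn => [vm|]; last by rewrite /= => /negPf ->.
  rewrite /= /shift_up !ffunE invMg permM.
  have -> : (cyc^-1)%g ord_max = ord0 by apply/val_inj; rewrite /= cycVE /= eqxx.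
  rewrite permKV eqxx addn1 inordK // ltnS.
  rewrite leq0n /= mulgK; congr (_, _, _).
  apply/ffunP => c; rewrite !ffunE permM; apply/val_inj => /=.
  have -> : (cyc (r c) == ord_max) = (r c == ord0).
    rewrite -(inj_eq (@perm_inj _ cyc^-1%g)) permK.
    by congr (_ == _); apply/val_inj; rewrite /= cycVE /= eqxx.
  have [rc|rc] := eqVneq (r c) ord0; last first.
    by rewrite addn0 subn0 !inordK // inord_val.
  have vc : v c < m by rewrite -rc permK in vm.
  by rewrite !inordK ?addnK //; have := ltn_ord (v c); lia.
have [->|im] := eqVneq i ord_max.
  case: ifPn => [vm|]; last by rewrite /= eqxx => /negPf ->.
  rewrite /= /shift_down !ffunE invMg permM invgK.
  have -> : cyc ord0 = ord_max by apply/val_inj; rewrite /= cycE.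
  rewrite permKV eqxx inordK; last exact: leq_ltn_trans (leq_subr _ _) (ltn_ord _).
  have -> : v (r^-1%g ord_max) - true < m.
    by rewrite /= subn1 -ltnS prednK ?ltn_ord.
  rewrite mulgKV; congr (_, _, _).
  apply/ffunP => c; rewrite !ffunE permM; apply/val_inj => /=.
  have -> : (cyc^-1%g (r c) == ord0) = (r c == ord_max).
    rewrite -(inj_eq (@perm_inj _ cyc)) permKV.
    by congr (_ == _); apply/val_inj; rewrite /= cycE.
  have [rc|rc] := eqVneq (r c) ord_max; last first.
    by rewrite addn0 subn0 !inordK // inord_val.
  have vc : 0 < v c by rewrite -rc permK in vm.
  by rewrite !inordK ?subnK //; have := ltn_ord (v c); lia.
by rewrite (negPf i0) (negPf im) -mulgA tperm2 mulg1.
Qed.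

Definition boundary (w : {ffun 'I_d -> nat}) :=
  [exists c, (w c == 0) || (w c == m.+1)].

(** The two facets have the same vertices, numbered differently; as [flip] is an involution, one
    implication is enough. *)
Lemma good_facet_flip lab v r i :
  let: (v', r', i') := flip (v, r, i) in
  good_facet lab v' r' i' = good_facet lab v r i.
Proof.
suff imp v0 r0 i0 : good_facet lab v0 r0 i0 ->
    let: (v', r', i') := flip (v0, r0, i0) in good_facet lab v' r' i'.
  have := flipK (v, r, i); case E : (flip (v, r, i)) => [[v' r'] i'] E'.
  apply/idP/idP => [/imp|/imp]; first by rewrite E'.
  by rewrite E.
rewrite /flip => {v r i}; move: v0 r0 i0 => v r i.
have main v1 r1 i1 v2 r2 i2 (h : 'I_d.+1 -> 'I_d.+1) :
   (forall j, j != i1 -> h j != i2 /\ vert v2 r2 (h j) = vert v1 r1 j) ->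
   good_facet lab v1 r1 i1 -> good_facet lab v2 r2 i2.
  move=> hP /forallP g; apply/forallP => l.
  have /existsP[j /andP[ji jl]] := g l.
  by apply/existsP; exists (h j); have [-> ->] := hP _ ji.
have up v1 r1 : v1 (r1^-1%g ord0) < m -> forall j : nat, j < d ->
    vert (shift_up v1 r1) (r1 * cyc)%g j = vert v1 r1 j.+1.
  move=> vm j jd; apply/ffunP => c; rewrite !ffunE permM cycE.
  have -> : (r1 c == ord0) = (r1 c == 0 :> nat) by [].
  case: ifPn => rc; last first.
    by rewrite addn0 inordK //; congr addn; move: rc; case: (nat_of_ord (r1 c)).
  rewrite inordK ?addn1; last by rewrite ltnS -(permK r1 c) (_ : r1 c = ord0) //; apply/val_inj/eqP.
  by rewrite (eqP rc) addn1 ltnNge -ltnS jd addn0.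
have down v1 r1 : 0 < v1 (r1^-1%g ord_max) -> forall j : nat, 0 < j <= d ->
    vert (shift_down v1 r1) (r1 * cyc^-1)%g j = vert v1 r1 j.-1.
  move=> vm [//|j] /= jd; apply/ffunP => c; rewrite !ffunE permM cycVE.
  have -> : (r1 c == ord_max) = (r1 c == k :> nat) by [].
  case: ifPn => rc; last by rewrite subn0 inordK.
  have vc : 0 < v1 c by rewrite -(permK r1 c) (_ : r1 c = ord_max) //; apply/val_inj/eqP.
  rewrite (eqP rc) ltnS leq0n inordK; last by have := ltn_ord (v1 c); lia.
  by rewrite subnK // ltnNge -ltnS jd addn0.
case: eqVneq => [->|i0].
  case: ifPn => vm //.
  apply: (main _ _ _ _ _ _ (fun j => inord j.-1)) => j j0.
  have j0' : 0 < j by rewrite lt0n.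
  have jd : j.-1 < d by have := ltn_ord j; lia.
  rewrite inordK; last by lia.
  rewrite up // prednK //; split=> //.
  by rewrite -val_eqE /= inordK; lia.
case: eqVneq => [->|im].
  case: ifPn => vm //.
  apply: (main _ _ _ _ _ _ (fun j => inord j.+1)) => j jm.
  have jd : j.+1 < d.+1.
    by have := ltn_ord j; move: jm; rewrite -val_eqE /=; lia.
  rewrite inordK //.
  by rewrite down //; split=> //; rewrite -val_eqE /= inordK.
apply: (main _ _ _ _ _ _ id) => j ji; split=> //.
apply/ffunP => c; rewrite !ffunE permM; congr (_ + _).
have i0' : 0 < i by rewrite lt0n.
have id' : i < d by have := ltn_ord i; move: im; rewrite -val_eqE /=; lia.
have ji' : j <> i :> nat by move=> /val_inj E; rewrite E eqxx in ji.
congr nat_of_bool; case: tpermP => [->|->|//]; rewrite !inordK; lia.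
Qed.

Lemma good_facet_eq lab lab' v r i :
  (forall j : 'I_d.+1, j != i -> lab (vert v r j) = lab' (vert v r j)) ->
  good_facet lab v r i = good_facet lab' v r i.
Proof.
move=> h; apply: eq_forallb => l; apply: eq_existsb => j.
by case: (boolP (j != i)) => //= ji; rewrite h.
Qed.

(** A full simplex has one good facet, opposite to its vertex labelled d. Any other simplex with a
    good facet [i] has exactly two, because vertex [i] repeats the label of a single vertex [i'] and
    these two can be exchanged. *)
Lemma odd_good_facets (lab : {ffun 'I_d -> nat} -> 'I_d.+1) v r :
  odd #|[set i | good_facet lab v r i]| = full lab v r.
Proof.
pose L (j : 'I_d.+1) := lab (vert v r j).
have gP i : reflect (forall l : 'I_d, exists2 j, j != i & L j = l :> nat)
    (good_facet lab v r i).
  apply: (iffP forallP) => h l; have := h l.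
    by case/existsP => j /andP[ji /eqP jl]; exists j.
  by case=> j ji jl; apply/existsP; exists j; rewrite ji /=; apply/eqP.
have fP : reflect (forall l, exists j, L j = l) (full lab v r).
  apply: (iffP forallP) => h l; have := h l.
    by case/existsP => j /eqP jl; exists j.
  by case=> j jl; apply/existsP; exists j; apply/eqP.
have [/fP f|nf] := boolP (full lab v r).
  have Linj : injective L.
    apply/injectiveP/card_uniqP; rewrite size_map -cardE.
    by apply: eq_card => l; rewrite inE; have [j <-] := f l; apply/codomP; exists j.
  have [i iL] := f ord_max.
  suff -> : [set i | good_facet lab v r i] = [set i] by rewrite cards1.
  apply/setP => i'; rewrite !inE; apply/gP/eqP => [g|-> l].
    apply/eqP; apply: contraT => ii'.
    have /= := ltn_ord (L i').
    case: (ltnP (L i') d) => h; last first.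
      have E : L i' = ord_max by apply/val_inj => /=; have := ltn_ord (L i'); lia.
      by rewrite -iL in E; move/Linj: E ii' => ->; rewrite eqxx.
    have [j ji jl] := g (Ordinal h); move/val_inj/Linj: jl ji => ->.
    by rewrite eqxx.
  have [j jl] := f (widen_ord (leqnSn _) l); exists j; last by rewrite jl.
  apply/eqP => E; move: jl; rewrite E iL => /(congr1 val) /= E'.
  by have := ltn_ord l; rewrite -E' ltnn.
have [->|[i]] := set_0Vmem [set i | good_facet lab v r i].
  by rewrite cards0.
rewrite inE => /gP g.
have Li : L i < d.
  rewrite ltn_neqAle -ltnS ltn_ord andbT; apply/eqP => E.
  case/fP: nf => l; have [h|h] := ltnP l d.
    by have [j _ jl] := g (Ordinal h); exists j; apply/val_inj.
  by exists i; apply/val_inj; rewrite /= E; have := ltn_ord l; lia.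
have [i' ii' Li'] := g (Ordinal Li); rewrite /= in Li'.
have sub : [set~ ord_max] \subset L @: [set~ i].
  apply/fintype.subsetP => l; rewrite !inE -val_eqE /= => lm.
  have ld : l < d by have := ltn_ord l; lia.
  have [j ji jl] := g (Ordinal ld).
  by apply/imsetP; exists j; rewrite ?inE //; apply/val_inj.
have cardi : #|[set~ i]| = #|[set~ (ord_max : 'I_d.+1)]| by rewrite !cardsC1.
have im : [set~ ord_max] = L @: [set~ i].
  by apply/eqP; rewrite eqEcard sub -cardi leq_imset_card.
have Linj j j' : j != i -> j' != i -> L j = L j' -> j = j'.
  move=> ji j'i; have /imset_injP Li2 : #|L @: [set~ i]| == #|[set~ i]|.
    by rewrite -im cardi.
  by apply: Li2; rewrite !inE.
suff -> : [set i | good_facet lab v r i] = [set i; i'].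
  by rewrite cards2 eq_sym ii'.
apply/setP => x; rewrite !inE; apply/gP/orP => [gx|[]/eqP-> //]; last first.
  move=> l; have [j ji jl] := g l.
  have [E|] := eqVneq j i'; last by exists j.
  by exists i; [rewrite eq_sym | rewrite -jl E].
apply/orP; apply: contraT; rewrite negb_or => /andP[xi xi'].
have [h|h] := ltnP (L x) d.
  have [j jx jl] := gx (Ordinal h).
  have [E|ji] := eqVneq j i; last by move/val_inj/(Linj _ _ ji xi): jl jx => ->; rewrite eqxx.
  move: jl; rewrite E /= -Li' => /val_inj/Linj -/(_ ii' xi) E'.
  by rewrite E' eqxx in xi'.
have : L x \in [set~ ord_max] by rewrite im imset_f // !inE.
by rewrite !inE -val_eqE /=; have := ltn_ord (L x); lia.
Qed.

(** Full simplices are counted modulo two by pairs of a simplex and a good facet. The pairs on which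
    the two labellings disagree are permuted by [flip] without fixed points, since a fixed facet
    lies on the boundary, where the labels coincide. *)
Lemma full_parity (lab lab' : {ffun 'I_d -> nat} -> 'I_d.+1) :
  (forall w, boundary w -> lab w = lab' w) ->
  odd #|[set x | full lab x.1 x.2]| = odd #|[set x | full lab' x.1 x.2]|.
Proof.
move=> bd.
pose g (la : {ffun 'I_d -> nat} -> 'I_d.+1) :=
  [set x : facet | good_facet la x.1.1 x.1.2 x.2].
have odd_full la : odd #|[set x | full la x.1 x.2]| = odd #|g la|.
  rewrite /g (odd_card_pair (fun p i => good_facet la p.1 p.2 i)); congr odd.
  by apply: eq_card => x; rewrite !inE odd_good_facets.
rewrite !odd_full.
suff : ~~ odd #|[set x | (x \in g lab) (+) (x \in g lab')]|.
  by rewrite odd_cardsU_diff; case: odd; case: odd.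
have inv (la : {ffun 'I_d -> nat} -> 'I_d.+1) x : (flip x \in g la) = (x \in g la).
  case: x => [[v r] i]; have := good_facet_flip la v r i.
  by case: (flip _) => [[v' r'] i'] E; rewrite !inE.
apply: (even_card_involution flipK) => x.
  by rewrite finset.in_set => h; rewrite finset.in_set !inv.
rewrite finset.in_set; apply: contraTneq => fx.
have bdw (w : {ffun 'I_d -> nat}) c : (w c == 0) || (w c == m.+1) -> lab w = lab' w.
  by move=> h; apply: bd; apply/existsP; exists c.
case: x fx => [[v r] i] fx; rewrite !inE /=.
suff -> : good_facet lab v r i = good_facet lab' v r i by rewrite addbb.
apply: good_facet_eq => j ji; move: fx; rewrite /flip.
case: ifPn => [/eqP i0|i0].
  case: ifPn => [_ [_ _ E]|vm _]; first by move: E; rewrite i0.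
  apply: (bdw _ ((r^-1)%g ord0)); rewrite ffunE permKV.
  have -> : (ord0 : 'I_d) < j by rewrite /= lt0n; move: ji; rewrite i0.
  by apply/orP; right; rewrite addn1 eqSS eqn_leq -ltnS ltn_ord leqNgt.
case: ifPn => [/eqP im|im].
  case: ifPn => [_ [_ _ E]|v0 _]; first by move: i0; rewrite -E.
  apply: (bdw _ ((r^-1)%g ord_max)); rewrite ffunE permKV.
  have jd : j < d by have := ltn_ord j; move: ji; rewrite im -val_eqE /=; lia.
  by apply/orP; left; move: v0; rewrite -eqn0Ngt => /eqP ->; rewrite ltnNge -ltnS jd.
move=> E; have := congr1 (fun x : facet => x.1.2 ((r^-1)%g (inord i))) E.
rewrite /= permM permKV tpermR => /(congr1 val) /= {}E.
have i0' : 0 < i by rewrite lt0n.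
have id' : i < d by have := ltn_ord i; move: im; rewrite -val_eqE /=; lia.
by exfalso; move: E; rewrite !inordK; lia.
Qed.

(* Label of [u] at a grid point: the first coordinate at which [u] is negative,
   and [d] when there is none. *)
Definition sign_label (neg : pred 'I_d) : 'I_d.+1 := inord (find neg (enum 'I_d)).

Lemma sign_label_lt (neg : pred 'I_d) (l : 'I_d) :
  sign_label neg = l :> nat -> neg l.
Proof.
have h := find_size neg (enum 'I_d); rewrite size_enum_ord in h.
rewrite /sign_label inordK // => E.
have hs : has neg (enum 'I_d) by rewrite has_find E size_enum_ord.
have := nth_find l hs; rewrite E (_ : nth l (enum 'I_d) l = l) //.
by apply/val_inj; rewrite /= nth_enum_ord.
Qed.

Lemma sign_label_max (neg : pred 'I_d) (l : 'I_d) :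
  l < sign_label neg -> ~~ neg l.
Proof.
have h := find_size neg (enum 'I_d); rewrite size_enum_ord in h.
rewrite /sign_label inordK // => /(before_find l).
rewrite (_ : nth l (enum 'I_d) l = l); first by move=> ->.
by apply/val_inj; rewrite /= nth_enum_ord.
Qed.

Lemma sign_label_eq (neg neg' : pred 'I_d) :
  neg =1 neg' -> sign_label neg = sign_label neg'.
Proof. by move=> E; rewrite /sign_label (eq_find E). Qed.

Lemma sign_label_mono (neg neg' : pred 'I_d) :
  (forall c, neg' c -> neg c) -> sign_label neg <= sign_label neg'.
Proof.
move=> h; rewrite leqNgt; apply/negP => lt.
have lt' : sign_label neg' < d by have := ltn_ord (sign_label neg); lia.
have := sign_label_max (l := Ordinal lt') lt => /negP; apply; apply: h.
exact: sign_label_lt.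
Qed.

(** Coordinates grow along a simplex, hence so do the labels; in a full simplex vertex [j] must have
    label [j], which leaves only the identity order and the base point with all coordinates
    [h - 1]. *)
Lemma full_half_space (h : nat) : 0 < h <= m ->
  #|[set x : {ffun 'I_d -> 'I_m.+1} * {perm 'I_d} |
     full (fun w => sign_label (fun c => w c < h)) x.1 x.2]| = 1.
Proof.
case/andP=> h0 hm.
set S := [set x | _].
suff -> : S = [set ([ffun=> inord h.-1], 1%g)] by rewrite cards1.
apply/setP => -[v r]; rewrite !inE /=.
apply/idP/eqP => [/forallP f|[-> ->]]; last first.
  apply/forallP => l; apply/existsP; exists l; apply/eqP/val_inj => /=.
  have E c : vert [ffun=> inord h.-1] 1 l c < h = (l <= c).
    rewrite !ffunE perm1 inordK; last by lia.
    by case: (ltnP c l); rewrite /= ?addn0 ?addn1; lia.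
  apply/eqP; rewrite eqn_leq; apply/andP; split; rewrite leqNgt; apply/negP => lt.
    have ld : l < d by move: lt; case: (sign_label _) => s /= ? ?; lia.
    by have := sign_label_max (l := Ordinal ld) lt; rewrite E /= leqnn.
  set s := sign_label _ in lt.
  have sd : s < d by have := ltn_ord l; lia.
  have : vert [ffun=> inord h.-1] 1 l (Ordinal sd) < h by apply: (@sign_label_lt (fun c => _ c < h)).
  by rewrite E /=; lia.
pose L j := sign_label (fun c => vert v r j c < h).
have Lmono i j : i <= j -> L i <= L j.
  move=> ij; apply: sign_label_mono => c; rewrite !ffunE.
  by apply: leq_ltn_trans; rewrite leq_add2l; case: (ltnP (r c) i) => // /leq_trans ->.
have Linj : injective (fun j : 'I_d.+1 => L j).
  apply/injectiveP/card_uniqP; rewrite size_map -cardE.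
  apply: eq_card => l; rewrite inE; have /existsP[j /eqP <-] := f l.
  by apply/codomP; exists j.
have Lstep j : j < d -> L j < L j.+1.
  move=> jd; rewrite ltn_neqAle Lmono // andbT; apply/eqP => /val_inj E.
  have jd1 : j < d.+1 by lia.
  have := Linj (Ordinal jd1) (Ordinal (jd : j.+1 < d.+1)) E.
  by move=> /(congr1 val) /=; lia.
have Ladd i t : i + t < d.+1 -> L i + t <= L (i + t).
  elim: t => [|t IH] h1; first by rewrite !addn0.
  by rewrite !addnS (leq_ltn_trans (IH _)) ?Lstep; lia.
have Lid j : j < d.+1 -> L j = j :> nat.
  move=> jd; have := Ladd 0 j jd; have := Ladd j (d - j).
  by rewrite subnKC // add0n; have := ltn_ord (L d); lia.
have vrc c : r c = c /\ v c = h.-1 :> nat.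
  have cd := ltn_ord c.
  have neg : vert v r c c < h by apply: (@sign_label_lt (fun c' => vert v r c c' < h)); rewrite -/(L _) Lid; lia.
  have pos : ~~ (vert v r c.+1 c < h).
    by apply: (@sign_label_max (fun c' => vert v r c.+1 c' < h)); rewrite -/(L _) Lid; lia.
  move: neg pos; rewrite !ffunE.
  case: (ltnP (r c) c) => /=; case: (ltnP (r c) c.+1) => /= ? ? ? ?; try (split; [apply/val_inj|]); move=> /=; lia.
congr (_, _).
  by apply/ffunP => c; rewrite ffunE; apply/val_inj; rewrite /= inordK ?(vrc c).2; lia.
by apply/permP => c; rewrite perm1 (vrc c).1.
Qed.

(* Sperner-type lemma: [neg w c] reads as "the c-th coordinate of the map is
   negative at the grid point w". *)
Lemma grid_zero (h : nat) (neg : {ffun 'I_d -> nat} -> pred 'I_d) :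
  0 < h <= m ->
  (forall w, boundary w -> forall c, neg w c = (w c < h)) ->
  exists v r, forall c : 'I_d,
    (exists j, neg (vert v r j) c) /\ (exists j, ~~ neg (vert v r j) c).
Proof.
move=> hm bd.
have : odd #|[set x : {ffun 'I_d -> 'I_m.+1} * {perm 'I_d} |
    full (fun w => sign_label (neg w)) x.1 x.2]|.
  rewrite (full_parity (lab' := fun w => sign_label (fun c => w c < h))).
    by rewrite full_half_space.
  by move=> w /bd E; apply: sign_label_eq.
case: (set_0Vmem [set x | full (fun w => sign_label (neg w)) x.1 x.2]) => [->|].
  by rewrite cards0.
(* The vertex labelled [c] is negative in coordinate [c]; the vertex labelled d is negative in
   none. *)
case=> -[v r]; rewrite inE /= => /forallP f _; exists v, r => c; split.
  have /existsP[j /eqP jc] := f (widen_ord (leqnSn _) c).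
  by exists j; apply: sign_label_lt; rewrite jc.
have /existsP[j /eqP jc] := f ord_max.
by exists j; apply: sign_label_max; rewrite jc /=.
Qed.

End Sperner.

Local Open Scope classical_set_scope.
Local Open Scope ring_scope.

Section MatrixNorm.
Context {R : realType}.

Lemma entry_le_norm p q (A : 'M[R]_(p, q)) i j : `|A i j| <= `|A|.
Proof.
by rewrite [leRHS]/Num.Def.normr /= mx_normrE; apply: (le_bigmax _ (fun x => `|A x.1 x.2|) (i, j)).
Qed.

Lemma norm_le_entries p q (A : 'M[R]_(p, q)) c :
  0 <= c -> (forall i j, `|A i j| <= c) -> `|A| <= c.
Proof.
move=> c0 h; rewrite [leLHS]/Num.Def.normr /= mx_normrE; apply/bigmax_leP.
by split=> // -[i j] _; exact: h.
Qed.

Lemma continuous_epsilon (V W : normedModType R) (f : V -> W) :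
  continuous f <-> forall x e, 0 < e ->
    exists2 d, 0 < d & forall y, `|y - x| < d -> `|f y - f x| < e.
Proof.
split=> [fc x e e0|h x].
  have /cvgrPdist_lt/(_ e e0)/nbhs_ballP[d /= d0 hd] := fc x.
  exists d => // y yx; rewrite distrC; apply: hd.
  by rewrite -ball_normE /= distrC.
apply/cvgrPdist_lt => e e0; have [d d0 hd] := h x e e0.
apply/nbhs_ballP; exists d => //= y; rewrite -ball_normE /= => yx.
by rewrite distrC; apply: hd; rewrite distrC.
Qed.

Lemma bounded_seq_cluster k (x_ : nat -> 'rV[R]_k) (c : R) :
  (forall N, `|x_ N| <= c) ->
  exists2 x, `|x| <= c & forall e N0, 0 < e ->
    exists2 N, (N0 <= N)%N & `|x_ N - x| < e.
Proof.
move=> xc; pose B := [set x : 'rV[R]_k | `|x| <= c].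
have cB : compact B.
  apply: bounded_closed_compact.
    exists c; split=> [|M cM x Bx]; first exact: num_real.
    exact: le_trans Bx (ltW cM).
  rewrite (_ : B = Num.Def.normr @^-1` [set r | r <= c]) //.
  by apply: preimage_closed; [move=> x _; exact: norm_continuous | exact: closed_le].
have [|x [Bx clx]] := cB (x_ @ \oo) _; first by exists 0%N => // N _; exact: xc.
exists x => // e N0 e0.
have nb : nbhs x (ball x e) by exact: nbhsx_ballx.
have im : (x_ @ \oo) (x_ @` [set N | (N0 <= N)%N]).
  by exists N0 => // N /= h; exists N.
have [y [[N /= NN0 <-] xy]] := clx _ _ im nb.
by exists N => //; move: xy; rewrite -ball_normE /= distrC.
Qed.

End MatrixNorm.

(** * From zeros on finer and finer grids to fixed points *)

Section Brouwer.
Context {R : realType}.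

(** The cut-off [phi] is 1 for |y| <= B and 0 for |y| >= b = B + 1. So [u] is the identity on the
    boundary of the cube of radius [b], as [grid_zero] demands, and a zero of [u] satisfies |x| <=
    B, hence is a fixed point of [f]. *)
Lemma brouwer_bounded_row d (f : 'rV[R]_d.+1 -> 'rV[R]_d.+1) (B : R) :
  continuous f -> (forall x, `|f x| <= B) -> exists x, f x = x.
Proof.
move=> /continuous_epsilon fc fB.
have B0 : 0 <= B := le_trans (normr_ge0 _) (fB 0).
pose b := B + 1.
pose phi (y : 'rV[R]_d.+1) : R := Num.max 0 (Num.min 1 (b - `|y|)).
have phi01 y : 0 <= phi y <= 1.
  by rewrite /phi /Num.max /Num.min; case: ifPn; case: ifPn; lra.
have phiL y z : `|phi y - phi z| <= `|y - z|.
  have : `| `|y| - `|z| | <= `|y - z| := ler_dist_dist _ _.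
  rewrite !ler_norml /phi /Num.max /Num.min => h.
  by repeat (case: ifPn); lra.
pose u (y : 'rV[R]_d.+1) := y - phi y *: f y.
have uc x e : 0 < e -> exists2 dl, 0 < dl & forall y, `|y - x| < dl -> `|u y - u x| < e.
  move=> e0; have e3 : 0 < e / 2 by lra.
  have [dl dl0 hd] := fc x _ e3.
  exists (Num.min dl (e / 2 / (B + 1))).
    by rewrite lt_min dl0 divr_gt0 //; lra.
  move=> y; rewrite lt_min => /andP[yx1]; rewrite ltr_pdivlMr; last by lra.
  move=> yx2.
  have -> : u y - u x = (y - x) - (phi y *: (f y - f x) + (phi y - phi x) *: f x).
    by rewrite /u scalerBr scalerBl; apply/rowP => i; rewrite !mxE; ring.
  apply: le_lt_trans (ler_normB _ _) _.
  have := ler_normD (phi y *: (f y - f x)) ((phi y - phi x) *: f x).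
  rewrite !normrZ (ger0_norm (proj1 (andP (phi01 y)))).
  have := hd y yx1; have := phi01 y; have := phiL y x; have := fB x.
  have := normr_ge0 (f y - f x); have := normr_ge0 (phi y - phi x); have := normr_ge0 (f x).
  by nra.
(* The indices 0 to 2N+2 run over [-b, b], and the index [h = N + 1] is the coordinate 0. *)
pose pt N (w : 'I_d.+1 -> nat) : 'rV[R]_d.+1 :=
  \row_c (b * ((w c)%:R / N.+1%:R - 1)).
have N0 N : 0 < N.+1%:R :> R by rewrite ltr0n.
have grid N : exists x, `|x| <= b /\ forall c, exists y z,
   [/\ `|y - x| <= b / N.+1%:R, `|z - x| <= b / N.+1%:R, u y 0 c < 0 & 0 <= u z 0 c].
  have [||v [r vr]] := @grid_zero d N.*2.+1 N.+1 (fun w c => u (pt N w) 0 c < 0).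
  - by lia.
  - move=> w /existsP[c0 w0] c.
    have ph0 : phi (pt N w) = 0.
      rewrite /phi; suff : b <= `|pt N w|.
        by rewrite /Num.max /Num.min; repeat (case: ifPn); lra.
      apply: le_trans (entry_le_norm _ 0 c0); rewrite mxE.
      case/orP: w0 => /eqP ->; first by rewrite mul0r sub0r mulrN1 normrN ler_norm.
      have -> : N.*2.+2%:R = 2 * N.+1%:R :> R by rewrite -natrM mul2n doubleS.
      rewrite mulfK ?gt_eqF //.
      by rewrite (_ : b * (2 - 1) = b) ?ler_norm //; ring.
    rewrite /u ph0 scale0r subr0 mxE pmulr_rlt0; last by rewrite /b; lra.
    by rewrite subr_lt0 ltr_pdivrMr // mul1r ltr_nat.
  exists (pt N (fun c => v c)); split.
    apply: norm_le_entries => [|i c]; first by rewrite /b; lra.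
    rewrite !mxE normrM ger0_norm; last by rewrite /b; lra.
    rewrite -[leRHS]mulr1 ler_wpM2l //; first by rewrite /b; lra.
    have vN : (v c)%:R / N.+1%:R <= 2 :> R.
      rewrite ler_pdivrMr // -natrM ler_nat; have := ltn_ord (v c); lia.
    have v0 : 0 <= (v c)%:R / N.+1%:R :> R by rewrite divr_ge0.
    by rewrite ler_norml; apply/andP; split; [rewrite lerBrDr addNr; exact: v0 | rewrite lerBlDr; exact: vN].
  move=> c; have [[j1 h1] [j2 h2]] := vr c.
  have dist j : `|pt N (vert v r j) - pt N (fun c => v c)| <= b / N.+1%:R.
    apply: norm_le_entries => [|i c']; first by rewrite divr_ge0 // /b; lra.
    rewrite !mxE ffunE natrD.
    have -> : b * (((v c')%:R + (r c' < j)%:R) / N.+1%:R - 1) - b * ((v c')%:R / N.+1%:R - 1) = b / N.+1%:R * (r c' < j)%:R.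
      by field; rewrite addrC natr1 gt_eqF.
    have b0 : 0 <= b / N.+1%:R by rewrite divr_ge0 // /b; lra.
    by rewrite ger0_norm; case: (r c' < j)%N; rewrite ?mulr1 ?mulr0.
  exists (pt N (vert v r j1)), (pt N (vert v r j2)).
  by split=> //; rewrite leNgt.
have [x_ x_P] := choice grid.
have [x xb xcl] := bounded_seq_cluster (fun N => proj1 (x_P N)).
(* A nonzero coordinate of [u x] would have a constant sign near [x], but the grid cells
   accumulating at [x] show both signs. *)
have ux : u x = 0.
  apply/rowP => c; rewrite [RHS]mxE; apply: contrapT => /eqP ne.
  have t0 : 0 < `|u x 0 c| by rewrite normr_gt0.
  have [dl dl0 hdl] := uc x _ t0.
  have [M Mlt] : exists M : nat, b / (dl / 2) < M%:R.
    by exists (Num.truncn (b / (dl / 2))).+1; apply: Num.Theory.truncnS_gt.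
  have dl2 : 0 < dl / 2 by lra.
  have [N MN xN] := xcl _ M dl2.
  have bN : b / N.+1%:R < dl / 2.
    rewrite ltr_pdivrMr // mulrC -ltr_pdivrMr //; apply: lt_le_trans Mlt _.
    by rewrite ler_nat; lia.
  have [_ /(_ c) [y [z [yx zx uy uz]]]] := x_P N.
  have close w : `|w - x_ N| <= b / N.+1%:R -> `|u w 0 c - u x 0 c| < `|u x 0 c|.
    move=> wx; have := le_lt_trans (entry_le_norm (u w - u x) 0 c) (hdl w _).
    rewrite !mxE; apply.
    have -> : w - x = (w - x_ N) + (x_ N - x) by rewrite addrA subrK.
    by apply: le_lt_trans (ler_normD _ _) _; rewrite (splitr dl) ltrD // (le_lt_trans wx).
  have := close y yx; have := close z zx.
  by move: ne uy uz; case: (ger0P (u x 0 c)) => ? ?; rewrite !ltr_norml; lra.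
have E : x = phi x *: f x by apply/eqP; rewrite -subr_eq0; apply/eqP.
have xB : `|x| <= B.
  rewrite E normrZ; have := phi01 x; have := fB x; have := normr_ge0 (f x).
  by case: (ger0P (phi x)); nra.
exists x; rewrite {2}E (_ : phi x = 1) ?scale1r // /phi /b.
by rewrite /Num.max /Num.min; repeat (case: ifPn); lra.
Qed.

Lemma brouwer_bounded p q (f : 'M[R]_(p, q) -> 'M[R]_(p, q)) (B : R) :
  continuous f -> (forall x, `|f x| <= B) -> exists x, f x = x.
Proof.
move=> /continuous_epsilon fc fB.
have B0 : 0 <= B := le_trans (normr_ge0 _) (fB 0).
have nv (A : 'M[R]_(p, q)) : `|mxvec A| <= `|A|.
  apply: norm_le_entries => // i j; rewrite (ord1 i).
  by case/mxvec_indexP: j => a b; rewrite mxvecE; exact: entry_le_norm.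
have nw (v : 'rV[R]_(p * q)) : `|vec_mx v| <= `|v|.
  by apply: norm_le_entries => // i j; rewrite mxE; exact: entry_le_norm.
pose g v := mxvec (f (vec_mx v)).
have gc : continuous g.
  apply/continuous_epsilon => x e e0; have [d d0 hd] := fc (vec_mx x) e e0.
  exists d => // y yx; rewrite /g -linearB; apply: le_lt_trans (nv _) _.
  by apply: hd; rewrite -linearB; exact: le_lt_trans (nw _) yx.
have gB v : `|g v| <= B by exact: le_trans (nv _) (fB _).
suff [v gv] : exists v, g v = v by exists (vec_mx v); rewrite -{2}gv mxvecK.
move: g gc gB; case: (p * q)%N => [|d] g gc gB; last exact: brouwer_bounded_row gc gB.
by exists 0; apply/rowP => -[].
Qed.

End Brouwer.

(** * Gradient flow and minimax values *)

(** The factor is the positive part of |U x| - m divided by (1 + |U x|)^2; written with an absolute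
    value, its continuity is that of the norm. *)
Lemma continuous_damped (R : realType) (X : normedModType R) (U : X -> X) (t m : R) :
  continuous U ->
  continuous (fun x => x -
    (t * ((`| `|U x| - m| + (`|U x| - m)) / 2 / (1 + `|U x|) ^+ 2)) *: U x).
Proof.
move=> cU x.
have cN : `|U y| @[y --> x] --> `|U x| by apply: cvg_norm; exact: cU.
have cB : `|U y| - m @[y --> x] --> `|U x| - m.
  by apply: cvgB => //; exact: cvg_cst.
have c1 : 1 + `|U y| @[y --> x] --> 1 + `|U x|.
  by apply: cvgD => //; exact: cvg_cst.
apply: cvgB; first exact: cvg_id.
apply: cvgZ; last exact: cU.
apply: cvgM; first exact: cvg_cst.
apply: cvgM; first by apply: cvgM; [apply: cvgD => //; exact: cvg_norm | exact: cvg_cst].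
apply: cvgV; first by rewrite expf_neq0 // gt_eqF // ltr_pwDl.
by rewrite /= expr2; under eq_fun do rewrite expr2; exact: cvgM.
Qed.

Section UniformGradient.
Context {R : realType} {p q : nat}.
Local Notation X := 'M[R]_(p, q).
Implicit Types (A G : X -> R) (V W : X -> X).

Definition dot (a b : X) : R := \sum_i \sum_j a i j * b i j.

Lemma dotDl a b c : dot (a + b) c = dot a c + dot b c.
Proof.
rewrite /dot -big_split; apply: eq_bigr => i _; rewrite -big_split.
by apply: eq_bigr => j _; rewrite mxE mulrDl.
Qed.

Lemma dotZl k a c : dot (k *: a) c = k * dot a c.
Proof.
rewrite /dot mulr_sumr; apply: eq_bigr => i _; rewrite mulr_sumr.
by apply: eq_bigr => j _; rewrite mxE mulrA.
Qed.

Lemma dotC a c : dot a c = dot c a.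
Proof. by apply: eq_bigr => i _; apply: eq_bigr => j _; rewrite mulrC. Qed.

Lemma dot0l c : dot 0 c = 0.
Proof. by rewrite -(scale0r 0) dotZl mul0r. Qed.

Lemma sqr_norm_le_dot a : `|a| ^+ 2 <= dot a a.
Proof.
have entry i j : a i j ^+ 2 <= dot a a.
  rewrite /dot (bigD1 i) //= (bigD1 j) //= -expr2 -addrA lerDl.
  apply: addr_ge0; first by apply: sumr_ge0 => j' _; rewrite -expr2 sqr_ge0.
  by apply: sumr_ge0 => i' _; apply: sumr_ge0 => j' _; rewrite -expr2 sqr_ge0.
have d0 : 0 <= dot a a.
  by apply: sumr_ge0 => i' _; apply: sumr_ge0 => j' _; rewrite -expr2 sqr_ge0.
rewrite -[leRHS]sqr_sqrtr // ler_sqr ?nnegrE ?sqrtr_ge0 //.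
apply: norm_le_entries; first exact: sqrtr_ge0.
move=> i j; rewrite -ler_sqr ?nnegrE ?sqrtr_ge0 //.
by rewrite sqr_sqrtr // real_normK ?num_real.
Qed.

Lemma norm_dot_le a b : `|dot a b| <= (p * q)%:R * `|a| * `|b|.
Proof.
have -> : (p * q)%:R * `|a| * `|b| = \sum_(i < p) \sum_(j < q) `|a| * `|b|.
  by rewrite !sumr_const !card_ord -mulrnA mulnC -mulrA mulr_natl.
apply: le_trans (ler_norm_sum _ _ _) _; apply: ler_sum => i _.
apply: le_trans (ler_norm_sum _ _ _) _; apply: ler_sum => j _.
by rewrite normrM ler_pM // entry_le_norm.
Qed.

Definition unif_cont_field V := forall e : R, 0 < e ->
  exists2 r : R, 0 < r & forall x y, `|y - x| <= r -> `|V y - V x| <= e.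

Lemma unif_cont_continuous V : unif_cont_field V -> continuous V.
Proof.
move=> h; apply/continuous_epsilon => x e e0.
have e2 : 0 < e / 2 by lra.
have [r r0 hr] := h _ e2; exists r => // y /ltW/hr; lra.
Qed.

(** The remainder is uniform over the whole noncompact space, so that one size of descent step works
    everywhere. This replaces the second derivatives that C^1 Hamiltonians do not have. *)
Definition ugrad A V := unif_cont_field V /\
  forall e : R, 0 < e -> exists2 r : R, 0 < r &
    forall x y, `|y - x| <= r -> `|A y - A x - dot (V x) (y - x)| <= e * `|y - x|.

Lemma ugradD A V G W : ugrad A V -> ugrad G W ->
  ugrad (fun x => A x + G x) (fun x => V x + W x).
Proof.
move=> [uV dA] [uW dG]; split=> e e0; have e2 : 0 < e / 2 by lra.
  have [r r0 hr] := uV _ e2; have [r' r'0 hr'] := uW _ e2.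
  exists (Num.min r r') => [|x y]; first by rewrite lt_min r0.
  rewrite le_min => /andP[/hr h /hr' h']; rewrite opprD addrACA.
  by apply: le_trans (ler_normD _ _) _; rewrite (splitr e) lerD.
have [r r0 hr] := dA _ e2; have [r' r'0 hr'] := dG _ e2.
exists (Num.min r r') => [|x y]; first by rewrite lt_min r0.
rewrite le_min => /andP[/hr h /hr' h']; rewrite dotDl.
have -> : A y + G y - (A x + G x) - (dot (V x) (y - x) + dot (W x) (y - x)) =
  (A y - A x - dot (V x) (y - x)) + (G y - G x - dot (W x) (y - x)) by ring.
by apply: le_trans (ler_normD _ _) _; rewrite (splitr e) mulrDl lerD.
Qed.

Lemma ugradZ k A V : ugrad A V -> ugrad (fun x => k * A x) (fun x => k *: V x).
Proof.
move=> [uV dA].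
have k0 : 0 < `|k| + 1 by rewrite ltr_wpDl.
have kle : `|k| <= `|k| + 1 by rewrite lerDl.
split=> e e0; have e2 : 0 < e / (`|k| + 1) by rewrite divr_gt0.
  have [r r0 hr] := uV _ e2; exists r => // x y /hr h.
  rewrite -scalerBr normrZ; apply: le_trans (ler_pM _ _ kle h) _ => //.
  by rewrite mulrC divfK // gt_eqF.
have [r r0 hr] := dA _ e2; exists r => // x y /hr h.
rewrite dotZl -!mulrBr normrM; apply: le_trans (ler_pM _ _ kle h) _ => //.
by rewrite mulrA [_ * (e / _)]mulrC divfK // gt_eqF.
Qed.

Lemma ugrad0 : ugrad (fun=> 0) (fun=> 0).
Proof.
split=> e e0; exists 1 => // x y _; first by rewrite subrr normr0 ltW.
by rewrite dot0l !subrr normr0 mulr_ge0 // ltW.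
Qed.

Lemma ugrad_sum (I : finType) (A : I -> X -> R) (V : I -> X -> X) :
  (forall i, ugrad (A i) (V i)) ->
  ugrad (fun x => \sum_i A i x) (fun x => \sum_i V i x).
Proof.
move=> h; have -> : (fun x => \sum_i A i x) = \big[(fun f g x => f x + g x)/fun=> 0]_i A i.
  by apply/funext => x; rewrite (big_morph (fun f : X -> R => f x) (op1 := +%R) (id1 := 0)).
have -> : (fun x => \sum_i V i x) = \big[(fun f g x => f x + g x)/fun=> 0]_i V i.
  by apply/funext => x; rewrite (big_morph (fun f : X -> X => f x) (op1 := +%R) (id1 := 0)).
elim/big_rec2 : _ => [|i V' A' _ h']; first exact: ugrad0.
exact: ugradD.
Qed.

(* One step of the normalised gradient descent, damped where the gradient is
   shorter than [mu / 2] so that [A] never increases. *)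
Lemma gradient_step A V G W (mu : R) : ugrad A V -> ugrad G W -> 0 < mu ->
  exists2 b : R, 0 < b & forall s : R, 0 <= s <= 1 ->
    exists2 eta : X -> X, continuous eta & forall x,
      [/\ `|eta x - x| <= 1,
          A (eta x) + s * G (eta x) <= A x + s * G x &
          mu <= `|V (eta x) + s *: W (eta x)| ->
          A (eta x) + s * G (eta x) <= A x + s * G x - b].
Proof.
move=> [uV dA] [uW dG] mu0; have e0 : 0 < mu / 8 by lra.
have [r1 r10 h1] := uV _ e0; have [r2 r20 h2] := uW _ e0.
have [r3 r30 h3] := dA _ e0; have [r4 r40 h4] := dG _ e0.
pose t := Num.min 1 (Num.min (Num.min r1 r2) (Num.min r3 r4)).
have t0 : 0 < t by rewrite !lt_min r10 r20 r30 r40 ltr01.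
have [t1 tr1 tr2 tr3 tr4] : [/\ t <= 1, t <= r1, t <= r2, t <= r3 & t <= r4].
  by rewrite /t !ge_min !lexx !orbT.
(* A step changes the gradient by at most mu / 8 + s mu / 8 <= mu / 4: if it is at least [mu] after
   the step, it was at least [a] before. *)
pose a := 3 / 4 * mu; have a0 : 0 < a by rewrite /a; lra.
pose lam (rho : R) := (`|rho - mu / 2| + (rho - mu / 2)) / 2 / (1 + rho) ^+ 2.
have lam_low rho : rho <= mu / 2 -> lam rho = 0.
  by move=> h; rewrite /lam ler0_norm ?subr_le0 // addNr !mul0r.
have lam_high rho : mu / 2 <= rho -> lam rho = (rho - mu / 2) / (1 + rho) ^+ 2.
  move=> h; rewrite /lam ger0_norm ?subr_ge0 //; congr (_ / _); lra.
(* The step gains at least t lam(rho) rho (rho - mu / 4). For rho >= a one has rho - mu / 2 >= a / 3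
   and rho - mu / 4 >= 2 rho / 3, and rho / (1 + rho) is increasing. *)
pose b := t * (a / 3 * (2 / 3) * (a / (1 + a)) ^+ 2).
have ka0 : 0 < a / (1 + a) by rewrite divr_gt0 //; lra.
exists b; first by rewrite /b mulr_gt0 // mulr_gt0 ?exprn_gt0 //; lra.
move=> s s01; pose U x := V x + s *: W x.
exists (fun x => x - (t * lam `|U x|) *: U x).
  apply: continuous_damped; apply: unif_cont_continuous.
  by have [] := ugradD (conj uV dA) (ugradZ s (conj uW dG)).
move=> x /=; set rho := `|U x|; set y := x - _.
have rho0 : 0 <= rho by exact: normr_ge0.
have lamP : 0 <= lam rho.
  have [h|h] := leP rho (mu / 2); first by rewrite lam_low.
  by rewrite lam_high ?(ltW h) // divr_ge0 ?sqr_ge0 // subr_ge0 ltW.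
have lamrho : lam rho * rho <= 1.
  have [h|h] := leP rho (mu / 2); first by rewrite lam_low // mul0r.
  rewrite lam_high ?(ltW h) // mulrAC ler_pdivrMr; last by rewrite exprn_gt0 // ltr_pwDl.
  by rewrite expr2; nra.
have wE : y - x = - ((t * lam rho) *: U x) by rewrite /y addrC addKr.
have nw : `|y - x| = t * (lam rho * rho).
  have tl0 : 0 <= t * lam rho by rewrite mulr_ge0 // ltW.
  by rewrite wE normrN normrZ (ger0_norm tl0) -mulrA.
have nwt : `|y - x| <= t by rewrite nw ler_piMr // ltW.
have dotw : dot (U x) (y - x) <= - (t * lam rho * rho ^+ 2).
  rewrite wE -scaleNr dotC dotZl mulNr lerN2 ler_wpM2l ?sqr_norm_le_dot //.
  by rewrite mulr_ge0 // ltW.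
have := h3 x y (le_trans nwt tr3); have := h4 x y (le_trans nwt tr4).
rewrite !ler_norml => /andP[_ gG] /andP[_ gA].
have dec : A y + s * G y <= A x + s * G x - t * (lam rho * rho) * (rho - mu / 4).
  have : dot (U x) (y - x) = dot (V x) (y - x) + s * dot (W x) (y - x).
    by rewrite /U dotDl dotZl.
  have ww : 0 <= `|y - x| by [].
  move: dotw gG gA; rewrite -nw => dotw gG gA dE.
  have : s * (G y - G x - dot (W x) (y - x)) <= mu / 8 * `|y - x|.
    case/andP: s01 => s0 s1; have [h|h] := leP 0 (G y - G x - dot (W x) (y - x)); nra.
  have : t * lam rho * rho ^+ 2 = `|y - x| * rho by rewrite nw; ring.
  lra.
split; first exact: le_trans nwt t1.
  apply: le_trans dec _; rewrite gerBl.
  have [h|h] := leP rho (mu / 2); first by rewrite lam_low // mul0r mulr0 mul0r.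
  apply: mulr_ge0; last by lra.
  by apply: mulr_ge0; [exact: ltW | exact: mulr_ge0].
move=> muy.
have rhoa : a <= rho.
  have := h1 x y (le_trans nwt tr1); have := h2 x y (le_trans nwt tr2) => hW hV.
  have : `|U y - U x| <= mu / 4.
    rewrite /U opprD addrACA -scalerBr; apply: le_trans (ler_normD _ _) _.
    rewrite normrZ; case/andP: s01 => s0 s1; rewrite (ger0_norm s0).
    by have := normr_ge0 (W y - W x); nra.
  have := ler_dist_dist (U y) (U x); rewrite ler_norml => /andP[_] h h'.
  by move: muy h h'; rewrite -/(U y) -/rho /a; lra.
apply: le_trans dec _; rewrite lerD2l lerN2 /b -[leRHS]mulrA ler_pM2l //.
rewrite lam_high; last by move: rhoa; rewrite /a; lra.
have k0 : 0 <= a / (1 + a) by rewrite divr_ge0 //; lra.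
have k1 : a / (1 + a) <= rho / (1 + rho).
  rewrite ler_pdivrMr; last by lra.
  by rewrite mulrAC ler_pdivlMr; [nra | lra].
have -> : (rho - mu / 2) / (1 + rho) ^+ 2 * rho * (rho - mu / 4) =
  (rho - mu / 2) * (rho - mu / 4) / (1 + rho) * (rho / (1 + rho)).
  by field; apply: lt0r_neq0; lra.
have : (rho / (1 + rho)) * (2 / 3) <= (rho - mu / 4) / (1 + rho).
  rewrite mulrAC ler_pM2r ?invr_gt0; last by lra.
  by move: rhoa; rewrite /a; lra.
move: k0 k1; set k := a / (1 + a); set K := rho / (1 + rho) => k0 k1 h.
have h' : a / 3 * (K * (2 / 3)) <= (rho - mu / 2) * ((rho - mu / 4) / (1 + rho)).
  have K0 : 0 <= K by exact: le_trans k0 k1.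
  by apply: ler_pM => //; [lra | lra | move: rhoa; rewrite /a; lra].
rewrite -[X in X * K]mulrA; set Z := (X in _ <= X * K) in h' *.
have hK : a / 3 * (K * (2 / 3)) * K <= Z * K by rewrite ler_wpM2r // (le_trans k0).
apply: le_trans hK.
have -> : a / 3 * (K * (2 / 3)) * K = a / 3 * (2 / 3) * K ^+ 2 by ring.
rewrite ler_wpM2l ?lerXn2r ?nnegrE //; first by lra.
exact: le_trans k1.
Qed.

(** Says that the minimax value of [A] is at most [l]. Staying at bounded distance from [iota] is
    stable under descent steps and is what makes Brouwer's theorem applicable to [g]. *)
Definition reach (iota : X -> X) A (l : R) := exists g : X -> X,
  [/\ continuous g, exists C : R, forall y, `|g y - iota y| <= C &
      forall y, A (g y) <= l].

(* The value [l] attained by the minimax sets moves by at most [d] along a family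
   in which [G], the derivative of the family, is at most [d] near critical points. *)
Lemma reach_continuation iota A V G W (mu d l M : R) :
  ugrad A V -> ugrad G W -> 0 < mu -> 0 <= d -> (forall x, `|G x| <= M) ->
  (forall s x, 0 <= s <= 1 -> `|V x + s *: W x| < mu -> G x <= d) ->
  reach iota A l -> reach iota (fun x => A x + G x) (l + d).
Proof.
move=> uA uG mu0 d0 GM crit rA.
have [b b0 step] := gradient_step uA uG mu0.
(* The increments of the parameter are so small that each costs at most M h <= b, the gain of one
   descent step. *)
have [k kM] : exists k : nat, M / b < k.+1%:R.
  by exists (Num.truncn (M / b)); apply: Num.Theory.truncnS_gt.
have k0 : 0 < k.+1%:R :> R by rewrite ltr0n.
pose h : R := k.+1%:R^-1; have h0 : 0 < h by rewrite invr_gt0.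
have Mh : M * h <= b.
  by rewrite ler_pdivrMr // mulrC -ler_pdivrMr // ltW.
have kh : k.+1%:R * h = 1 by rewrite mulfV // gt_eqF.
suff H i : (i <= k.+1)%N ->
    reach iota (fun x => A x + i%:R * h * G x) (l + i%:R * h * d).
  by have := H k.+1 (leqnn _); rewrite kh mul1r; under eq_fun do rewrite mul1r.
elim: i => [_|i IH ik].
  by rewrite !mul0r addr0; under eq_fun do rewrite !mul0r addr0.
have [g [gc [C gC] gl]] := IH (ltnW ik).
have s01 : 0 <= i%:R * h <= 1.
  rewrite mulr_ge0 ?(ltW h0) //= -[leRHS]kh ler_wpM2r ?(ltW h0) // ler_nat.
  exact: ltnW.
have [eta etac etaP] := step _ s01.
exists (eta \o g); split.
- by move=> y; apply: continuous_comp; [exact: gc | exact: etac].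
- exists (1 + C) => y /=; have [e1 _ _] := etaP (g y).
  rewrite -(subrKA (g y)); apply: le_trans (ler_normD _ _) _.
  by rewrite lerD // gC.
move=> y /=; have [_ e2 e3] := etaP (g y); have := gl y.
have := GM (eta (g y)); rewrite ler_norml => /andP[_ GMy] gly.
rewrite -natr1 !mulrDl mul1r.
have hd : 0 <= h * d by rewrite mulr_ge0 // ltW.
(* Near a critical point the increment costs h G <= h d; elsewhere the descent step has already paid
   for it. *)
have [lt|ge] := ltP `|V (eta (g y)) + (i%:R * h) *: W (eta (g y))| mu.
  have : h * G (eta (g y)) <= h * d by rewrite ler_pM2l // (crit _ _ s01).
  lra.
have : h * G (eta (g y)) <= h * M by rewrite ler_pM2l.
have := e3 ge; lra.
Qed.

End UniformGradient.

(** * The discretised action functional *)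

Lemma continuous_sub_comp (R : realType) (X : normedModType R) (g h : X -> X) (y : X) :
  continuous g -> continuous h -> continuous (fun x => y - h (g x - h x)).
Proof.
move=> gc hc x; apply: cvgB; first exact: cvg_cst.
apply: (@continuous_comp _ _ _ (fun x => g x - h x) h); last exact: hc.
by apply: cvgB; [exact: gc | exact: hc].
Qed.

Section QuadraticPart.
Context {R : realType} {n M : nat}.
Local Notation X := 'M[R]_(M.+1, n + n).
Implicit Types x y w : X.

Definition qc x i (k : 'I_n) : R := x i (lshift n k).
Definition pc x i (k : 'I_n) : R := x i (rshift n k).
Definition mk_qp (a b : 'I_M.+1 -> 'I_n -> R) : X :=
  \matrix_(i, j) match fintype.split j with inl k => a i k | inr k => b i k end.

Lemma qc_mk a b i k : qc (mk_qp a b) i k = a i k.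
Proof. by rewrite /qc mxE (unsplitK (inl k : _ + _)). Qed.

Lemma pc_mk a b i k : pc (mk_qp a b) i k = b i k.
Proof. by rewrite /pc mxE (unsplitK (inr k : _ + _)). Qed.

Lemma qp_eq x y :
  (forall i k, qc x i k = qc y i k) -> (forall i k, pc x i k = pc y i k) -> x = y.
Proof.
move=> hq hp; apply/matrixP => i j; rewrite -(splitK j).
by case: (fintype.split j) => k /=; [exact: hq | exact: hp].
Qed.

Lemma norm_qp_le x (c : R) : 0 <= c ->
  (forall i k, `|qc x i k| <= c) -> (forall i k, `|pc x i k| <= c) -> `|x| <= c.
Proof.
move=> c0 hq hp; apply: norm_le_entries => // i j; rewrite -(splitK j).
by case: (fintype.split j) => k /=; [exact: hq | exact: hp].
Qed.

Lemma qc_le x i k : `|qc x i k| <= `|x|. Proof. exact: entry_le_norm. Qed.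
Lemma pc_le x i k : `|pc x i k| <= `|x|. Proof. exact: entry_le_norm. Qed.

Lemma qcB x y i k : qc (x - y) i k = qc x i k - qc y i k.
Proof. by rewrite /qc !mxE. Qed.
Lemma pcB x y i k : pc (x - y) i k = pc x i k - pc y i k.
Proof. by rewrite /pc !mxE. Qed.

Lemma dot_qp x y :
  dot x y = \sum_i \sum_k (qc x i k * qc y i k + pc x i k * pc y i k).
Proof. by apply: eq_bigr => i _; rewrite big_split_ord big_split. Qed.

Definition area x y : R := \sum_i \sum_k pc x i k * (qc y (ordS i) k - qc y i k).

(* The discrete symplectic area of the closed polygon [x]; a critical point of
   [Qform x - \sum_i h_i (row i x)] is a closed orbit of the symplectic Euler scheme. *)
Definition Qform x := area x x.

Definition Qgrad x : X :=
  mk_qp (fun i k => pc x (ord_pred i) k - pc x i k)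
        (fun i k => qc x (ordS i) k - qc x i k).

Lemma QgradB x y : Qgrad (x - y) = Qgrad x - Qgrad y.
Proof.
by apply: qp_eq => i k; rewrite ?(qcB, pcB, qc_mk, pc_mk); ring.
Qed.

Lemma Qgrad_le x : `|Qgrad x| <= 2 * `|x|.
Proof.
apply: norm_qp_le => [|i k|i k]; first by rewrite mulr_ge0.
  rewrite qc_mk mulr_natl; apply: le_trans (ler_normB _ _) _.
  by rewrite mulr2n lerD // pc_le.
rewrite pc_mk mulr_natl; apply: le_trans (ler_normB _ _) _.
by rewrite mulr2n lerD // qc_le.
Qed.

Lemma dot_Qgrad x w : dot (Qgrad x) w = area x w + area w x.
Proof.
rewrite dot_qp /area.
transitivity (\sum_i \sum_k pc x (ord_pred i) k * qc w i k +
   \sum_i \sum_k (pc w i k * (qc x (ordS i) k - qc x i k) - pc x i k * qc w i k)).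
  rewrite -big_split; apply: eq_bigr => i _; rewrite -big_split; apply: eq_bigr => k _.
  by rewrite /= qc_mk pc_mk; ring.
rewrite (reindex_inj (@ordS_inj _)) /= -!big_split; apply: eq_bigr => i _.
rewrite -!big_split; apply: eq_bigr => k _ /=.
by rewrite ordSK; ring.
Qed.

Lemma Qform_le w : `|Qform w| <= (M.+1 * n)%:R * (2 * `|w| ^+ 2).
Proof.
have -> : (M.+1 * n)%:R * (2 * `|w| ^+ 2) = \sum_(i < M.+1) \sum_(k < n) (2 * `|w| ^+ 2).
  by rewrite !sumr_const !card_ord -mulrnA mulnC mulr_natl.
apply: le_trans (ler_norm_sum _ _ _) _; apply: ler_sum => i _.
apply: le_trans (ler_norm_sum _ _ _) _; apply: ler_sum => k _.
rewrite normrM expr2 mulrCA ler_pM // ?pc_le //.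
by apply: le_trans (ler_normB _ _) _; rewrite mulr_natl mulr2n lerD // qc_le.
Qed.

Lemma ugrad_Qform : ugrad Qform Qgrad.
Proof.
split=> e e0.
  exists (e / 2); first by lra.
  move=> x y h; rewrite -QgradB; apply: le_trans (Qgrad_le _) _; lra.
pose c : R := (M.+1 * n)%:R * 2 + 1.
have c0 : 0 < c by rewrite ltr_wpDl // mulr_ge0.
exists (e / c); first by rewrite divr_gt0.
move=> x y; rewrite ler_pdivlMr // => h; set w := y - x in h *.
have -> : Qform y - Qform x - dot (Qgrad x) w = Qform w.
  rewrite dot_Qgrad /Qform /area -!sumrB -big_split -sumrB; apply: eq_bigr => i _ /=.
  rewrite -!sumrB -big_split -sumrB; apply: eq_bigr => k _ /=.
  by rewrite /w !qcB !pcB; ring.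
apply: le_trans (Qform_le w) _.
have := normr_ge0 w; move: h; rewrite /c => h w0; rewrite expr2; nra.
Qed.

(** The polygon is closed, so the increments of [q] add up to zero and a constant may be subtracted
    from [p]. *)
Lemma Qform_centered x : Qform x = \sum_(i | i != ord_max) \sum_k
  (pc x i k - pc x ord_max k) * (qc x (ordS i) k - qc x i k).
Proof.
have -> : \sum_(i | i != ord_max) \sum_k
    (pc x i k - pc x ord_max k) * (qc x (ordS i) k - qc x i k) =
   \sum_i \sum_k (pc x i k - pc x ord_max k) * (qc x (ordS i) k - qc x i k).
  rewrite [RHS](bigD1 ord_max) //= [X in _ = X + _]big1 ?add0r // => k _.
  by rewrite subrr mul0r.
apply/eqP; rewrite -subr_eq0 /Qform /area -sumrB; apply/eqP.
under eq_bigr => i _.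
  rewrite -sumrB; under eq_bigr => k _ do rewrite -mulrBl opprB addrCA subrr addr0.
  over.
rewrite exchange_big big1 // => k _ /=; rewrite -mulr_sumr sumrB.
by rewrite [X in _ - X](reindex_inj (@ordS_inj _)) /= subrr mulr0.
Qed.

(* Projection onto the sum of the negative and null eigenspaces of [Qform], written
   in the coordinates q_0, p_M and [half_gap]; on the complement
   p_i - p_M = q_(i+1) - q_i and [Qform] is a sum of squares. *)
Definition half_gap x (i : 'I_M.+1) k : R :=
  if i == ord_max then 0
  else (pc x i k - pc x ord_max k - (qc x (ordS i) k - qc x i k)) / 2.

Definition proj_neg x : X :=
  mk_qp (fun i k => qc x ord0 k - \sum_(j : 'I_M.+1 | (j < i)%N) half_gap x j k)
        (fun i k => pc x ord_max k + half_gap x i k).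

Lemma pc_proj_neg_max x k : pc (proj_neg x) ord_max k = pc x ord_max k.
Proof. by rewrite pc_mk /half_gap eqxx addr0. Qed.

Lemma qc_proj_neg0 x k : qc (proj_neg x) ord0 k = qc x ord0 k.
Proof. by rewrite qc_mk big1 ?subr0. Qed.

Lemma qc_proj_negS x i k : i != ord_max ->
  qc (proj_neg x) (ordS i) k - qc (proj_neg x) i k = - half_gap x i k.
Proof.
move=> im; rewrite !qc_mk.
have Si : ordS i = i.+1 :> nat.
  rewrite /= modn_small // ltnS ltn_neqAle -ltnS ltn_ord andbT.
  by rewrite -val_eqE in im.
have -> : \sum_(j : 'I_M.+1 | (j < ordS i)%N) half_gap x j k =
    half_gap x i k + \sum_(j : 'I_M.+1 | (j < i)%N) half_gap x j k.
  rewrite (bigD1 i); last by rewrite Si.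
  congr (_ + _); apply: eq_bigl => j.
  by rewrite Si ltnS -val_eqE /= andbC -ltn_neqAle.
by ring.
Qed.

Lemma half_gap_proj_neg x i k : half_gap (proj_neg x) i k = half_gap x i k.
Proof.
rewrite [LHS]/half_gap; case: ifPn => im; first by rewrite /half_gap im.
rewrite qc_proj_negS // pc_proj_neg_max pc_mk; lra.
Qed.

Lemma proj_neg_idem x : proj_neg (proj_neg x) = proj_neg x.
Proof.
apply: qp_eq => i k.
  rewrite [LHS]qc_mk [RHS]qc_mk qc_proj_neg0.
  by under eq_bigr do rewrite half_gap_proj_neg.
by rewrite [LHS]pc_mk [RHS]pc_mk pc_proj_neg_max half_gap_proj_neg.
Qed.

Lemma half_gapB x y i k : half_gap (x - y) i k = half_gap x i k - half_gap y i k.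
Proof. by rewrite /half_gap; case: ifP => _; rewrite ?subrr // !qcB !pcB; lra. Qed.

Lemma proj_negB x y : proj_neg (x - y) = proj_neg x - proj_neg y.
Proof.
apply: qp_eq => i k; rewrite ?(qcB, pcB) ?qc_mk ?pc_mk ?qcB ?pcB ?half_gapB; last by ring.
under eq_bigr do rewrite half_gapB.
by rewrite sumrB; ring.
Qed.

Lemma half_gap_le x i k : `|half_gap x i k| <= 2 * `|x|.
Proof.
rewrite /half_gap; case: ifP => _; first by rewrite normr0 mulr_ge0.
have := pc_le x i k; have := pc_le x ord_max k.
have := qc_le x i k; have := qc_le x (ordS i) k; rewrite !ler_norml; lra.
Qed.

Lemma proj_neg_le x : `|proj_neg x| <= (M.*2.+3)%:R * `|x|.
Proof.
apply: norm_qp_le => [|i k|i k]; first by rewrite mulr_ge0.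
  rewrite qc_mk; apply: le_trans (ler_normB _ _) _.
  have : `|\sum_(j < M.+1 | (j < i)%N) half_gap x j k| <= \sum_(j < M.+1) 2 * `|x|.
    apply: le_trans (ler_norm_sum _ _ _) _; rewrite big_mkcond /=.
    apply: ler_sum => j _; case: ifP => _; first exact: half_gap_le.
    by rewrite mulr_ge0.
  rewrite sumr_const card_ord -[leRHS]mulr_natl mulrA -natrM => h.
  have := qc_le x ord0 k => h'; apply: le_trans (lerD h' h) _.
  by rewrite -[X in X + _]mul1r -mulrDl -(natrD _ 1) ler_wpM2r // ler_nat; lia.
rewrite pc_mk; apply: le_trans (ler_normD _ _) _.
apply: le_trans (lerD (pc_le x ord_max k) (half_gap_le x i k)) _.
by rewrite -[X in X + _]mul1r -mulrDl -(natrD _ 1) ler_wpM2r // ler_nat; lia.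
Qed.

Lemma continuous_proj_neg : continuous proj_neg.
Proof.
apply: unif_cont_continuous => e e0.
have c0 : 0 < (M.*2.+3)%:R :> R by rewrite ltr0n.
exists (e / (M.*2.+3)%:R); first by rewrite divr_gt0.
move=> x y; rewrite ler_pdivlMr // => h.
by rewrite -proj_negB; apply: le_trans (proj_neg_le _) _; rewrite mulrC.
Qed.

(** On the range of the projection p_i - p_M = -(q_(i+1) - q_i), so every term of the centred form
    is minus a square. *)
Lemma Qform_proj_neg_le0 x : Qform (proj_neg x) <= 0.
Proof.
rewrite Qform_centered; apply: sumr_le0 => i im; apply: sumr_le0 => k _.
rewrite qc_proj_negS // pc_proj_neg_max pc_mk addrC addKr mulrN oppr_le0.
by rewrite -expr2 sqr_ge0.
Qed.

Lemma reach_Qform : reach proj_neg Qform 0.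
Proof.
exists proj_neg; split; first exact: continuous_proj_neg.
  by exists 0 => y; rewrite subrr normr0.
exact: Qform_proj_neg_le0.
Qed.

(** Linking: the deformed negative space meets the fibre of the projection over [y]. At a fixed
    point z = y - P (g z - P z) one gets P z = z, then P (g z) = y; the right-hand side is bounded
    because [g] is at bounded distance from the projection P. *)
Lemma reach_linking A l y : reach proj_neg A l -> proj_neg y = y ->
  exists2 x, proj_neg x = y & A x <= l.
Proof.
move=> [g [gc [C gC] gl]] yE.
pose f x := y - proj_neg (g x - proj_neg x).
have fc : continuous f.
  exact: continuous_sub_comp gc continuous_proj_neg.
have fB x : `|f x| <= `|y| + (M.*2.+3)%:R * C.
  apply: le_trans (ler_normB _ _) _; rewrite lerD2l.
  by apply: le_trans (proj_neg_le _) _; rewrite ler_wpM2l.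
have [z fz] := brouwer_bounded fc fB.
exists (g z); last exact: gl.
have zE : proj_neg z = z by rewrite -fz /f !proj_negB !proj_neg_idem yE.
move: fz; rewrite /f proj_negB proj_neg_idem zE opprB addrA addrAC.
by rewrite -[RHS]add0r => /addIr/eqP; rewrite subr_eq0 => /eqP.
Qed.

End QuadraticPart.

(** * Symplectic Euler steps and the change of a function along them *)

Section DiscreteOrbits.
Context {R : realType} {n : nat}.
Local Notation E := 'rV[R]_(n + n).
Implicit Types (F G : E -> R) (V W : E -> E) (z w : E).

Definition bracket V W z : R :=
  \sum_(k < n) (V z 0 (lshift n k) * W z 0 (rshift n k)
                - V z 0 (rshift n k) * W z 0 (lshift n k)).

Lemma bracket_self V z : bracket V V z = 0.
Proof. by rewrite /bracket big1 // => k _; rewrite mulrC subrr. Qed.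

Lemma norm_split_le z (c : R) : 0 <= c ->
  (forall k : 'I_n, `|z 0 (lshift n k)| <= c) ->
  (forall k : 'I_n, `|z 0 (rshift n k)| <= c) -> `|z| <= c.
Proof.
move=> c0 hl hr; apply: norm_le_entries => // i j; rewrite (ord1 i) -(splitK j).
by case: (fintype.split j) => k /=; [exact: hl | exact: hr].
Qed.

(** The q-equation reads the gradient at the old point and the p-equation at the new one, as in the
    critical point equations of the action. *)
Definition euler_step V (s eta : R) z w :=
  (forall k : 'I_n, `|w 0 (lshift n k) - z 0 (lshift n k)
                      - s * V z 0 (rshift n k)| <= eta) /\
  (forall k : 'I_n, `|w 0 (rshift n k) - z 0 (rshift n k)
                      + s * V w 0 (lshift n k)| <= eta).

Lemma euler_step_dist V (B s eta t : R) z w :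
  (forall z, `|V z| <= B) -> `|s| <= t -> 0 <= eta -> euler_step V s eta z w ->
  `|w - z| <= t * B + eta.
Proof.
move=> VB st eta0 [h1 h2].
have B0 : 0 <= B := le_trans (normr_ge0 _) (VB 0).
have sV u j : `|s * V u 0 j| <= t * B.
  by rewrite normrM ler_pM // (le_trans (entry_le_norm _ _ _)).
apply: norm_split_le => [|k|k]; first by rewrite addr_ge0 // mulr_ge0 // (le_trans _ st).
  rewrite !mxE -[X in `|X|](subrK (s * V z 0 (rshift n k))).
  by apply: le_trans (ler_normD _ _) _; rewrite [leRHS]addrC; apply: lerD.
rewrite !mxE -[X in `|X|](addrK (s * V w 0 (lshift n k))).
by apply: le_trans (ler_normB _ _) _; rewrite [leRHS]addrC; apply: lerD.
Qed.

Lemma ugrad_unif_cont F V (B : R) : ugrad F V -> (forall z, `|V z| <= B) ->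
  forall e : R, 0 < e ->
  exists2 r : R, 0 < r & forall z w, `|w - z| <= r -> `|F w - F z| <= e.
Proof.
move=> [_ dF] VB e e0.
have B0 : 0 <= B := le_trans (normr_ge0 _) (VB 0).
have [r r0 hr] := dF 1 ltr01.
pose c : R := (1 * (n + n))%:R * B + 1.
have c0 : 0 < c by rewrite ltr_wpDl // mulr_ge0.
exists (Num.min r (e / c)); first by rewrite lt_min r0 divr_gt0.
move=> z w; rewrite le_min => /andP[/hr h1]; rewrite ler_pdivlMr // => h2.
have := norm_dot_le (V z) (w - z).
have : (1 * (n + n))%:R * `|V z| * `|w - z| <= (1 * (n + n))%:R * B * `|w - z|.
  by rewrite ler_wpM2r // ler_wpM2l.
move: h1 h2; rewrite mul1r /c mulrDr mulr1 [_ * (_ * B)]mulrC.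
by rewrite !ler_norml; lra.
Qed.

(** The discrete form of dG/dt = {G, F}. The p-equation reads [VF] at [w]; going back to [z] costs
    only the modulus of continuity of [VF], since a step has length O(t). *)
Lemma euler_step_change F VF G VG (B e : R) :
  ugrad F VF -> ugrad G VG -> (forall z, `|VF z| <= B) -> (forall z, `|VG z| <= B) ->
  0 < e -> exists2 r : R, 0 < r & forall t s z w, 0 < t <= r -> `|s| <= t ->
    euler_step VF s (r * t) z w ->
    `|G w - G z - s * bracket VG VF z| <= e * t.
Proof.
move=> [uF _] [_ dG] FB GB e0.
have B0 : 0 <= B := le_trans (normr_ge0 _) (FB 0).
pose c : R := n%:R * B + 1.
have nB0 : 0 <= n%:R * B by rewrite mulr_ge0.
have c0 : 0 < c by rewrite ltr_wpDl.
have e1 : 0 < e / (4 * c) by rewrite divr_gt0 // mulr_gt0.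
have e2 : 0 < e / (2 * (B + 1)) by rewrite divr_gt0 // mulr_gt0 //; lra.
have [r1 r10 h1] := uF _ e1; have [r2 r20 h2] := dG _ e2.
have B1 : 0 < B + 1 by lra.
(* [e / 2] pays for the errors in the two equations and for moving [VF] from [w] to [z], [e / 2] for
   the remainder of [G]; [r1] and [r2] are divided by [B + 1] because a step has length at most t (B
   + 1). *)
pose r := Num.min (Num.min 1 (e / (8 * c))) (Num.min (r1 / (B + 1)) (r2 / (B + 1))).
have r0 : 0 < r by rewrite !lt_min ltr01 !divr_gt0 // mulr_gt0.
have [ra rb rc rd] : [/\ r <= 1, r <= e / (8 * c), r <= r1 / (B + 1) & r <= r2 / (B + 1)].
  by rewrite /r !ge_min !lexx !orbT.
exists r => // t s z w /andP[t0 tr] st step.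
have rt0 : 0 <= r * t by rewrite mulr_ge0 // ltW.
have dist : `|w - z| <= t * (B + 1).
  apply: le_trans (euler_step_dist FB st rt0 step) _.
  by rewrite mulrDr lerD2l mulr1 ler_piMl // ltW.
have tB1 : t * (B + 1) <= r1.
  by rewrite -ler_pdivlMr // (le_trans tr).
have tB2 : t * (B + 1) <= r2.
  by rewrite -ler_pdivlMr // (le_trans tr).
have VFd := h1 z w (le_trans dist tB1).
have Gd := h2 z w (le_trans dist tB2).
have part1 : `|dot (VG z) (w - z) - s * bracket VG VF z| <= e / 2 * t.
  rewrite /dot big_ord1 big_split_ord /= /bracket mulr_sumr -!big_split -sumrB /=.
  apply: (@le_trans _ _ (\sum_(k < n) (B * (2 * (r * t) + t * (e / (4 * c)))))); last first.
    rewrite sumr_const card_ord -[leLHS]mulr_natl.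
    have -> : n%:R * (B * (2 * (r * t) + t * (e / (4 * c)))) = (n%:R * B) * (2 * r + e / (4 * c)) * t by ring.
    rewrite ler_pM2r //; apply: (@le_trans _ _ (c * (2 * (e / (8 * c)) + e / (4 * c)))).
      have nBc : n%:R * B <= c by rewrite lerDl.
      apply: ler_pM => //; first by apply: addr_ge0; [apply: mulr_ge0 => //; exact: ltW | exact: ltW].
      by rewrite lerD2r ler_wpM2l.
    by rewrite le_eqVlt; apply/orP; left; apply/eqP; field; rewrite gt_eqF.
  apply: le_trans (ler_norm_sum _ _ _) _; apply: ler_sum => k _.
  case: step => /(_ k) s1 /(_ k) s2; rewrite !mxE.
  set zl := z 0 _ in s1 s2 *; set wl := w 0 _ in s1 s2 *.
  have a1 := le_trans (entry_le_norm (VG z) 0 (lshift n k)) (GB z).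
  have a2 := le_trans (entry_le_norm (VG z) 0 (rshift n k)) (GB z).
  have a3 := le_trans (entry_le_norm (VF w - VF z) 0 (lshift n k)) VFd.
  rewrite !mxE in a3.
  set gl := VG z 0 (lshift n k) in a1 *; set gr := VG z 0 (rshift n k) in a2 *.
  set e1' := _ - s * _ in s1; set e2' := _ + s * _ in s2.
  set D := VF w 0 _ - _ in a3.
  set X := (X in `|X| <= _).
  have -> : X = gl * e1' + gr * (e2' - s * D) by rewrite /X /e1' /e2' /D; ring.
  apply: le_trans (ler_normD _ _) _; rewrite !normrM.
  have : `|gl| * `|e1'| <= B * (r * t) by rewrite ler_pM.
  have : `|gr| * `|e2' - s * D| <= B * (r * t + t * (e / (4 * c))).
    rewrite ler_pM // (le_trans (ler_normB _ _)) // lerD // normrM ler_pM //.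
  lra.
have part2 : e / (2 * (B + 1)) * `|w - z| <= e / 2 * t.
  apply: le_trans (ler_wpM2l (ltW e2) dist) _.
  by rewrite le_eqVlt; apply/orP; left; apply/eqP; field; rewrite gt_eqF.
rewrite -(subrKA (dot (VG z) (w - z))).
apply: le_trans (ler_normD _ _) _.
by rewrite (splitr e) mulrDl lerD // (le_trans Gd).
Qed.

Lemma euler_chain VF VG G (s eta e t : R) (z : nat -> E) (a b : nat) : (a <= b)%N ->
  (forall i, (a <= i < b)%N -> euler_step VF s eta (z i) (z i.+1)) ->
  (forall z w, euler_step VF s eta z w -> `|G w - G z - s * bracket VG VF z| <= e * t) ->
  `|G (z b) - G (z a) - s * \sum_(a <= i < b) bracket VG VF (z i)|
    <= (b - a)%:R * (e * t).
Proof.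
move=> ab st h; elim: b ab st => [|b IH]; rewrite ?leqn0.
  by move=> /eqP -> _; rewrite big_geq // mulr0 !subrr normr0 subnn mul0r.
rewrite leq_eqVlt => /orP[/eqP <- _|ab st].
  by rewrite big_geq // mulr0 !subrr normr0 subnn mul0r.
have {}IH : `|G (z b) - G (z a) - s * \sum_(a <= i < b) bracket VG VF (z i)|
    <= (b - a)%:R * (e * t).
  by apply: IH => // i ib; apply: st; lia.
rewrite big_nat_recr //=; set S := \sum_(_ <= _ < _) _ in IH *.
have h1 : euler_step VF s eta (z b) (z b.+1) by apply: st; lia.
rewrite subSn // -natr1 mulrDl mul1r.
have -> : G (z b.+1) - G (z a) - s * (S + bracket VG VF (z b)) =
  (G (z b) - G (z a) - s * S) + (G (z b.+1) - G (z b) - s * bracket VG VF (z b)) by ring.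
by apply: le_trans (ler_normD _ _) _; apply: lerD => //; exact: h.
Qed.

End DiscreteOrbits.

(** * Small energy of the loop, and displacement of the ball *)

Section OrbitEstimates.
Context {R : realType} {n : nat}.
Local Notation E := 'rV[R]_(n + n).

Lemma euler_step_weaken (V : E -> E) (s eta eta' : R) z w :
  eta <= eta' -> euler_step V s eta z w -> euler_step V s eta' z w.
Proof.
by move=> le [h1 h2]; split=> k; [exact: le_trans (h1 k) le | exact: le_trans (h2 k) le].
Qed.

(** Each Hamiltonian is nearly preserved by its own steps. So any value of [H] in the second half is
    compared with one of [Hj] in the first through the seam, where the two functions differ by at
    most [ej]. The gradient bound [B] influences [r] only, not the final estimate. *)
Lemma energy_drift (H Hj : E -> R) (V Vj : E -> E) (B ej eps : R) :
  ugrad H V -> ugrad Hj Vj -> (forall z, `|V z| <= B) -> (forall z, `|Vj z| <= B) ->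
  (forall z, `|Hj z - H z| <= ej) -> 0 < eps ->
  exists2 r : R, 0 < r & forall (m : nat) (t th : R) (z : nat -> E),
    0 < t <= r -> m%:R * t <= 1 -> 0 <= th <= 1 ->
    (forall i, (0 < i < m)%N -> euler_step Vj (th * t) (r * t) (z i) (z i.+1)) ->
    (forall i, (m < i < m + m)%N -> euler_step V (- (th * t)) (r * t) (z i) (z i.+1)) ->
    `|z m.+1 - z m| <= t * B + r * t ->
    `|t * \sum_(0 <= i < m) (H (z (m + i).+1) - Hj (z i.+1))| <= ej + eps.
Proof.
move=> uH uHj VB VjB HjH eps0.
have B0 : 0 <= B := le_trans (normr_ge0 _) (VB 0).
have ej0 : 0 <= ej := le_trans (normr_ge0 _) (HjH 0).
have e3 : 0 < eps / 3 by lra.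
have [r1 r10 h1] := euler_step_change uH uH VB VB e3.
have [r2 r20 h2] := euler_step_change uHj uHj VjB VjB e3.
have [r3 r30 h3] := ugrad_unif_cont uH VB e3.
have B1 : 0 < B + 1 by lra.
pose r := Num.min (Num.min 1 r1) (Num.min r2 (r3 / (B + 1))).
have r0 : 0 < r by rewrite !lt_min ltr01 r10 r20 divr_gt0.
have [ra rb rc rd] : [/\ r <= 1, r <= r1, r <= r2 & r <= r3 / (B + 1)].
  by rewrite /r !ge_min !lexx !orbT.
exists r => // m t th z /andP[t0 tr] mt /andP[th0 th1] ph2 ph3 junc.
have tht : `|th * t| <= t by rewrite ger0_norm ?mulr_ge0 ?ler_piMl // ltW.
have chain_small (G : E -> R) W s a b : (a <= b)%N -> (b - a <= m)%N ->
    (forall z w, euler_step W s (r * t) z w ->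
      `|G w - G z - s * bracket W W z| <= eps / 3 * t) ->
    (forall i, (a <= i < b)%N -> euler_step W s (r * t) (z i) (z i.+1)) ->
    `|G (z b) - G (z a)| <= eps / 3.
  move=> ab bam stepG st; have := euler_chain ab st stepG.
  rewrite big1; last by move=> i _; rewrite bracket_self.
  rewrite mulr0 subr0 => /le_trans; apply.
  have : (b - a)%:R * t <= 1.
    by apply: le_trans mt; rewrite ler_wpM2r ?(ltW t0) // ler_nat.
  by move=> h; rewrite mulrCA ler_piMr // ltW.
have st1 z' w : euler_step V (- (th * t)) (r * t) z' w ->
    `|H w - H z' - - (th * t) * bracket V V z'| <= eps / 3 * t.
  move=> st; apply: h1; rewrite ?t0 ?(le_trans tr) ?normrN //.
  by apply: euler_step_weaken st; rewrite ler_pM2r.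
have st2 z' w : euler_step Vj (th * t) (r * t) z' w ->
    `|Hj w - Hj z' - (th * t) * bracket Vj Vj z'| <= eps / 3 * t.
  move=> st; apply: h2; rewrite ?t0 ?(le_trans tr) //.
  by apply: euler_step_weaken st; rewrite ler_pM2r.
have hj : `|H (z m.+1) - H (z m)| <= eps / 3.
  apply: h3; apply: le_trans junc _.
  have : t * (B + 1) <= r3 by rewrite -ler_pdivlMr // (le_trans tr).
  have : r * t <= t by rewrite ler_piMl // ltW.
  by lra.
have term i : (i < m)%N -> `|H (z (m + i).+1) - Hj (z i.+1)| <= ej + eps.
  move=> im.
  have p1 : `|H (z (m + i).+1) - H (z m.+1)| <= eps / 3.
    apply: (chain_small H V (- (th * t)) m.+1 (m + i).+1) => //.
    - by rewrite ltnS leq_addr.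
    - by rewrite subSS addKn ltnW.
    - move=> j /andP[j1 j2]; apply: ph3; rewrite j1 (leq_trans j2) //.
      by rewrite ltn_add2l.
  have p2 : `|Hj (z m) - Hj (z i.+1)| <= eps / 3.
    apply: (chain_small Hj Vj (th * t) i.+1 m) => //.
    - by rewrite leq_subr.
    - by move=> j /andP[j1 j2]; apply: ph2; rewrite j2 (leq_trans _ j1).
  have := HjH (z m); move: p1 p2 hj; rewrite !ler_norml; lra.
rewrite normrM (gtr0_norm t0).
apply: (@le_trans _ _ (t * (m%:R * (ej + eps)))).
  rewrite ler_pM2l // big_mkord; apply: le_trans (ler_norm_sum _ _ _) _.
  rewrite -[m in m%:R]card_ord mulr_natl -sumr_const; apply: ler_sum => i _.
  exact: term.
by rewrite mulrA [t * _]mulrC ler_piMl // addr_ge0 // ltW.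
Qed.

(** Both ends of the orbit are near [x0], so [K] takes almost the same value there. In the first
    half [Kj] changes by at most ej + eps, and passing between [K] and [Kj] costs 2 ej. In the
    second half the bracket is at least c / 2 and [K] changes by at least T c / 4 - eps. The
    remaining [eps] is spent at the seam. *)
Lemma bracket_displacement (H Hj K Kj : E -> R) (V Vj W Wj : E -> E)
    (B Bj ej eps eK c T d rc : R) (x0 : E) :
  ugrad H V -> ugrad Hj Vj -> ugrad K W -> ugrad Kj Wj ->
  (forall z, `|V z| <= B) -> (forall z, `|Vj z| <= Bj) ->
  (forall z, `|W z| <= B) -> (forall z, `|Wj z| <= Bj) ->
  (forall z, `|Kj z - K z| <= ej) -> (forall z, `|bracket Wj Vj z| <= ej) ->
  (forall z, `|z - x0| <= rc -> c / 2 <= bracket W V z) ->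
  (forall z, `|z - x0| <= d -> `|K z - K x0| <= eK) ->
  0 < c -> 0 < T <= 1 -> T * (B + 1) + d <= rc -> 0 < eps ->
  exists2 r : R, 0 < r & forall (m : nat) (t : R) (z : nat -> E),
    (1 < m)%N -> 0 < t <= r -> m%:R * t = T ->
    (forall i, (0 < i < m)%N -> euler_step Vj t (r * t) (z i) (z i.+1)) ->
    (forall i, (m < i < m + m)%N -> euler_step V (- t) (r * t) (z i) (z i.+1)) ->
    `|z m.+1 - z m| <= t * Bj + r * t ->
    `|z 1%N - x0| <= d -> `|z (m + m)%N - x0| <= d ->
    T * c / 4 <= 3 * eps + 2 * eK + 3 * ej.
Proof.
move=> uH uHj uK uKj VB VjB WB WjB KjK brj brc Kd c0 /andP[T0 T1] Trc eps0.
have B0 : 0 <= B := le_trans (normr_ge0 _) (VB 0).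
have ej0 : 0 <= ej := le_trans (normr_ge0 _) (KjK 0).
have [r1 r10 h1] := euler_step_change uH uK VB WB eps0.
have [r2 r20 h2] := euler_step_change uHj uKj VjB WjB eps0.
have [r3 r30 h3] := ugrad_unif_cont uK WB eps0.
have Bj0 : 0 <= Bj := le_trans (normr_ge0 _) (VjB 0).
have B1 : 0 < B + 1 by lra.
have Bj1 : 0 < Bj + 1 by lra.
pose r := Num.min (Num.min 1 r1) (Num.min r2 (r3 / (Bj + 1))).
have r0 : 0 < r by rewrite !lt_min ltr01 r10 r20 divr_gt0.
have [ra rb rc' rd] : [/\ r <= 1, r <= r1, r <= r2 & r <= r3 / (Bj + 1)].
  by rewrite /r !ge_min !lexx !orbT.
exists r => // m t z m1 /andP[t0 tr] mt ph2 ph3 junc zd1 zd2.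
have rt : r * t <= t by rewrite ler_piMl // ltW.
have tt : `|t| <= t by rewrite gtr0_norm.
have st1 z' w : euler_step V (- t) (r * t) z' w ->
    `|K w - K z' - - t * bracket W V z'| <= eps * t.
  move=> st; apply: h1; rewrite ?t0 ?(le_trans tr) ?normrN //.
  by apply: euler_step_weaken st; rewrite ler_pM2r.
have st2 z' w : euler_step Vj t (r * t) z' w ->
    `|Kj w - Kj z' - t * bracket Wj Vj z'| <= eps * t.
  move=> st; apply: h2; rewrite ?t0 ?(le_trans tr) //.
  by apply: euler_step_weaken st; rewrite ler_pM2r.
have hj : `|K (z m.+1) - K (z m)| <= eps.
  apply: h3; apply: le_trans junc _.
  have : t * (Bj + 1) <= r3 by rewrite -ler_pdivlMr // (le_trans tr).
  by lra.
have m1t : (m - 1)%:R * t <= T.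
  by rewrite -mt ler_wpM2r ?(ltW t0) // ler_nat leq_subr.
have mt0 : 0 <= (m - 1)%:R * t by rewrite mulr_ge0 // ltW.
(* The second half is followed backwards from its last node, known to be near [x0]; only the bound
   [B] of [V] enters, which does not depend on the approximation. *)
have near j : (j < m)%N -> `|z (m + m - j)%N - x0| <= rc.
  move=> jm; have jt : j%:R * t <= T by rewrite -mt ler_wpM2r ?(ltW t0) // ler_nat ltnW.
  suff : `|z (m + m - j)%N - z (m + m)%N| <= j%:R * t * (B + 1).
    move=> h; rewrite -(subrKA (z (m + m)%N)); apply: le_trans (ler_normD _ _) _.
    have : j%:R * t * (B + 1) <= T * (B + 1) by rewrite ler_wpM2r // ltW.
    lra.
  elim: j jm {jt} => [|j IH] jm; first by rewrite subn0 subrr normr0 !mul0r.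
  have st : euler_step V (- t) (r * t) (z (m + m - j.+1)%N) (z (m + m - j)%N).
    have -> : (m + m - j = (m + m - j.+1).+1)%N by clear -jm; lia.
    by apply: ph3; clear -jm; lia.
  have st' : `|- t| <= t by rewrite normrN.
  have rt0 : 0 <= r * t by rewrite mulr_ge0 // ltW.
  have := euler_step_dist VB st' rt0 st; rewrite distrC => dd.
  rewrite -(subrKA (z (m + m - j)%N)); apply: le_trans (ler_normD _ _) _.
  apply: le_trans (lerD dd (IH (ltnW jm))) _.
  by rewrite -natr1; lra.
have c2 : `|Kj (z m) - Kj (z 1%N)| <= ej + eps.
  have := euler_chain (ltnW m1) ph2 st2.
  set S := \sum_(_ <= _ < _) _ => h.
  have hS : `|t * S| <= ej.
    rewrite normrM gtr0_norm //; apply: (@le_trans _ _ (t * ((m - 1)%:R * ej))); last first.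
      by rewrite mulrA [t * _]mulrC ler_piMl // (le_trans m1t).
    rewrite ler_pM2l //; apply: le_trans (ler_norm_sum _ _ _) _.
    rewrite mulr_natl -sumr_const_nat; apply: ler_sum_nat => i _; exact: brj.
  have : (m - 1)%:R * (eps * t) <= eps by rewrite mulrCA ler_piMr ?(ltW eps0) // (le_trans m1t).
  move: h hS; rewrite !ler_norml; lra.
have c3 : T * c / 4 - eps <= K (z m.+1) - K (z (m + m)%N).
  have mm : (m.+1 <= m + m)%N by clear -m1; lia.
  have := euler_chain mm ph3 st1.
  set S := \sum_(_ <= _ < _) _; have -> : (m + m - m.+1 = m - 1)%N by clear; lia.
  move=> h; have hS : (m - 1)%:R * (c / 2) <= S.
    have -> : (m - 1)%:R * (c / 2) = \sum_(m.+1 <= i < m + m) (c / 2).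
      by rewrite sumr_const_nat mulr_natl; congr (_ *+ _); clear; lia.
    apply: ler_sum_nat => i im; apply: brc.
    have -> : i = (m + m - (m + m - i))%N by clear -im; lia.
    by apply: near; clear -im; lia.
  have : (m - 1)%:R * (eps * t) <= eps by rewrite mulrCA ler_piMr ?(ltW eps0) // (le_trans m1t).
  (* The second half has only m - 1 steps, and m - 1 >= m / 2 because m > 1: hence T c / 4 instead
     of T c / 2. *)
  have : T / 2 <= (m - 1)%:R * t.
    rewrite -mt mulrAC ler_wpM2r ?(ltW t0) // ler_pdivrMr // -natrM ler_nat; clear -m1; lia.
  have c20 : 0 <= c / 2 by lra.
  move=> /(ler_wpM2r c20) h2'.
  have : t * ((m - 1)%:R * (c / 2)) <= t * S by rewrite ler_pM2l.
  move: h h2'; rewrite mulrA [t * _]mulrC ler_norml; clear; lra.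
have k1 := Kd _ zd1; have k2 := Kd _ zd2.
have := KjK (z m); have := KjK (z 1%N); move: c2 hj k1 k2; rewrite !ler_norml; lra.
Qed.

End OrbitEstimates.

(** * Nearly critical polygons are approximate orbits of the loop *)

Section NearCritical.
Context {R : realType} {n : nat}.
Local Notation E := 'rV[R]_(n + n).

Definition on_row N (i0 : 'I_N) (V : E -> E) (x : 'M[R]_(N, n + n)) : 'M[R]_(N, n + n) :=
  \matrix_(i, j) if i == i0 then V (row i0 x) 0 j else 0.

Lemma norm_row_le N (x : 'M[R]_(N, n + n)) i : `|row i x| <= `|x|.
Proof. by apply: norm_le_entries => // a j; rewrite mxE entry_le_norm. Qed.

Lemma ugrad_on_row N (i0 : 'I_N) F V : ugrad F V ->
  ugrad (fun x => F (row i0 x)) (on_row i0 V).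
Proof.
move=> [uV dF]; split=> e e0.
  have [r r0 hr] := uV e e0; exists r => // x y yx.
  have : `|row i0 y - row i0 x| <= r by rewrite -linearB (le_trans (norm_row_le _ _)).
  move=> /hr h; apply: norm_le_entries => [|i j]; first exact: ltW.
  rewrite !mxE; case: eqP => _; last by rewrite subrr normr0 ltW.
  by apply: le_trans h; rewrite (le_trans _ (entry_le_norm _ 0 j)) // !mxE.
have [r r0 hr] := dF e e0; exists r => // x y yx.
have : `|row i0 y - row i0 x| <= r by rewrite -linearB (le_trans (norm_row_le _ _)).
move=> /hr; rewrite -linearB => h.
have -> : dot (on_row i0 V x) (y - x) = dot (V (row i0 x)) (row i0 (y - x)).
  rewrite /dot big_ord1 (bigD1 i0) //= [X in _ + X]big1 ?addr0 => [|i /negPf ii0].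
    by apply: eq_bigr => j _; rewrite !mxE eqxx.
  by rewrite big1 // => j _; rewrite mxE ii0 mul0r.
by apply: le_trans h _; rewrite ler_wpM2l ?norm_row_le // ltW.
Qed.

Variables (m : nat) (t : R) (H Hj f : E -> R) (V Vj Vf : E -> E).
Hypothesis m_gt0 : (0 < m)%N.
Hypothesis t_gt0 : 0 < t.

Local Notation N := (m + m).+1.
Local Notation X := 'M[R]_(N, n + n).

(* Follow [Hj] for the time [m * t], then [- H] for the same time. *)
Definition phase_fun (i : nat) : E -> R :=
  if i == 0%N then fun=> 0
  else if (i <= m)%N then fun z => - t * Hj z else fun z => t * H z.

Definition phase_grad (i : nat) : E -> E :=
  if i == 0%N then fun=> 0
  else if (i <= m)%N then fun z => - t *: Vj z else fun z => t *: V z.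

Definition loop_energy (x : X) : R := \sum_(i < N) phase_fun i (row i x).
Definition loop_grad (x : X) : X := \sum_(i < N) on_row i (phase_grad i) x.

Lemma ugrad_loop_energy : ugrad H V -> ugrad Hj Vj -> ugrad loop_energy loop_grad.
Proof.
move=> uH uHj; apply: ugrad_sum => i; apply: ugrad_on_row.
rewrite /phase_fun /phase_grad; case: ifP => _; first exact: ugrad0.
by case: ifP => _; exact: ugradZ.
Qed.

Lemma loop_gradE x i j : loop_grad x i j = phase_grad i (row i x) 0 j.
Proof.
rewrite /loop_grad summxE (bigD1 i) //= mxE eqxx big1 ?addr0 // => i' /negPf ii'.
by rewrite mxE eq_sym ii'.
Qed.

Definition node (x : X) (i : nat) : E := row (inord i) x.

Lemma loop_energyE x : loop_energy x =
  t * \sum_(0 <= i < m) (H (node x (m + i).+1) - Hj (node x i.+1)).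
Proof.
have -> : loop_energy x = \sum_(0 <= i < N) phase_fun i (node x i).
  by rewrite big_mkord; apply: eq_bigr => i _; rewrite /node inord_val.
rewrite big_nat_recl //= {1}/phase_fun eqxx add0r.
rewrite (big_cat_nat (n := m)) ?leq_addr //= addrC.
rewrite -{1}[m in X in X + _]add0n big_addn addKn -big_split /= mulr_sumr.
apply: eq_big_nat => i /andP[_ im]; rewrite /phase_fun /=.
by rewrite im ifF; [rewrite addnC; ring | lia].
Qed.

Lemma loop_energy_bounded : (exists b, forall z, `|H z| <= b) ->
  (exists b, forall z, `|Hj z| <= b) -> exists b, forall x, `|loop_energy x| <= b.
Proof.
move=> [b hb] [bj hbj]; exists (t * \sum_(0 <= i < m) (b + bj)) => x.
rewrite loop_energyE normrM gtr0_norm // ler_pM2l //.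
rewrite !big_mkord; apply: le_trans (ler_norm_sum _ _ _) _; apply: ler_sum => i _.
by apply: le_trans (ler_normB _ _) _; rewrite lerD.
Qed.

Variables (x : X) (sf th mu B rho : R).
Hypothesis crit : `|Qgrad x + sf *: on_row ord0 Vf x + th *: loop_grad x| <= mu.
Local Notation z := (node x).

(** Node 0 feels the bump only, since phase 0 of the loop is zero; the other nodes feel the loop
    only. *)
Let force (i : 'I_N) : E := (if i == ord0 then sf *: Vf (row i x) else 0)
  + th *: phase_grad i (row i x).

Let crit_q (i : 'I_N) k :
  `|qc x (ordS i) k - qc x i k + force i 0 (rshift n k)| <= mu.
Proof.
apply: le_trans crit; apply: le_trans (entry_le_norm _ i (rshift n k)).
rewrite /force /pc !mxE -loop_gradE (unsplitK (inr k : _ + _)) addrA.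
by case: eqP => [->|_]; rewrite !mxE ?mulr0.
Qed.

Let crit_p (i : 'I_N) k :
  `|pc x (ord_pred i) k - pc x i k + force i 0 (lshift n k)| <= mu.
Proof.
apply: le_trans crit; apply: le_trans (entry_le_norm _ i (lshift n k)).
rewrite /force !mxE -loop_gradE (unsplitK (inl k : _ + _)) addrA.
by case: eqP => [->|_]; rewrite !mxE ?mulr0.
Qed.

Let nodeS i k : (i < m + m)%N -> qc x (ordS (inord i)) k = z i.+1 0 (lshift n k).
Proof.
move=> im; rewrite /node mxE /qc; congr (x _ _); apply/val_inj.
by rewrite /= !inordK ?modn_small //; lia.
Qed.

Let nodeP i k : (i < m + m)%N -> pc x (ord_pred (inord i.+1)) k = z i 0 (rshift n k).
Proof.
move=> im; rewrite /node mxE /pc; congr (x _ _); apply/val_inj.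
by rewrite /= !inordK ?addSn /= ?modnDr ?modn_small //; lia.
Qed.

Let forceE (i : nat) : (0 < i <= m + m)%N -> force (inord i) = th *: phase_grad i (z i).
Proof.
move=> im; have iN : (i < N)%N by move: im; clear; lia.
rewrite /force inordK // ifF ?add0r //.
by apply/eqP => /(congr1 val); rewrite /= inordK //; move: im; clear; lia.
Qed.

Let z_q i k : qc x (inord i) k = z i 0 (lshift n k). Proof. by rewrite /node mxE. Qed.
Let z_p i k : pc x (inord i) k = z i 0 (rshift n k). Proof. by rewrite /node mxE. Qed.

Lemma node_step_forward i : (0 < i < m)%N -> euler_step Vj (th * t) mu (z i) (z i.+1).
Proof.
move=> im; split=> k.
  have := crit_q (inord i) k; rewrite nodeS ?z_q ?forceE; try lia.
  rewrite /phase_grad ifF ?ifT; try lia.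
  by rewrite !mxE mulNr mulrN mulrA.
have := crit_p (inord i.+1) k; rewrite nodeP ?z_p ?forceE; try lia.
rewrite /phase_grad /= ifT; try lia.
by rewrite !mxE mulNr mulrN mulrA -normrN !opprD !opprK [- _ + _]addrC.
Qed.

Lemma node_step_backward i : (m < i < m + m)%N ->
  euler_step V (- (th * t)) mu (z i) (z i.+1).
Proof.
move=> im; split=> k.
  have := crit_q (inord i) k; rewrite nodeS ?z_q ?forceE; try lia.
  rewrite /phase_grad ifF ?ifF; try lia.
  by rewrite !mxE mulNr opprK mulrA.
have := crit_p (inord i.+1) k; rewrite nodeP ?z_p ?forceE; try lia.
rewrite /phase_grad /= ifF; try lia.
by rewrite !mxE mulNr mulrA -normrN !opprD !opprK [- _ + _]addrC.
Qed.

Hypothesis th01 : 0 <= th <= 1.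
Hypothesis sf01 : 0 <= sf <= 1.
Hypothesis VB : forall w, `|V w| <= B.
Hypothesis VjB : forall w, `|Vj w| <= B.
Hypothesis Vfrho : forall w, `|Vf w| <= rho.

Let B_ge0 : 0 <= B. Proof. exact: le_trans (normr_ge0 _) (VB 0). Qed.
Let rho_ge0 : 0 <= rho. Proof. exact: le_trans (normr_ge0 _) (Vfrho 0). Qed.
Let mu_ge0 : 0 <= mu. Proof. exact: le_trans (normr_ge0 _) crit. Qed.

Let force_le (i : nat) j : (0 < i <= m + m)%N -> `|force (inord i) 0 j| <= t * B.
Proof.
move=> im; rewrite forceE // mxE; case/andP: th01 => th0 th1.
rewrite normrM ger0_norm // -[leRHS]mul1r ler_pM //.
rewrite /phase_grad ifF; last by case/andP: im; case: (i).
by case: ifP => _; rewrite mxE normrM ?normrN (gtr0_norm t_gt0) ler_wpM2l ?(ltW t_gt0) //;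
  apply: le_trans (entry_le_norm _ _ _) _.
Qed.

Let force0_le j : `|force ord0 0 j| <= rho.
Proof.
rewrite /force eqxx /phase_grad eqxx scaler0 addr0 mxE.
case/andP: sf01 => s0 s1; rewrite normrM ger0_norm // -[leRHS]mul1r ler_pM //.
exact: le_trans (entry_le_norm _ _ _) (Vfrho _).
Qed.

Let from_crit (a b c e : R) : `|a - b + c| <= mu -> `|c| <= e -> `|a - b| <= e + mu.
Proof. by rewrite !ler_norml; lra. Qed.

Let sub_entry (a b : E) j : (a - b) 0 j = a 0 j - b 0 j. Proof. by rewrite !mxE. Qed.
Let tB_ge0 : 0 <= t * B. Proof. by rewrite mulr_ge0 // ltW. Qed.
Let m_pos := m_gt0.

(** At the seam the q-equation is driven by [Hj] and the p-equation by [H]: it is a step of neither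
    scheme, and only its length is controlled. *)
Lemma node_junction : `|z m.+1 - z m| <= t * B + mu.
Proof.
apply: norm_split_le => [|k|k]; rewrite ?addr_ge0 // sub_entry.
  have := from_crit (crit_q (inord m) k) (force_le _ _).
  by rewrite nodeS ?z_q => [h|]; [apply: h|]; move: m_pos; clear; lia.
have := from_crit (crit_p (inord m.+1) k) (force_le _ _).
by rewrite nodeP ?z_p => [h|]; [rewrite distrC; apply: h|]; move: m_pos; clear; lia.
Qed.

(** Of the two equations between nodes 0 and 1, the q-equation carries the bump, of gradient at most
    [rho], and the p-equation the loop. In [node_last] the roles are exchanged. *)
Lemma node_first : `|z 1%N - z 0%N| <= rho + t * B + mu.
Proof.
have o0 : inord 0 = ord0 :> 'I_N by apply/val_inj; rewrite /= inordK.
apply: norm_split_le => [|k|k]; rewrite ?addr_ge0 // sub_entry.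
  have := from_crit (crit_q ord0 k) (force0_le _).
  rewrite -o0 nodeS ?z_q; last by move: m_pos; clear; lia.
  by move: tB_ge0; lra.
have := from_crit (crit_p (inord 1) k) (force_le _ _).
rewrite nodeP ?z_p; last by move: m_pos; clear; lia.
rewrite distrC => h; apply: le_trans (h _) _; first by move: m_pos; clear; lia.
by move: rho_ge0; lra.
Qed.

Lemma node_last : `|z (m + m)%N - z 0%N| <= rho + t * B + mu.
Proof.
have o0 : inord 0 = ord0 :> 'I_N by apply/val_inj; rewrite /= inordK.
have om : inord (m + m) = ord_max :> 'I_N by apply/val_inj; rewrite /= inordK.
have Sm : ordS ord_max = inord 0 :> 'I_N by apply/val_inj; rewrite /= inordK // modnn.
have P0 : ord_pred ord0 = inord (m + m) :> 'I_N.
  by apply/val_inj; rewrite /= inordK // modn_small.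
apply: norm_split_le => [|k|k]; rewrite ?addr_ge0 // sub_entry.
  have := from_crit (crit_q (inord (m + m)) k) (force_le _ _).
  rewrite {1}om Sm !z_q distrC => h; apply: le_trans (h _) _.
    by move: m_pos; clear; lia.
  by move: rho_ge0; lra.
have := from_crit (crit_p ord0 k) (force0_le _).
rewrite P0 -o0 !z_p.
by move: tB_ge0; lra.
Qed.

End NearCritical.

Lemma dot_sqrD (R : realType) p q (a b : 'M[R]_(p, q)) :
  dot (a + b) (a + b) = dot a a + 2 * dot b a + dot b b.
Proof. by rewrite dotDl 2![dot _ (a + b)]dotC !dotDl (dotC a b); ring. Qed.

(** * A C^1 bump with controlled gradient *)

Section Bump.
Context {R : realType} {d : nat}.
Local Notation E := 'rV[R]_d.
Variables (x0 : E) (rho : R).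
Hypothesis rho_gt0 : 0 < rho.

Let sq (z : E) : R := dot (z - x0) (z - x0).
Let pos (z : E) : R := Num.max 0 (rho ^+ 2 - sq z).

(** The square makes the function C^1, and the denominator bounds its gradient by [rho]. *)
Definition bump_fun (z : E) : R := pos z ^+ 2 / (4 * rho ^+ 2).
Definition bump_grad (z : E) : E := - (pos z / rho ^+ 2) *: (z - x0).

Let rho2_gt0 : 0 < rho ^+ 2. Proof. exact: exprn_gt0. Qed.

Let sq_ge0 z : 0 <= sq z.
Proof. exact: le_trans (sqr_ge0 _) (sqr_norm_le_dot _). Qed.

Let pos_bound z : 0 <= pos z <= rho ^+ 2.
Proof. by have := sq_ge0 z; rewrite /pos /Num.max; case: ifPn; have := rho2_gt0; lra. Qed.

Let pos_far z : rho <= `|z - x0| -> pos z = 0.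
Proof.
move=> h; have : rho ^+ 2 <= sq z.
  by apply: le_trans (sqr_norm_le_dot _); rewrite lerXn2r ?nnegrE // ltW.
by rewrite /pos /Num.max; case: ifPn => //; lra.
Qed.

Lemma bump_ge0 z : 0 <= bump_fun z.
Proof. by rewrite divr_ge0 ?sqr_ge0 // mulr_ge0 // ltW. Qed.

Lemma bump_le z : bump_fun z <= rho ^+ 2.
Proof.
have := pos_bound z; have := rho2_gt0.
rewrite /bump_fun ler_pdivrMr; last by rewrite mulr_gt0.
by set r := rho ^+ 2 => r0 /andP[p0 p1]; rewrite expr2; nra.
Qed.

Lemma bump_far z : rho <= `|z - x0| -> bump_fun z = 0.
Proof. by move=> /pos_far h; rewrite /bump_fun h expr0n mul0r. Qed.

(** Near [x0] the bump is large, elsewhere the squared distance is. In the linking argument the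
    quadratic form supplies the squared distance, so this is the definite positive action. *)
Lemma bump_add_sq z : rho ^+ 2 / 16 <= bump_fun z + dot (z - x0) (z - x0).
Proof.
have := bump_ge0 z; have := sq_ge0 z; rewrite -/(sq z).
have [h|h] := leP (rho ^+ 2 / 2) (sq z); first by have := rho2_gt0; lra.
move=> s0 _; suff : rho ^+ 2 / 16 <= bump_fun z by lra.
rewrite /bump_fun ler_pdivlMr; last by rewrite mulr_gt0.
have : rho ^+ 2 / 2 <= pos z by rewrite /pos /Num.max; case: ifPn; have := rho2_gt0; lra.
by have := rho2_gt0; set r := rho ^+ 2 => r0 p; rewrite expr2; nra.
Qed.

Lemma bump_grad_le z : `|bump_grad z| <= rho.
Proof.
rewrite /bump_grad normrZ normrN.
have [h|h] := leP rho `|z - x0|; first by rewrite pos_far // mul0r normr0 mul0r ltW.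
have /andP[p0 p1] := pos_bound z.
rewrite ger0_norm ?divr_ge0 ?(ltW rho2_gt0) // -[leRHS]mul1r ler_pM ?divr_ge0 ?(ltW rho2_gt0) //.
  by rewrite ler_pdivrMr // mul1r.
exact: ltW.
Qed.

Let Nc : R := (1 * d)%:R.

Let sq_diff x y : `|x - x0| <= 2 * rho -> `|y - x| <= rho ->
  `|sq y - sq x| <= 5 * Nc * rho * `|y - x|.
Proof.
move=> hx hw.
have -> : sq y - sq x = dot (y - x) (y - x) + 2 * dot (x - x0) (y - x).
  have -> : sq y = dot ((y - x) + (x - x0)) ((y - x) + (x - x0)) by rewrite subrKA.
  by rewrite dot_sqrD /sq; ring.
apply: le_trans (ler_normD _ _) _; rewrite normrM ger0_norm //.
have Nc0 : 0 <= Nc by [].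
have h1 := norm_dot_le (y - x) (y - x); have h2 := norm_dot_le (x - x0) (y - x).
have w0 : 0 <= `|y - x| by []; have v0 : 0 <= `|x - x0| by [].
have g1 : Nc * `|y - x| * `|y - x| <= Nc * rho * `|y - x|.
  by rewrite ler_wpM2r // ler_wpM2l.
have g2 : Nc * `|x - x0| * `|y - x| <= Nc * (2 * rho) * `|y - x|.
  by rewrite ler_wpM2r // ler_wpM2l.
by move: h1 h2 g1 g2; rewrite -/Nc; lra.
Qed.

Let pos_diff x y : `|pos y - pos x| <= `|sq y - sq x|.
Proof.
rewrite ler_norml /pos /Num.max; have [h|h] := ger0P (sq y - sq x);
by case: ifPn => ?; case: ifPn => ?; lra.
Qed.

(** The derivative 2 max(0, a) of max(0, a)^2 is 2-Lipschitz, hence the quadratic remainder. *)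
Let pos_taylor x y :
  `|pos y ^+ 2 - pos x ^+ 2 + 2 * pos x * (sq y - sq x)| <= (sq y - sq x) ^+ 2.
Proof.
rewrite /pos; set a := _ - sq x; set b := _ - sq y.
have -> : sq y - sq x = a - b by rewrite /a /b; ring.
move: a b => a b; have dd := sqr_ge0 (a - b).
rewrite /Num.max; case: ifPn; case: ifPn; rewrite -?leNgt => ha hb.
- by rewrite (_ : _ + _ = (a - b) ^+ 2) ?ger0_norm //; ring.
- have := mulr_ge0 (ltW hb) (_ : 0 <= - a); rewrite oppr_ge0 => /(_ ha) ab.
  by rewrite ger0_norm !expr2; nra.
- have := mulr_ge0 (ltW ha) (_ : 0 <= - b); rewrite oppr_ge0 => /(_ hb) ab.
  by rewrite ger0_norm !expr2; nra.
- by rewrite ger0_norm !expr2; nra.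
Qed.

Lemma ugrad_bump : ugrad bump_fun bump_grad.
Proof.
have Nc0 : 0 <= Nc by [].
(* [C] exceeds the Lipschitz constant 1 + 10 Nc of the gradient and the constant 25/4 Nc^2 + Nc of
   the second order remainder. Both are computed for |x - x0| <= 2 rho; beyond, the bump vanishes at
   both points. *)
pose C := 7 * Nc ^+ 2 + 10 * Nc + 1.
have C0 : 0 < C by rewrite /C; nra.
have far x y : 2 * rho < `|x - x0| -> `|y - x| <= rho -> pos x = 0 /\ pos y = 0.
  move=> h1 h2; split; apply: pos_far; first by have := rho_gt0; lra.
  by have := ler_distD y x x0; rewrite (distrC x y); lra.
split=> e e0.
  exists (Num.min rho (e / C)); first by rewrite lt_min rho_gt0 divr_gt0.
  move=> x y; rewrite le_min ler_pdivlMr // => /andP[h1 h2].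
  have [hx|hx] := leP `|x - x0| (2 * rho); last first.
    have [p1 p2] := far _ _ hx h1.
    by rewrite /bump_grad p1 p2 mul0r oppr0 !scale0r subrr normr0 ltW.
  apply: le_trans h2; have -> : bump_grad y - bump_grad x =
     - ((pos y / rho ^+ 2) *: (y - x) + ((pos y - pos x) / rho ^+ 2) *: (x - x0)).
    by rewrite /bump_grad; apply/rowP => i; rewrite !mxE; ring.
  rewrite normrN; apply: le_trans (ler_normD _ _) _.
  rewrite (normrZ (pos y / rho ^+ 2)) (normrZ ((pos y - pos x) / rho ^+ 2)).
  have /andP[q0 q1] := pos_bound y.
  have g1 : `|pos y / rho ^+ 2| <= 1.
    by rewrite ger0_norm ?divr_ge0 ?(ltW rho2_gt0) // ler_pdivrMr // mul1r.
  have g2 : `|(pos y - pos x) / rho ^+ 2| <= 5 * Nc * `|y - x| / rho.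
    rewrite normrM normfV (gtr0_norm rho2_gt0) ler_pdivrMr //.
    apply: le_trans (pos_diff _ _) _; apply: le_trans (sq_diff hx h1) _.
    by rewrite le_eqVlt; apply/orP; left; apply/eqP; field; rewrite gt_eqF.
  have g3 : `|(pos y - pos x) / rho ^+ 2| * `|x - x0| <= 10 * Nc * `|y - x|.
    apply: le_trans (ler_pM (normr_ge0 _) (normr_ge0 _) g2 hx) _.
    by rewrite le_eqVlt; apply/orP; left; apply/eqP; field; rewrite gt_eqF.
  have g4 : `|pos y / rho ^+ 2| * `|y - x| <= `|y - x| by rewrite ler_piMl.
  have w0 : 0 <= `|y - x| by [].
  apply: le_trans (lerD g4 g3) _; rewrite -[X in X + _]mul1r -mulrDl mulrC ler_wpM2l //.
  by rewrite /C; have := sqr_ge0 Nc; lra.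
exists (Num.min rho (e / C)); first by rewrite lt_min rho_gt0 divr_gt0.
move=> x y; rewrite le_min ler_pdivlMr // => /andP[h1 h2].
have [hx|hx] := leP `|x - x0| (2 * rho); last first.
  have [p1 p2] := far _ _ hx h1.
  rewrite /bump_grad /bump_fun p1 p2 mul0r oppr0 scale0r dot0l !subr0 subrr normr0.
  by rewrite mulr_ge0 // ltW.
have dE : 2 * dot (x - x0) (y - x) = sq y - sq x - dot (y - x) (y - x).
  have -> : sq y = dot ((y - x) + (x - x0)) ((y - x) + (x - x0)) by rewrite subrKA.
  by rewrite dot_sqrD /sq; ring.
have -> : bump_fun y - bump_fun x - dot (bump_grad x) (y - x) =
   (pos y ^+ 2 - pos x ^+ 2 + 2 * pos x * (sq y - sq x)) / (4 * rho ^+ 2)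
   - pos x / rho ^+ 2 * dot (y - x) (y - x) / 2.
  rewrite /bump_fun /bump_grad dotZl.
  have -> : dot (x - x0) (y - x) = (sq y - sq x - dot (y - x) (y - x)) / 2.
    by rewrite -dE; field.
  by field; rewrite gt_eqF.
apply: le_trans (ler_normB _ _) _.
have w0 : 0 <= `|y - x| by [].
have t1 : `|(pos y ^+ 2 - pos x ^+ 2 + 2 * pos x * (sq y - sq x)) / (4 * rho ^+ 2)|
   <= 25 / 4 * Nc ^+ 2 * `|y - x| ^+ 2.
  have r40 : 0 < 4 * rho ^+ 2 by rewrite mulr_gt0.
  rewrite normrM normfV (gtr0_norm r40) ler_pdivrMr //.
  apply: le_trans (pos_taylor _ _) _.
  rewrite -real_normK ?num_real //.
  have -> : 25 / 4 * Nc ^+ 2 * `|y - x| ^+ 2 * (4 * rho ^+ 2) = (5 * Nc * rho * `|y - x|) ^+ 2 by field.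
  by rewrite lerXn2r ?nnegrE ?sq_diff // !mulr_ge0 // ltW.
have t2 : `|pos x / rho ^+ 2 * dot (y - x) (y - x) / 2| <= Nc * `|y - x| ^+ 2.
  have /andP[q0 q1] := pos_bound x.
  have g1 : `|pos x / rho ^+ 2| <= 1.
    by rewrite ger0_norm ?divr_ge0 ?(ltW rho2_gt0) // ler_pdivrMr // mul1r.
  rewrite 2!normrM; have := norm_dot_le (y - x) (y - x); rewrite -/Nc -mulrA -expr2 => dd.
  have : `|pos x / rho ^+ 2| * `|dot (y - x) (y - x)| <= Nc * `|y - x| ^+ 2.
    by rewrite -[leRHS]mul1r ler_pM.
  have : 0 <= `|pos x / rho ^+ 2| * `|dot (y - x) (y - x)| by rewrite mulr_ge0.
  rewrite (ger0_norm (x := 2^-1)) ?invr_ge0 //; lra.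
have : `|y - x| * C * `|y - x| <= e * `|y - x| by rewrite ler_wpM2r.
apply: le_trans; apply: le_trans (lerD t1 t2) _.
have -> : `|y - x| * C * `|y - x| = C * `|y - x| ^+ 2 by ring.
by rewrite -mulrDl ler_wpM2r ?sqr_ge0 // /C; nra.
Qed.

End Bump.

(** * The minimax argument *)

Section Rigidity.
Context {R : realType} {n : nat}.
Local Notation E := 'rV[R]_(n + n).

(** What the minimax argument retains of a C^1 Hamiltonian with compact support. *)
Definition tame (F : E -> R) (V : E -> E) := [/\ ugrad F V,
  exists B, forall z, `|V z| <= B & exists M, forall z, `|F z| <= M].

Lemma bracket_unif_cont (V W : E -> E) (B e : R) :
  unif_cont_field V -> unif_cont_field W ->
  (forall z, `|V z| <= B) -> (forall z, `|W z| <= B) -> 0 < e ->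
  exists2 r : R, 0 < r & forall x y, `|y - x| <= r ->
    `|bracket V W y - bracket V W x| <= e.
Proof.
move=> uV uW VB WB e0; have B0 : 0 <= B := le_trans (normr_ge0 _) (VB 0).
pose c := n%:R * (4 * B) + 1.
have c0 : 0 < c by rewrite ltr_wpDl // !mulr_ge0.
have e1 : 0 < e / c by rewrite divr_gt0.
have [r r0 hr] := uV _ e1; have [s s0 hs] := uW _ e1.
exists (Num.min r s) => [|x y]; first by rewrite lt_min r0.
rewrite le_min => /andP[/hr hV /hs hW].
have term j j' : `|V y 0 j * W y 0 j' - V x 0 j * W x 0 j'| <= 2 * B * (e / c).
  have -> : V y 0 j * W y 0 j' - V x 0 j * W x 0 j' =
    (V y - V x) 0 j * W y 0 j' + V x 0 j * (W y - W x) 0 j' by rewrite !mxE; ring.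
  have -> : 2 * B * (e / c) = (e / c) * B + B * (e / c) by ring.
  apply: le_trans (ler_normD _ _) _; rewrite !normrM.
  by apply: lerD; apply: ler_pM => //; apply: le_trans (entry_le_norm _ _ _) _.
rewrite /bracket -sumrB; apply: le_trans (ler_norm_sum _ _ _) _.
apply: (@le_trans _ _ (\sum_(k < n) 4 * B * (e / c))).
  apply: ler_sum => k _.
  have h1 := term (lshift n k) (rshift n k); have h2 := term (rshift n k) (lshift n k).
  by move: h1 h2; rewrite !ler_norml; lra.
rewrite sumr_const card_ord -[leLHS]mulr_natl mulrA mulrCA -[leRHS]mulr1 ler_wpM2l ?(ltW e0) //.
by rewrite ler_pdivrMr // mul1r /c lerDl.
Qed.

Lemma rigidity_bracket_le0 (H K : E -> R) (V W : E -> E) :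
  tame H V -> tame K W ->
  (forall e : R, 0 < e -> exists Hj Kj Vj Wj,
    [/\ tame Hj Vj, tame Kj Wj, forall z, `|Hj z - H z| <= e,
        forall z, `|Kj z - K z| <= e & forall z, `|bracket Wj Vj z| <= e]) ->
  forall x0, bracket W V x0 <= 0.
Proof.
move=> tH tK approx x0.
rewrite leNgt; apply/negP; set c := bracket W V x0 => c0.
have [uH [B1 VB1] [bH HB]] := tH; have [uK [B2 WB2] _] := tK.
pose B := Num.max B1 B2.
have VB z : `|V z| <= B by rewrite le_max VB1.
have WB z : `|W z| <= B by rewrite le_max WB2 orbT.
have B0 : 0 <= B := le_trans (normr_ge0 _) (VB 0).
have c2 : 0 < c / 2 by lra.
have [rc rc0 hrc] := bracket_unif_cont uK.1 uH.1 WB VB c2.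
(* Short enough for a backward orbit of [H] that ends near [x0] to stay where the bracket is at
   least c / 2. *)
pose T := Num.min 1 (rc / (2 * (B + 1))).
have BB : 0 < 2 * (B + 1) by lra.
have T0 : 0 < T by rewrite lt_min ltr01 divr_gt0.
have T1 : T <= 1 by rewrite ge_min lexx.
have TB : T * (B + 1) <= rc / 2.
  have : T <= rc / (2 * (B + 1)) by rewrite ge_min lexx orbT.
  by rewrite ler_pdivlMr //; lra.
(* With this value the displacement inequality reads 16 u <= 3 u + 2 u + 3 ej with ej <= u, a
   contradiction. *)
pose u := T * c / 64; have u0 : 0 < u by rewrite divr_gt0 // mulr_gt0.
have [d1 d10 hd1] := ugrad_unif_cont uK WB u0.
pose d := Num.min d1 (rc / 2); have d0 : 0 < d by rewrite lt_min d10 /=; lra.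
have Kd z : `|z - x0| <= d -> `|K z - K x0| <= u.
  by move=> h; apply: hd1; apply: le_trans h _; rewrite ge_min lexx.
have Tdrc : T * (B + 1) + d <= rc.
  have : d <= rc / 2 by rewrite ge_min lexx orbT.
  lra.
(* If node 0 is within [rho] of [x0], its two neighbours, at most 2 rho away from it, are still
   within [d]. *)
pose rho := d / 3; have rho0 : 0 < rho by rewrite divr_gt0.
(* [kap] is the action guaranteed by [bump_add_sq]. The loop energy will be at most ej + kap / 8 <=
   kap / 4, paid once when the loop is switched on and once when it is switched off. *)
pose kap := rho ^+ 2 / 16; have kap0 : 0 < kap by rewrite divr_gt0 // exprn_gt0.
have k8 : 0 < kap / 8 by lra.
pose ej := Num.min u (kap / 8); have ej0 : 0 < ej by rewrite lt_min u0.
have eju : ej <= u by rewrite ge_min lexx.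
have ejk : ej <= kap / 8 by rewrite ge_min lexx orbT.
have [Hj [Kj [Vj [Wj [[uHj [B3 VB3] [bHj HjB]] [uKj [B4 WB4] _] HjH KjK brj]]]]] := approx _ ej0.
pose Bj := Num.max B (Num.max B3 B4).
have VjB z : `|Vj z| <= Bj by rewrite le_max; apply/orP; right; rewrite le_max VB3.
have WjB z : `|Wj z| <= Bj by rewrite le_max; apply/orP; right; rewrite le_max WB4 orbT.
have VBj z : `|V z| <= Bj by rewrite le_max VB.
have Bj0 : 0 <= Bj := le_trans (normr_ge0 _) (VjB 0).
have brc z : `|z - x0| <= rc -> c / 2 <= bracket W V z.
  by move=> /hrc; rewrite ler_norml -/c; clear; lra.
have [ra ra0 drift] := energy_drift uH uHj VBj VjB HjH k8.
have T01 : 0 < T <= 1 by rewrite T0.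
have [rb rb0 disp] := bracket_displacement uH uHj uK uKj VB VjB WB WjB KjK brj brc Kd
  c0 T01 Tdrc u0.
have Bj1 : 0 < Bj + 1 by rewrite ltr_wpDl.
pose r := Num.min (Num.min 1 ra) (Num.min rb (rho / (Bj + 1))).
have r0 : 0 < r by rewrite !lt_min ltr01 ra0 rb0 divr_gt0.
have [r1 r_a r_b r_rho] : [/\ r <= 1, r <= ra, r <= rb & r <= rho / (Bj + 1)].
  by rewrite /r !ge_min !lexx !orbT.
(* The mesh is chosen last: it depends on [Bj], hence on the chosen approximation. *)
have [m m1 mr] : exists2 m : nat, (1 < m)%N & T / r <= m%:R.
  exists (Num.truncn (T / r)).+2 => //; apply/ltW.
  by apply: lt_trans (Num.Theory.truncnS_gt _) _; rewrite ltr_nat.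
have m0 : 0 < m%:R :> R by rewrite ltr0n ltnW.
pose t := T / m%:R; have t0 : 0 < t by rewrite divr_gt0.
have mt : m%:R * t = T by rewrite mulrC divfK // gt_eqF.
have tr : t <= r by rewrite ler_pdivrMr // mulrC -ler_pdivrMr.
have tra : 0 < t <= ra by rewrite t0 (le_trans tr).
have trb : 0 < t <= rb by rewrite t0 (le_trans tr).
pose mu := r * t; have mu0 : 0 < mu by rewrite mulr_gt0.
have mua : mu <= ra * t by rewrite ler_pM2r.
have mub : mu <= rb * t by rewrite ler_pM2r.
have trho : t * Bj + mu <= rho.
  have : t * (Bj + 1) <= rho by rewrite -ler_pdivlMr // (le_trans tr).
  have : mu <= t by rewrite /mu ler_piMl // ltW.
  by clear; lra.
have mpos : (0 < m)%N by exact: ltnW.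
pose f := bump_fun x0 rho; pose Vf := bump_grad x0 rho.
have Vfrho z : `|Vf z| <= rho by exact: bump_grad_le.
pose S := @loop_energy R n m t H Hj; pose VS := @loop_grad R n m t V Vj.
pose X := 'M[R]_((m + m).+1, n + n).
pose fb (x : X) := f (row ord0 x); pose Vfb (x : X) := on_row ord0 Vf x.
have uS : ugrad S VS by exact: ugrad_loop_energy.
have uf : ugrad fb Vfb by apply: ugrad_on_row; exact: ugrad_bump.
have SB : exists b, forall x, `|S x| <= b.
  by apply: loop_energy_bounded => //; [exists bH | exists bHj].
have crit_drift sf th (x : X) : 0 <= sf <= 1 -> 0 <= th <= 1 ->
    `|Qgrad x + sf *: Vfb x + th *: VS x| < mu -> `|S x| <= kap / 4.
  move=> sf01 th01 /ltW crit; rewrite /S loop_energyE //.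
  apply: le_trans (drift m t th (node x) tra _ th01 _ _ _) _; last by move: ejk; clear; lra.
  - by rewrite mt.
  - by move=> i im; apply: euler_step_weaken mua _; exact: (node_step_forward mpos t0 crit).
  - by move=> i im; apply: euler_step_weaken mua _; exact: (node_step_backward mpos t0 crit).
  - apply: le_trans (node_junction mpos t0 crit th01 VBj VjB) _.
    by rewrite lerD2l.
(* Were node 0 in the ball, the loop at full strength (parameter 1) would lead from near [x0] back
   to near [x0], against the displacement estimate. So the bump vanishes at node 0, whatever its
   strength [sf]. *)
have crit_bump sf (x : X) : 0 <= sf <= 1 ->
    `|Qgrad x + sf *: Vfb x + 1 *: VS x| < mu -> fb x <= 0.
  move=> sf01 /ltW crit.
  have th01 : 0 <= (1 : R) <= 1 by rewrite ler01 lexx.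
  have n0 : row ord0 x = node x 0 by congr (row _ x); apply/val_inj; rewrite /= inordK.
  rewrite /fb n0; have [far|near] := leP rho `|node x 0 - x0|; first by rewrite /f bump_far.
  exfalso.
  have d3 : d = 3 * rho by rewrite /rho; field.
  have z1 : `|node x 1 - x0| <= d.
    rewrite -(subrKA (node x 0)); apply: le_trans (ler_normD _ _) _.
    by have := node_first mpos t0 crit th01 sf01 VBj VjB Vfrho; move: near trho d3; clear; lra.
  have z2 : `|node x (m + m) - x0| <= d.
    rewrite -(subrKA (node x 0)); apply: le_trans (ler_normD _ _) _.
    by have := node_last mpos t0 crit th01 sf01 VBj VjB Vfrho; move: near trho d3; clear; lra.
  have := disp m t (node x) m1 trb mt _ _ _ z1 z2.
  have e1 i : (0 < i < m)%N -> euler_step Vj t (rb * t) (node x i) (node x i.+1).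
    by move=> im; apply: euler_step_weaken mub _; have := node_step_forward mpos t0 crit im; rewrite mul1r.
  have e2 i : (m < i < m + m)%N -> euler_step V (- t) (rb * t) (node x i) (node x i.+1).
    by move=> im; apply: euler_step_weaken mub _; have := node_step_backward mpos t0 crit im; rewrite mul1r.
  have e3 : `|node x m.+1 - node x m| <= t * Bj + rb * t.
    by apply: le_trans (node_junction mpos t0 crit th01 VBj VjB) _; rewrite lerD2l.
  move=> /(_ e1 e2 e3).
  have : u * 16 = T * c / 4 by rewrite /u; field.
  by move: eju u0; clear; lra.
(* Switch the loop on, then the bump on, then the loop off: the minimax value stays
   below [kap / 2], while linking forces it above [kap] once the loop is off. *)
have k4 : 0 <= kap / 4 by move: kap0; clear; lra.
have [bS SbS] := SB.
have R1 : reach (@proj_neg R n (m + m)) (fun x => Qform x + S x) (0 + kap / 4).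
  apply: (reach_continuation ugrad_Qform uS mu0 k4 SbS); last exact: reach_Qform.
  move=> s x s01 crit; apply: le_trans (ler_norm _) _.
  apply: (crit_drift 0 s) => //; first by rewrite lexx ler01.
  by rewrite scale0r addr0.
have fB x : `|fb x| <= rho ^+ 2 by rewrite /fb /f ger0_norm ?bump_ge0 ?bump_le.
have R2 : reach (@proj_neg R n (m + m)) (fun x => Qform x + S x + fb x) (0 + kap / 4 + 0).
  apply: (reach_continuation (ugradD ugrad_Qform uS) uf mu0 (lexx _) fB) R1.
  move=> s x s01 crit; apply: (crit_bump s) => //.
  by rewrite scale1r addrAC.
have R3 : reach (@proj_neg R n (m + m)) (fun x => Qform x + S x + fb x + (- 1) * S x)
    (0 + kap / 4 + 0 + kap / 4).
  have SbS' x : `|- 1 * S x| <= bS by rewrite mulN1r normrN.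
  apply: (reach_continuation (ugradD (ugradD ugrad_Qform uS) uf) (ugradZ (- 1) uS) mu0 k4 SbS') R2.
  move=> s x /andP[s0 s1] crit; rewrite mulN1r; apply: le_trans (ler_norm _) _; rewrite normrN.
  apply: (crit_drift 1 (1 - s)); rewrite ?ler01 ?lexx // ?subr_ge0 ?gerBl ?s0 ?s1 //.
  rewrite scale1r scalerBl scale1r; move: crit; rewrite scaleN1r scalerN.
  by rewrite [X in `|X| < _](_ : _ = Qgrad x + Vfb x + (VS x - s *: VS x)) // addrA (addrAC (Qgrad x)).
(* The constant polygon at [x0] has no gaps, so the projection fixes it. *)
pose y : X := \matrix_(i, j) x0 0 j.
have half0 i k : half_gap y i k = 0.
  by rewrite /half_gap; case: ifP => // _; rewrite /pc /qc !mxE !subrr mul0r.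
have yE : proj_neg y = y.
  apply: qp_eq => i k; first by rewrite qc_mk big1 // subr0 /qc !mxE.
  by rewrite pc_mk half0 addr0 /pc !mxE.
have [x xy /= Ax] := reach_linking R3 yE.
have hx i k : half_gap x i k = 0 by rewrite -half_gap_proj_neg xy half0.
have q0 k : qc x ord0 k = x0 0 (lshift n k) by rewrite -qc_proj_neg0 xy /qc mxE.
have pM k : pc x ord_max k = x0 0 (rshift n k) by rewrite -pc_proj_neg_max xy /pc mxE.
(* Over [y] all half gaps vanish, so q_(i+1) - q_i = p_i - p_M and the form is a sum of squares.
   Since q_0 and p_M are those of [x0], the term i = 0 alone is the squared distance from node 0 to
   [x0]. *)
have Qx : dot (row ord0 x - x0) (row ord0 x - x0) <= Qform x.
  have -> : dot (row ord0 x - x0) (row ord0 x - x0) =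
      \sum_k (pc x ord0 k - pc x ord_max k) ^+ 2.
    rewrite /dot big_ord1 big_split_ord /= big1 ?add0r => [|k _].
      by apply: eq_bigr => k _; rewrite pM !mxE expr2.
    by rewrite !mxE -/(qc x ord0 k) q0 subrr mul0r.
  have E i k : i != ord_max -> qc x (ordS i) k - qc x i k = pc x i k - pc x ord_max k.
    by move=> im; have := hx i k; rewrite /half_gap (negPf im); clear; lra.
  rewrite Qform_centered (bigD1 ord0) /=; last by rewrite -val_eqE /= neq_ltn addn_gt0 mpos.
  rewrite -[leLHS]addr0; apply: lerD; last first.
    apply: sumr_ge0 => i /andP[im _]; apply: sumr_ge0 => k _.
    by rewrite E // -expr2 sqr_ge0.
  apply: ler_sum => k _; rewrite E ?expr2 //.
  by rewrite -val_eqE /= neq_ltn addn_gt0 mpos.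
have := bump_add_sq x0 rho0 (row ord0 x); rewrite -/(fb x) -/kap.
have -> : bump_fun x0 rho (row ord0 x) = fb x by [].
by move: Qx Ax kap0; clear; lra.
Qed.

End Rigidity.

(** * Smooth functions of compact support *)

Section Gradient.
Context {R : realType} {d : nat}.
Local Notation E := 'rV[R]_d.
Implicit Types (f : E -> R) (x a h : E).

Lemma dotBr (a b c : E) : dot a (b - c) = dot a b - dot a c.
Proof. by rewrite dotC dotDl -scaleN1r dotZl mulN1r !(dotC a). Qed.

Lemma dot_continuous a : continuous (dot a : E -> R).
Proof.
apply/continuous_epsilon => x e e0.
have c0 : 0 < (1 * d)%:R * `|a| + 1 by rewrite ltr_wpDl // mulr_ge0.
exists (e / ((1 * d)%:R * `|a| + 1)); first by rewrite divr_gt0.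
move=> y; rewrite ltr_pdivlMr // => yx; rewrite -dotBr.
apply: le_lt_trans (norm_dot_le _ _) _; apply: le_lt_trans yx.
by rewrite mulrC ler_wpM2l // lerDl.
Qed.

Lemma differentiable_epsilon f x a :
  (forall e : R, 0 < e -> exists2 r : R, 0 < r &
     forall h, `|h| <= r -> `|f (x + h) - f x - dot a h| <= e * `|h|) ->
  differentiable f x.
Proof.
move=> H; have lin : linear (dot a : E -> R).
  by move=> k u v; rewrite dotC dotDl dotZl !(dotC a).
pose lM := GRing.isLinear.Build _ _ _ _ _ lin.
pose lL : {linear E -> R} := HB.pack (dot a : E -> R) lM.
have lc : continuous lL by exact: dot_continuous.
have key (e : R) : 0 < e -> \forall h \near (0 : E),
    `|(f \o shift x - (cst (f x) + lL)) h| <= e * `|h|.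
  move=> e0; have [r r0 hr] := H e e0.
  apply/nbhs_ballP; exists r => //= h; rewrite -ball_normE /= sub0r normrN => /ltW/hr.
  by rewrite !fctE (addrC h) opprD addrA.
have dE : ('d f x : E -> R) = lL by apply: diff_unique lc _; exact/eqaddoP.
by apply/diff_locallyP; rewrite dE; split; last exact/eqaddoP.
Qed.

Lemma diff_gradient f x h : differentiable f x -> 'd f x h = dot (gradient f x) h.
Proof.
move=> df; rewrite {1}(row_sum_delta h) linear_sum /dot big_ord1.
by apply: eq_bigr => j _; rewrite linearZ /= mxE /partial deriveE // mulrC.
Qed.

Lemma gradient_epsilon f x : differentiable f x ->
  forall e : R, 0 < e -> exists2 r : R, 0 < r &
    forall h, `|h| < r -> `|f (x + h) - f x - dot (gradient f x) h| <= e * `|h|.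
Proof.
move=> df e e0; have /eqaddoP/(_ e e0)/nbhs_ballP[r /= r0 hr] := diff_locally df.
exists r => // h hr'; have /= := hr h; rewrite -ball_normE /= sub0r normrN => /(_ hr').
by rewrite !fctE /= diff_gradient // opprD addrA (addrC h).
Qed.

Lemma mean_value f x y : (forall z, differentiable f z) ->
  exists z, `|z - x| <= `|y - x| /\ f y - f x = dot (gradient f z) (y - x).
Proof.
move=> df; set w := y - x; pose g (t : R) := f (x + t *: w).
have dg (t : R) : is_derive t (1 : R) g (dot (gradient f (x + t *: w)) w).
  have dfz := df (x + t *: w).
  pose q (h : R) := h^-1 *: ((f \o shift (x + t *: w)) (h *: w) - f (x + t *: w)).
  split; rewrite /derivable /derive (_ : (fun h : R => _) = q).
  - exact: diff_derivable.
  - by apply/funext => h; rewrite /q /g /= [h *: 1]mulr1 scalerDl addrCA.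
  - by rewrite -diff_gradient // -deriveE.
  - by apply/funext => h; rewrite /q /g /= [h *: 1]mulr1 scalerDl addrCA.
have gc : {within `[0%R, 1%R], continuous g}.
  by apply: derivable_within_continuous => t _; have [] := dg t.
have [c /andP[c0 c1]] := @MVT_segment R g _ 0 1 ler01 (fun t _ => dg t) gc.
have xw : x + w = y by rewrite /w addrC subrK.
rewrite subr0 mulr1 /g scale1r scale0r addr0 xw => E1.
exists (x + c *: w); split => //.
rewrite addrC addKr normrZ ger0_norm ?ler_piMl //.
Qed.

Lemma compact_support_radius f : compactly_supported f ->
  exists C : R, forall z, C < `|z| -> f z = 0.
Proof.
move=> /compact_bounded[C [_ hC]]; exists (C + 1) => z Cz.
apply: contrapT => /eqP fz; have C1 : C < C + 1 by rewrite ltrDl.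
have cz : closure [set x | f x != 0] z by apply: subset_closure.
by have /= := hC _ C1 z cz; rewrite leNgt Cz.
Qed.

Lemma gradient_outside f (C : R) : (forall z, C < `|z| -> f z = 0) ->
  forall z, C < `|z| -> gradient f z = 0.
Proof.
move=> fC z Cz; apply/rowP => j; rewrite !mxE /partial.
rewrite (@near_eq_derive _ _ _ f (cst 0)) ?derive_cst //.
apply/nbhs_ballP; exists (`|z| - C) => /= [|y]; first by rewrite subr_gt0.
rewrite -ball_normE /= => zy; apply: fC.
by have := ler_dist_dist z y; rewrite ler_norml => /andP[_]; move: zy; clear; lra.
Qed.

Lemma bounded_field (W : normedModType R) (V : E -> W) (C : R) : continuous V ->
  (forall z, C < `|z| -> V z = 0) -> exists B, forall z, `|V z| <= B.
Proof.
move=> /continuous_epsilon Vc VC; apply: contrapT => nb.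
have ex (N : nat) : exists x, N%:R < `|V x|.
  apply: contrapT => h; apply: nb.
  by exists N%:R => z; rewrite leNgt; apply/negP => ?; apply: h; exists z.
have [x_ x_P] := choice ex.
have xC N : `|x_ N| <= C.
  rewrite leNgt; apply/negP => /VC h; have := x_P N.
  by rewrite h normr0 ltNge ler0n.
have [x _ xcl] := bounded_seq_cluster xC.
have [dl dl0 hd] := Vc x 1 ltr01.
have [N] := xcl dl (Num.truncn (`|V x| + 1)).+1 dl0.
move=> hN /hd; apply/negP; rewrite -leNgt.
have : `|V x| + 1 < N%:R.
  by apply: lt_le_trans (Num.Theory.truncnS_gt _) _; rewrite ler_nat.
have := x_P N; have := ler_dist_dist (V (x_ N)) (V x); rewrite ler_norml => /andP[_].
lra.
Qed.

Lemma unif_cont_field_compact (V : E -> E) (C : R) : continuous V ->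
  (forall z, C < `|z| -> V z = 0) -> unif_cont_field V.
Proof.
move=> /continuous_epsilon Vc VC e e0; apply: contrapT => nu.
have inv0 N : 0 < N.+1%:R^-1 :> R by rewrite invr_gt0.
have ex (N : nat) : exists p : E * E, `|p.2 - p.1| <= N.+1%:R^-1 /\ e < `|V p.2 - V p.1|.
  apply: contrapT => h; apply: nu; exists N.+1%:R^-1 => // x y yx.
  by rewrite leNgt; apply/negP => ?; apply: h; exists (x, y).
have [xy_ xy_P] := choice ex.
(* Far from the support both points of the pair give the value 0, so the first points stay
   bounded. *)
have xC N : `|(xy_ N).1| <= C + 1.
  rewrite leNgt; apply/negP => h; have [h1 h2] := xy_P N.
  have N1 : N.+1%:R^-1 <= 1 :> R by rewrite invf_le1 // ler1n.
  have hx : V (xy_ N).1 = 0 by apply: VC; apply: lt_trans h; rewrite ltrDl.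
  have hy : V (xy_ N).2 = 0.
    apply: VC; have := ler_dist_dist (xy_ N).2 (xy_ N).1.
    by rewrite ler_norml => /andP[+ _]; move: (le_trans h1 N1) h; clear; lra.
  by move: h2; rewrite hx hy subrr normr0; move: e0; clear; lra.
have [x _ xcl] := bounded_seq_cluster xC.
have e2 : 0 < e / 2 by rewrite divr_gt0.
have [dl dl0 hd] := Vc x _ e2.
have dl2 : 0 < dl / 2 by rewrite divr_gt0.
have [N hN xN] := xcl (dl / 2) (Num.truncn (dl / 2)^-1).+1 dl2.
have [h1 h2] := xy_P N.
have N2 : N.+1%:R^-1 < dl / 2.
  rewrite -[dl / 2]invrK ltf_pV2 ?posrE ?invr_gt0 //.
  by apply: lt_le_trans (Num.Theory.truncnS_gt _) _; rewrite ler_nat ltnW.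
have k1 : `|V (xy_ N).1 - V x| < e / 2.
  by apply: hd; move: xN dl0; clear; lra.
have k2 : `|V (xy_ N).2 - V x| < e / 2.
  apply: hd; have := ler_distD (xy_ N).1 (xy_ N).2 x.
  by move: (le_lt_trans h1 N2) xN; clear; lra.
have := ler_distD (V x) (V (xy_ N).2) (V (xy_ N).1).
rewrite (distrC (V x)); move: h2 k1 k2; clear; lra.
Qed.

(** By the mean value theorem the remainder is an increment of the gradient paired with [y - x]. *)
Lemma ugrad_gradient f : (forall z, differentiable f z) ->
  unif_cont_field (gradient f) -> ugrad f (gradient f).
Proof.
move=> df uV; split=> // e e0.
have c0 : 0 < (1 * d)%:R + 1 :> R by rewrite ltr_wpDl.
have [r r0 hr] := uV _ (divr_gt0 e0 c0); exists r => // x y yx.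
have [z [zx ->]] := mean_value x y df; have := hr _ _ (le_trans zx yx).
rewrite -!(dotC (y - x)) -dotBr dotC => h.
apply: le_trans (norm_dot_le _ _) _; rewrite ler_wpM2r //.
apply: le_trans (ler_wpM2l _ h) _ => //.
by rewrite mulrCA -[leRHS]mulr1 ler_wpM2l ?(ltW e0) // ler_pdivrMr // mul1r lerDl.
Qed.

End Gradient.

(** * C^0-commutation forces the bracket to vanish *)

Section Conclusion.
Context {R : realType}.

Lemma uniform_cvgP d (f : nat -> 'rV[R]_d -> R) (g : 'rV[R]_d -> R) :
  {uniform, f @ \oo --> g} <->
  forall e : R, 0 < e -> exists N : nat, forall j, (N <= j)%N ->
    forall x, `|f j x - g x| <= e.
Proof.
split=> [cf e e0|H P].
  have /cf [N _ hN] : nbhs (g : {uniform _ -> _})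
      [set h : {uniform 'rV[R]_d -> R} | forall x, `|h x - g x| <= e].
    apply/uniform_nbhs; exists [set xy : R * R | ball xy.1 e xy.2]; split.
      exact: entourage_ball (PosNum e0).
    move=> h /= hh x; have := hh x I; rewrite -ball_normE /= distrC; exact: ltW.
  by exists N => j /hN.
case/uniform_nbhs => U [entU subP].
move: entU; rewrite -entourage_ballE => -[e /= e0 eU].
have e2 : 0 < e / 2 by rewrite divr_gt0.
have [N hN] := H _ e2; exists N => // j /= Nj; apply: subP => x _.
apply: eU; rewrite /= -ball_normE /= distrC; apply: le_lt_trans (hN j Nj x) _.
by rewrite ltr_pdivrMr // mulr_natr mulr2n ltrDl.
Qed.

Lemma gradient_support d (f : 'rV[R]_d -> R) : compactly_supported f ->
  exists C : R, forall z, C < `|z| -> f z = 0 /\ gradient f z = 0.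
Proof.
move=> /compact_support_radius[C fC]; exists C => z Cz.
by split; [exact: fC | exact: (gradient_outside fC)].
Qed.

Lemma tame_C1 n (f : 'rV[R]_(n + n) -> R) : C1 f -> compactly_supported f ->
  tame f (gradient f).
Proof.
move=> [df gc] /gradient_support[C fC]; have gC z Cz := (fC z Cz).2.
split.
- by apply: ugrad_gradient => //; exact: (unif_cont_field_compact gc gC).
- exact: (bounded_field gc gC).
- apply: (@bounded_field _ _ _ f C) => [z|z Cz]; last by have [] := fC z Cz.
  exact: differentiable_continuous.
Qed.

Lemma poisson_bracket n (F G : 'rV[R]_(n + n) -> R) x :
  poisson F G x = bracket (gradient F) (gradient G) x.
Proof. by apply: eq_bigr => k _; rewrite !mxE. Qed.

Lemma poissonC n (F G : 'rV[R]_(n + n) -> R) x : poisson F G x = - poisson G F x.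
Proof. by rewrite /poisson -sumrN; apply: eq_bigr => k _; ring. Qed.

Lemma C0_commute_sym n (F G : 'rV[R]_(n + n) -> R) :
  C0_commute F G -> C0_commute G F.
Proof.
move=> [F_ [G_ [cF cG uF uG FG]]]; exists G_, F_; split=> //.
apply/uniform_cvgP => e e0; have [N hN] := (uniform_cvgP _ _).1 FG e e0.
by exists N => j /hN h x; rewrite poissonC /= subr0 normrN; have := h x; rewrite subr0.
Qed.

Lemma C0_commute_poisson_le0 n (H K : 'rV[R]_(n + n) -> R) :
  C1 H -> compactly_supported H -> C1 K -> compactly_supported K ->
  C0_commute H K -> forall x, poisson K H x <= 0.
Proof.
move=> cH sH cK sK [H_ [K_ [cH_ cK_ uH uK HK]]] x; rewrite poisson_bracket.
apply: (rigidity_bracket_le0 (tame_C1 cH sH) (tame_C1 cK sK)) => e e0.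
have [N1 h1] := (uniform_cvgP _ _).1 uH e e0.
have [N2 h2] := (uniform_cvgP _ _).1 uK e e0.
have [N3 h3] := (uniform_cvgP _ _).1 HK e e0.
pose N := maxn N1 (maxn N2 N3).
exists (H_ N), (K_ N), (gradient (H_ N)), (gradient (K_ N)); split.
- by have [] := cH_ N; exact: tame_C1.
- by have [] := cK_ N; exact: tame_C1.
- by apply: h1; rewrite leq_maxl.
- by apply: h2; rewrite /N leq_max leq_maxl orbT.
- move=> z; rewrite -poisson_bracket poissonC normrN.
  have := h3 N _ z; rewrite subr0; apply.
  by rewrite /N !leq_max leqnn !orbT.
Qed.

(** Exchanging the two Hamiltonians changes the sign of the bracket, so the one-sided estimate gives
    equality. *)
Lemma C0_commute_poisson0 n (H K : 'rV[R]_(n + n) -> R) :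
  C1 H -> compactly_supported H -> C1 K -> compactly_supported K ->
  C0_commute H K -> forall x, poisson H K x = 0.
Proof.
move=> cH sH cK sK HK x; apply/eqP; rewrite eq_le.
have := C0_commute_poisson_le0 cH sH cK sK HK x; rewrite poissonC oppr_le0 => ->.
by rewrite C0_commute_poisson_le0 //; exact: C0_commute_sym.
Qed.

Lemma weak_hamiltonian_vf0 n (F : 'rV[R]_(n + n) -> R) x :
  (forall y, F y = 0) -> weak_hamiltonian_vf F x = [set 0].
Proof.
move=> F0; have -> : F = cst 0 by apply/funext.
rewrite /weak_hamiltonian_vf; case: asboolP => [_|[]]; last exact: differentiable_cst.
rewrite /hamiltonian_vf (_ : gradient _ _ = 0) ?trmx0 ?mulmx0 ?trmx0 //.
by apply/rowP => j; rewrite !mxE /partial derive_cst.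
Qed.

Lemma C0_commute_poisson n (H K : 'rV[R]_(n + n) -> R) :
  C1 H -> compactly_supported H -> C1 K -> compactly_supported K ->
  (forall x, poisson H K x = 0) -> C0_commute H K.
Proof.
move=> cH sH cK sK HK; exists (fun=> H), (fun=> K); split=> //.
- by apply/uniform_cvgP => e e0; exists 0%N => j _ x; rewrite subrr normr0 ltW.
- by apply/uniform_cvgP => e e0; exists 0%N => j _ x; rewrite subrr normr0 ltW.
- by apply/uniform_cvgP => e e0; exists 0%N => j _ x; rewrite HK subrr normr0 ltW.
Qed.

Lemma hamiltonian_vf_eq0 n (F : 'rV[R]_(n + n) -> R) x :
  hamiltonian_vf F x = 0 -> gradient F x = 0.
Proof.
move=> /(congr1 trmx); rewrite /hamiltonian_vf trmxK trmx0 /symplectic_mx.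
rewrite -[(gradient F x)^T]vsubmxK mul_block_col !mul0mx mulNmx !mul1mx add0r addr0.
rewrite -[0]vsubmxK => /eq_col_mx[]; rewrite !linear0 => h1 /eqP; rewrite oppr_eq0 => /eqP h2.
by apply/trmx_inj; rewrite -[LHS]vsubmxK h1 h2 trmx0 -[RHS]vsubmxK !linear0.
Qed.

End Conclusion.

(** * Differentiability of Lipschitz functions *)

Section LipschitzLine.
Context {R : realType}.
Local Notation mu := (@lebesgue_measure R).

(* Both [g + id / 2] and [id / 2 - g] are nondecreasing, and their Stieltjes measures
   add up to the Lebesgue measure. *)
Variable g : R -> R.
Hypothesis g_lip : forall x y, `|g x - g y| <= `|x - y| / 2.

Let gc (s : R) (h := fun x => x / 2 + s * g x) : `|s| = 1 -> continuous h.
Proof.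
move=> s1; apply/continuous_epsilon => x e e0; exists e => // y yx.
have -> : h y - h x = (y - x) / 2 + s * (g y - g x) by rewrite /h; lra.
apply: le_lt_trans (ler_normD _ _) _; rewrite !normrM s1 mul1r.
have := g_lip y x; rewrite (gtr0_norm (x := 2^-1)) ?invr_gt0 //; move: yx; lra.
Qed.

Let h1 (x : R) := x / 2 + g x.
Let h2 (x : R) := x / 2 - g x.

Let h1_nd : nondecreasing h1.
Proof.
move=> x y xy; have := g_lip y x; rewrite (ger0_norm (x := y - x)) ?subr_ge0 // ler_norml /h1; lra.
Qed.
Let h2_nd : nondecreasing h2.
Proof.
move=> x y xy; have := g_lip y x; rewrite (ger0_norm (x := y - x)) ?subr_ge0 // ler_norml /h2; lra.
Qed.
Let h1_rc : right_continuous h1.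
Proof.
apply: right_continuousW; have := gc (normr1 R).
by rewrite /h1; under eq_fun do rewrite mul1r.
Qed.
Let h2_rc : right_continuous h2.
Proof.
apply: right_continuousW; have := gc (s := -1); rewrite normrN normr1 => /(_ erefl).
by rewrite /h2; under eq_fun do rewrite mulN1r.
Qed.

HB.instance Definition _ := isCumulative.Build R _ R h1 h1_nd h1_rc.
HB.instance Definition _ := isCumulative.Build R _ R h2 h2_nd h2_rc.

Let nu1 : {measure set (measurableTypeR R) -> \bar R} :=
  lebesgue_stieltjes_measure (h1 : cumulative R R).
Let nu2 : {measure set (measurableTypeR R) -> \bar R} :=
  lebesgue_stieltjes_measure (h2 : cumulative R R).

Let nu1E (a b : R) : a <= b -> nu1 `]a, b]%classic = (h1 b - h1 a)%:E.
Proof.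
move=> ab; rewrite -(wlength_itv_bnd h1 false false ab).
rewrite [LHS]/(lebesgue_stieltjes_measure (h1 : cumulative R R) _).
by rewrite /lebesgue_stieltjes_measure /measure_extension measurable_mu_extE //; exact: is_ocitv.
Qed.
Let nu2E (a b : R) : a <= b -> nu2 `]a, b]%classic = (h2 b - h2 a)%:E.
Proof.
move=> ab; rewrite -(wlength_itv_bnd h2 false false ab).
rewrite [LHS]/(lebesgue_stieltjes_measure (h2 : cumulative R R) _).
by rewrite /lebesgue_stieltjes_measure /measure_extension measurable_mu_extE //; exact: is_ocitv.
Qed.

Let nu_sum A : measurable A -> mu A = (nu1 A + nu2 A)%E.
Proof.
move=> mA; pose nu : {measure set (measurableTypeR R) -> \bar R} := measure_add nu1 nu2.
suff H X : ocitv X -> mu X = nu X.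
  by rewrite (lebesgue_measure_unique H mA); exact: measure_addE.
move=> /ocitvP[->|[[a b] /= ab ->]]; first by rewrite !measure0.
have -> : nu `]a, b]%classic = (nu1 `]a, b]%classic + nu2 `]a, b]%classic)%E by exact: measure_addE.
rewrite nu1E ?(ltW ab) // nu2E ?(ltW ab) //.
rewrite lebesgue_measure_itv /= lte_fin ab -EFinB -EFinD; congr EFin.
by rewrite /h1 /h2; lra.
Qed.

(** As [nu1] is dominated by the Lebesgue measure, it has a Radon-Nikodym density [d], and g + id /
    2 is an integral of [d]; Lebesgue's differentiation theorem then gives the derivative d - 1 / 2
    of [g]. *)
Lemma lipschitz_line_density (N : R) : 0 < N -> exists d : R -> R,
  [/\ mu.-integrable `]-N, N]%classic (EFin \o d),
      forall y, - N <= y <= N ->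
        g y - g (- N) = \int[mu]_(t in `]-N, y]) d t - (y + N) / 2 &
      {ae mu, forall x, - N < x < N -> is_derive x (1 : R) g (d x - 1 / 2)}].
Proof.
move=> N0; set D : set (measurableTypeR R) := `]-N, N]%classic.
have mD : measurable D by exact: (@measurable_itv R).
have NN : - N <= N by lra.
have nuD : (nu1 D < +oo)%E by rewrite nu1E // ltry.
(* Restricting to a bounded interval makes the measure finite and its density integrable. *)
pose nuD1 : {finite_measure set (measurableTypeR R) -> \bar R} :=
  mfrestr (f := nu1) mD nuD.
have dom : nuD1 `<< (mu : {sigma_finite_measure set (measurableTypeR R) -> \bar R}).
  move=> A Anull B mB BA; have := Anull B mB BA; rewrite /= nu_sum // /nuD1 /mfrestr /mrestr /=.
  move=> /eqP; rewrite padde_eq0 // => /andP[/eqP nuB _].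
  apply/eqP; rewrite -measure_le0 -nuB le_measure ?inE //; last exact: measurableI.
have [f [f0 ffin fint fE]] := radon_nikodym_sigma_finite dom.
pose d := fine \o f; have dE : EFin \o d = f by apply/funext => x; rewrite /= fineK.
have dint : mu.-integrable setT (EFin \o d) by rewrite dE.
have h1E y : - N <= y <= N -> h1 y - h1 (- N) = \int[mu]_(t in `]-N, y]) d t.
  move=> /andP[y1 y2]; rewrite /Rintegral.
  rewrite (_ : (fun t => (d t)%:E) = f) // -fE; last exact: (@measurable_itv R).
  rewrite /nuD1 /= /mfrestr /mrestr /= (_ : _ `&` D = `]-N, y]%classic) ?nu1E //.
  apply/setIidl => x /=; rewrite /D /= !in_itv /= => /andP[-> xy] /=; exact: le_trans y2.
exists d; split.
- exact: integrableS dint.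
- by move=> y yN; rewrite -h1E // /h1; lra.
have loc : locally_integrable setT d.
  split.
  - by apply/measurable_EFinP; exact: measurable_int dint.
  - exact: openT.
  - move=> K _ cK; have mK : measurable K by exact: compact_measurable.
    by have /integrableP[_] : mu.-integrable K (EFin \o d) by exact: integrableS dint.
have := lebesgue_differentiation loc.
apply: (@filterS _ _ (ae_filter_ringOfSetsType mu)) => x lx /andP[x1 x2].
have dD : mu.-integrable [set` Interval (BRight (- N)) (BRight N)] (EFin \o d).
  exact: integrableS dint.
have Nx : (BRight (- N) < BRight x)%O by rewrite bnd_simp.
have [dF FE] := FTC1_lebesgue_pt x2 dD Nx lx.
pose F (y : R) := \int[mu]_(t in `]-N, y]) d t.
have gF : {near x, (fun y => F y - (y + N) / 2 + g (- N)) =1 g}.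
  apply/nbhs_ballP; exists (Num.min (x + N) (N - x)) => /=.
    by rewrite lt_min; apply/andP; split; lra.
  move=> y; rewrite -ball_normE /= lt_min => /andP[].
  rewrite !ltr_norml => /andP[a1 a2] /andP[a3 a4].
  rewrite /F -h1E; first by rewrite /h1; lra.
  by apply/andP; split; lra.
apply: near_eq_is_derive gF _.
have FD : is_derive x (1 : R) F (d x) by split=> //; rewrite -derive1E.
apply: is_derive_eq.
by rewrite !scaler0 add0r !addr0 /GRing.scale /= mulr1 div1r.
Qed.

End LipschitzLine.

Section LipschitzDerivative.
Context {R : realType}.
Local Notation mu := (@lebesgue_measure R).
Variables (f : R -> R) (L : R).
Hypothesis f_lip : forall x y, `|f x - f y| <= L * `|x - y|.

Let L_ge0 : 0 <= L.
Proof. by have := f_lip 1 0; rewrite subr0 normr1 mulr1; apply: le_trans. Qed.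

(** Rescales to the Lipschitz constant 1 / 2; [L + 1] instead of [L] avoids dividing by zero. *)
Let c : R := (2 * (L + 1))^-1.
Let c_gt0 : 0 < c. Proof. by rewrite invr_gt0; have := L_ge0; lra. Qed.
Let g (x : R) := c * f x.

Let g_lip x y : `|g x - g y| <= `|x - y| / 2.
Proof.
rewrite -mulrBr normrM gtr0_norm // mulrC ler_pdivrMr; last by have := L_ge0; lra.
apply: le_trans (f_lip x y) _; have := normr_ge0 (x - y); have := L_ge0; nra.
Qed.

Let fE : f = (fun x => c^-1 * g x).
Proof. by apply/funext => x; rewrite /g mulKf // gt_eqF. Qed.

Lemma lipschitz_derivable_ae : {ae mu, forall x, derivable f x 1}.
Proof.
have H (N : nat) : {ae mu, forall x, - N.+1%:R < x < N.+1%:R -> derivable f x 1}.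
  have [d [_ _ dP]] := lipschitz_line_density g_lip (ltr0Sn R N).
  apply: (@filterS _ _ (ae_filter_ringOfSetsType mu)) dP => x dx xN.
  have gx := dx xN; rewrite fE; apply: derivableM; first exact: derivable_cst.
  by have [] := gx.
have := ae_foralln H; apply: (@filterS _ _ (ae_filter_ringOfSetsType mu)) => x xP.
apply: (xP (Num.truncn `|x|)); rewrite -ltr_norml; exact: Num.Theory.truncnS_gt.
Qed.

(** The density of [nu1] equals 1 / 2 almost everywhere, so its integral cancels the linear term and
    [g] keeps its value at the left end. *)
Lemma lipschitz_derive0_const : {ae mu, forall x, is_derive x (1 : R) f 0} ->
  forall x y, f x = f y.
Proof.
move=> f0; suff H (M y : R) : `|y| < M -> f y = f (- M).
  move=> x y; pose M := `|x| + `|y| + 1.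
  have := normr_ge0 x; have := normr_ge0 y => y0 x0.
  by rewrite (H M x) ?(H M y) // /M; lra.
move=> yM; have M0 : 0 < M := le_lt_trans (normr_ge0 _) yM.
have [d [dint dE dP]] := lipschitz_line_density g_lip M0.
have /andP[y1 y2] : - M < y < M by rewrite -ltr_norml.
have mI : measurable (`]-M, y]%classic : set (measurableTypeR R)) by exact: (@measurable_itv R).
have d12 : \int[mu]_(t in `]-M, y]) d t = (y + M) / 2.
  have -> : (y + M) / 2 = \int[mu]_(t in `]-M, y]) (1 / 2).
    have muI : mu `]-M, y]%classic = (y + M)%:E.
      by rewrite lebesgue_measure_itv /= lte_fin y1 -EFinB opprK.
    by rewrite Rintegral_cst //= [X in fine X]muI /=; lra.
  rewrite /Rintegral; congr fine; apply: ae_eq_integral => //.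
  - apply: (measurable_int mu).
    have mM : measurable (`]-M, M]%classic : set (measurableTypeR R)).
      exact: (@measurable_itv R).
    apply: integrableS mM mI _ dint.
    move=> t /=; rewrite !in_itv /= => /andP[-> ty] /=; exact: le_trans ty (ltW y2).
  - move: f0 dP; apply: (@filterS2 _ _ (ae_filter_ringOfSetsType mu)) => t ft dt /=.
    rewrite in_itv /= => /andP[t1 t2]; have tM : - M < t < M by rewrite t1 (le_lt_trans t2).
    have gt0 : is_derive t (1 : R) g 0.
      by rewrite /g; apply: is_derive_eq; rewrite ?scaler0 ?addr0 ?mul0r ?mulr0.
    have gt := dt tM.
    have := @derive_val _ _ _ _ _ _ _ gt; rewrite (@derive_val _ _ _ _ _ _ _ gt0).
    by move=> E; congr EFin; lra.
have := dE y; rewrite d12 (ltW y1) (ltW y2) subrr => /(_ isT)/eqP.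
rewrite subr_eq0 => /eqP gE; by rewrite fE gE.
Qed.

End LipschitzDerivative.

Section Approximation.
Context {R : realType}.

Lemma norm_delta_mx_le d (j : 'I_d) : `|delta_mx 0 j : 'rV[R]_d| <= 1.
Proof.
apply: norm_le_entries => // i k; rewrite mxE.
by case: (_ && _); rewrite ?normr1 ?normr0.
Qed.

Lemma dot_delta d (a : 'rV[R]_d) j : dot a (delta_mx 0 j) = a 0 j.
Proof.
rewrite /dot big_ord1 (bigD1 j) //= mxE !eqxx mulr1 big1 ?addr0 // => k /negPf kj.
by rewrite mxE kj mulr0.
Qed.

Lemma invS_small (e : R) : 0 < e -> exists k : nat, k.+1%:R^-1 <= e.
Proof.
move=> e0; exists (Num.truncn e^-1).
rewrite -[leRHS]invrK lef_pV2 ?posrE ?invr_gt0 //.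
exact: ltW (Num.Theory.truncnS_gt _).
Qed.

(** The slope may depend on the accuracy [k]: the slopes are bounded by the Lipschitz constant plus
    one, and any cluster point of them is a gradient. *)
Lemma differentiable_approx d (f : 'rV[R]_d -> R) (L : R) x :
  (forall y z, `|f y - f z| <= L * `|y - z|) ->
  (forall k : nat, exists a, exists2 r : R, 0 < r & forall h, `|h| <= r ->
     `|f (x + h) - f x - dot a h| <= k.+1%:R^-1 * `|h|) ->
  differentiable f x.
Proof.
move=> fL H; have [a_ aP] := choice H.
have ab k : `|a_ k| <= `|L| + 1.
  have [r r0 hr] := aP k; apply: norm_le_entries => [|i j]; first by rewrite addr_ge0.
  rewrite (ord1 i) -(ler_pM2l r0).
  have nh : `|r *: delta_mx 0 j : 'rV[R]_d| <= r.
    by rewrite normrZ gtr0_norm // ler_piMr ?norm_delta_mx_le // ltW.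
  have := hr _ nh; rewrite dotC dotZl dotC dot_delta => h1.
  have h2 := fL (x + r *: delta_mx 0 j) x.
  rewrite [X in _ <= _ * `|X|]addrAC subrr add0r in h2.
  have h3 : L * `|r *: delta_mx 0 j : 'rV[R]_d| <= r * `|L|.
    by rewrite [leRHS]mulrC; apply: le_trans (ler_wpM2r _ (ler_norm L)) (ler_wpM2l _ nh).
  have h4 : k.+1%:R^-1 * `|r *: delta_mx 0 j : 'rV[R]_d| <= r.
    by rewrite -[leRHS]mul1r ler_pM ?invr_ge0 // invf_le1 // ler1n.
  have : `|r * a_ k 0 j| <= `|f (x + r *: delta_mx 0 j) - f x| +
      `|f (x + r *: delta_mx 0 j) - f x - r * a_ k 0 j|.
    by rewrite -[X in `|X| <= _](subKr (f (x + r *: delta_mx 0 j) - f x)) ler_normB.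
  rewrite normrM (gtr0_norm r0) => h5.
  apply: le_trans h5 _; rewrite mulrDr mulr1; apply: lerD.
    exact: le_trans h2 h3.
  exact: le_trans h1 h4.
have [a _ acl] := bounded_seq_cluster ab.
apply: (@differentiable_epsilon _ _ f x a) => e e0.
have N0 : 0 < (1 * d)%:R + 1 :> R by rewrite ltr_wpDl.
have e2 : 0 < e / 2 by rewrite divr_gt0.
have [k0 hk0] := invS_small e2.
have [k kk ka] := acl (e / 2 / ((1 * d)%:R + 1)) k0 (divr_gt0 e2 N0).
have [r r0 hr] := aP k; exists r => // h /hr hh.
have hk : k.+1%:R^-1 <= e / 2.
  by apply: le_trans hk0; rewrite lef_pV2 ?posrE // ler_nat ltnS.
have -> : f (x + h) - f x - dot a h = (f (x + h) - f x - dot (a_ k) h) + dot (a_ k - a) h.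
  by rewrite dotDl -(scaleN1r a) dotZl; ring.
apply: le_trans (ler_normD _ _) _; rewrite (splitr e) mulrDl; apply: lerD.
  by apply: le_trans hh _; rewrite ler_wpM2r.
apply: le_trans (norm_dot_le _ _) _; rewrite ler_wpM2r //.
apply: le_trans (ler_wpM2l _ (ltW ka)) _ => //.
by rewrite mulrCA -[leRHS]mulr1 ler_wpM2l ?(ltW e2) // ler_pdivrMr // mul1r lerDl.
Qed.

Lemma rat_approx_row d (a : 'rV[R]_d) (e : R) : 0 < e ->
  exists q : 'rV[rat]_d, `|map_mx ratr q - a| <= e.
Proof.
move=> e0; have H j : exists q : rat, `|ratr q - a 0 j| <= e.
  have ae : a 0 j < a 0 j + e by rewrite ltrDl.
  have [q] := rat_in_itvoo ae; rewrite in_itv /= => /andP[q1 q2]; exists q.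
  by rewrite ler_norml; apply/andP; split; move: q1 q2; lra.
have [q_ qP] := choice H; exists (\row_j q_ j).
by apply: norm_le_entries => [|i j]; [exact: ltW | rewrite !mxE (ord1 i)].
Qed.

Lemma lipschitz_continuous (V : normedModType R) (f : V -> R) (L : R) :
  (forall y z, `|f y - f z| <= L * `|y - z|) -> continuous f.
Proof.
move=> fL; apply/continuous_epsilon => x e e0.
have L0 : 0 < `|L| + 1 by rewrite ltr_wpDl.
exists (e / (`|L| + 1)); first by rewrite divr_gt0.
move=> y; rewrite ltr_pdivlMr // => h; apply: le_lt_trans (fL _ _) _.
apply: le_lt_trans h; rewrite mulrC ler_wpM2l // (le_trans (ler_norm _)) // lerDl //.
Qed.

(* Points at which [f] is affine up to [1 / (k + 1)] along the directions [e h]. *)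
Definition affine_at (V : normedModType R) d (f : V -> R) (e : 'rV[R]_d -> V)
  (k j : nat) (a : 'rV[R]_d) : set V :=
  [set w | forall h, `|h| <= j.+1%:R^-1 ->
     `|f (w + e h) - f w - dot a h| <= k.+1%:R^-1 * `|h|].

Lemma closed_affine_at (V : normedModType R) d (f : V -> R) (e : 'rV[R]_d -> V) k j a :
  continuous f -> closed (affine_at f e k j a).
Proof.
move=> fc; have -> : affine_at f e k j a = \bigcap_(h in [set h | `|h| <= j.+1%:R^-1])
    ((fun w => `|f (w + e h) - f w - dot a h|) @^-1` [set r | r <= k.+1%:R^-1 * `|h|]).
  by apply/seteqP; split => w H h /=; exact: H.
apply: closed_bigI => h _; apply: preimage_closed; last exact: closed_le.
move=> w _; apply: cvg_norm; apply: cvgB; last exact: cvg_cst.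
apply: cvgB; last exact: fc.
apply: (@continuous_comp _ _ _ (fun w => w + e h) f); last exact: fc.
by apply: cvgD; [exact: cvg_id | exact: cvg_cst].
Qed.

(** Rational slopes and radii 1 / (j + 1) make differentiability a countable combination of closed
    conditions; its measurability comes from here. *)
Lemma differentiable_affine_at d (f : 'rV[R]_d -> R) (L : R) x :
  (forall y z, `|f y - f z| <= L * `|y - z|) ->
  differentiable f x <->
  forall k, exists q : 'rV[rat]_d, exists j, affine_at f id k j (map_mx ratr q) x.
Proof.
move=> fL; split=> [df k|H]; last first.
  apply: (differentiable_approx fL) => k; have [q [j qj]] := H k.
  by exists (map_mx ratr q), j.+1%:R^-1.
have N0 : 0 < (1 * d)%:R + 1 :> R by rewrite ltr_wpDl.
have k2 : 0 < k.+1%:R^-1 / 2 :> R by rewrite divr_gt0 // invr_gt0.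
have [q hq] := rat_approx_row (gradient f x) (divr_gt0 k2 N0).
have [r r0 hr] := gradient_epsilon df k2.
have r2 : 0 < r / 2 by rewrite divr_gt0.
have [j hj] := invS_small r2; exists q, j => h hh.
have /hr hrr : `|h| < r by apply: le_lt_trans (le_trans hh hj) _; rewrite ltr_pdivrMr // mulr_natr mulr2n ltrDl.
have -> : f (x + h) - f x - dot (map_mx ratr q) h =
    (f (x + h) - f x - dot (gradient f x) h) - dot (map_mx ratr q - gradient f x) h.
  by rewrite dotDl -(scaleN1r (gradient f x)) dotZl; ring.
apply: le_trans (ler_normB _ _) _; rewrite (splitr k.+1%:R^-1) mulrDl; apply: lerD => //.
apply: le_trans (norm_dot_le _ _) _; rewrite ler_wpM2r //.
apply: le_trans (ler_wpM2l _ hq) _ => //.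
by rewrite mulrCA -[leRHS]mulr1 ler_wpM2l ?(ltW k2) // ler_pdivrMr // mul1r lerDl.
Qed.

End Approximation.

(** * Density points of measurable sets of reals *)

Section Density.
Context {R : realType}.
Local Notation mu := (@lebesgue_measure R).

(** Otherwise the ball of radius eta1 |u| about s + u would miss [A]; it fills a fraction eta1 / 2
    of the ball of radius 2 |u| about [s], in which [A] already has density above 1 - eta1 / 4. *)
Lemma density_point (A : set R) : measurable A ->
  {ae mu, forall s, A s -> forall eta : R, 0 < eta -> exists2 r : R, 0 < r &
     forall u, `|u| <= r -> exists2 s', A s' & `|s' - (s + u)| <= eta * `|u|}.
Proof.
move=> mA; have := lebesgue_density mA.
apply: (@filterS _ _ (ae_filter_ringOfSetsType mu)) => s ds As eta eta0.
pose eta1 := Num.min eta 1.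
have e10 : 0 < eta1 by rewrite lt_min eta0 ltr01.
have e11 : eta1 <= 1 by rewrite ge_min lexx orbT.
have e1e : eta1 <= eta by rewrite ge_min lexx.
have lt1 : ((1 - eta1 / 4)%:E < (\1_A s)%:E)%E.
  rewrite indicE mem_set // lte_fin; have -> : true%:R = 1 :> R by []; move: e10; clear; lra.
have : \forall r \near 0^'+,
    ((1 - eta1 / 4)%:E < mu (A `&` ball s r) * (mu (ball s r))^-1)%E.
  by have := ds _ (open_nbhs_nbhs (conj (@open_ereal_gt_ereal _ (1 - eta1 / 4)%:E) lt1)).
case=> r0 /= r00 hr; exists (r0 / 4); first by rewrite divr_gt0.
move=> u ur; have [->|u0] := eqVneq u 0.
  by exists s; rewrite // addr0 subrr normr0 mulr0.
have nu0 : 0 < `|u| by rewrite normr_gt0.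
pose rho := 2 * `|u|.
have rho0 : 0 < rho by rewrite mulr_gt0.
have bs : ball (0 : R) r0 rho.
  rewrite /ball /= sub0r normrN gtr0_norm // /rho; move: ur r00; clear; lra.
have := hr _ bs rho0; rewrite lebesgue_measure_ball ?(ltW rho0) //.
rewrite inver; have -> : (rho *+ 2 == 0) = false.
  by rewrite mulrn_eq0 /= gt_eqF.
move=> lt2; apply: contrapT => nA.
pose B := ball (s + u) (eta1 * `|u|).
have mAb : measurable (A `&` ball s rho) by apply: measurableI => //; exact: measurable_ball.
have mB : measurable B by exact: measurable_ball.
have e1u : eta1 * `|u| <= `|u| by rewrite ler_piMl.
have sub : (A `&` ball s rho) `|` B `<=` ball s rho.
  move=> x [[]//|]; rewrite /B /ball /= => xB.
  have -> : s - x = (s + u - x) - u by ring.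
  apply: le_lt_trans (ler_normB _ _) _; rewrite /rho; move: xB e1u; clear; lra.
have AB : (A `&` ball s rho) `&` B = set0.
  rewrite -subset0 => x [[Ax _] xB]; apply: nA; exists x => //.
  move: xB; rewrite /B /ball /= distrC => /ltW h; apply: le_trans h _.
  by rewrite ler_wpM2r.
have m1 : mu (ball s rho) = (rho *+ 2)%:E by rewrite lebesgue_measure_ball ?(ltW rho0).
have m2 : mu B = ((eta1 * `|u|) *+ 2)%:E.
  by rewrite lebesgue_measure_ball // mulr_ge0 ?(ltW e10).
have : (mu (A `&` ball s rho) + mu B <= mu (ball s rho))%E.
  rewrite -measureU //; apply: le_measure; rewrite ?inE //; first exact: measurableU.
  exact: measurable_ball.
rewrite m1 m2; move: lt2.
have : (0 <= mu (A `&` ball s rho))%E by exact: measure_ge0.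
case: (mu _) => [r _|//|//]. 
rewrite -EFinM lte_fin -EFinD lee_fin ltr_pdivlMr ?pmulrn_lgt0 //.
rewrite /rho !mulr2n; move: nu0 e10; set z := eta1 * `|u| => h1 h2.
have -> : (1 - eta1 / 4) * (2 * `|u| + 2 * `|u|) = 4 * `|u| - z by rewrite /z; field.
have : 0 < z by rewrite mulr_gt0.
clear; lra.
Qed.

End Density.

Section Fubini.
Context d1 d2 (T1 : measurableType d1) (T2 : measurableType d2) {R : realType}.
Variable m1 : {sigma_finite_measure set T1 -> \bar R}.
Variable m2 : {sigma_finite_measure set T2 -> \bar R}.

Lemma integral_eq0_ae d (T : measurableType d) (mu : {measure set T -> \bar R})
    (f : T -> \bar R) : measurable_fun setT f -> (forall x, (0 <= f x)%E) ->
  (\int[mu]_x f x = 0)%E <-> {ae mu, forall x, f x = 0%E}.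
Proof.
move=> mf f0; have -> : (\int[mu]_x f x = \int[mu]_x `|f x|)%E.
  by apply: eq_integral => x _; rewrite gee0_abs.
rewrite ae_eq_integral_abs //; split.
  by apply: (@filterS _ _ (ae_filter_ringOfSetsType mu)) => x /(_ I).
by apply: (@filterS _ _ (ae_filter_ringOfSetsType mu)) => x.
Qed.

Lemma product_null_xsection (A : set (T1 * T2)) : measurable A ->
  (m1 \x m2)%E A = 0%E <-> {ae m1, forall x, m2 (xsection A x) = 0%E}.
Proof.
by move=> mA; rewrite -integral_eq0_ae //; exact: measurable_fun_xsection.
Qed.

(** Integrating over the other factor first yields the same product measure, so null sets can be
    sliced in either direction. *)
Lemma product_null_ysection (A : set (T1 * T2)) : measurable A ->
  (m1 \x m2)%E A = 0%E <-> {ae m2, forall y, m1 (ysection A y) = 0%E}.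
Proof.
move=> mA; rewrite -integral_eq0_ae //; last exact: measurable_fun_ysection.
rewrite (@product_measure_unique _ _ _ _ _ m1 m2 (product_measure2 m1 m2)) //.
by move=> X Y mX mY; exact: product_measure2E.
Qed.

End Fubini.

(** * Measurability, and differentiability from slices *)

Section MeasurableMap.
Context {R : realType}.

(** An open set is the countable union of the closed rational boxes inside it, and a sup norm box is
    a condition on each entry. *)
Lemma open_preimage_measurable d (T : measurableType d) m (phi : T -> 'rV[R]_m)
    (U : set 'rV[R]_m) :
  (forall j, measurable_fun setT (fun t => phi t 0 j)) -> open U ->
  measurable (phi @^-1` U).
Proof.
move=> mphi oU.
pose D := [set qk : 'rV[rat]_m * nat | 
  forall w, `|w - map_mx ratr qk.1| <= qk.2.+1%:R^-1 -> U w].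
pose F qk := if qk \in D then [set t | `|phi t - map_mx ratr qk.1| <= qk.2.+1%:R^-1] else set0.
have -> : phi @^-1` U = \bigcup_qk F qk.
  apply/seteqP; split => [t /= Ut|t [qk _]]; last first.
    by rewrite /F; case: ifPn => // /[!inE] h /h.
  have := oU _ Ut; rewrite /interior /= -nbhs_ballE => -[r /= r0 hr].
  have r2 : 0 < r / 4 by rewrite divr_gt0.
  have [k hk] := invS_small r2.
  have k0 : 0 < k.+1%:R^-1 :> R by rewrite invr_gt0.
  have [q hq] := rat_approx_row (phi t) k0.
  have hq' : `|phi t - map_mx ratr q| <= k.+1%:R^-1 by rewrite distrC.
  exists (q, k) => //; rewrite /F ifT // inE => w /= hw; apply: hr.
  rewrite -ball_normE /=.
  have -> : phi t - w = (phi t - map_mx ratr q) - (w - map_mx ratr q).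
    by rewrite opprB addrA subrK.
  apply: le_lt_trans (ler_normB _ _) _; apply: le_lt_trans (lerD hq' hw) _.
  apply: le_lt_trans (lerD hk hk) _; move: r0; clear; lra.
apply: countable_bigcupT_measurable => [|qk]; first exact: countableP.
rewrite /F; case: ifP => _; last exact: measurable0.
have k0 : 0 <= qk.2.+1%:R^-1 :> R by rewrite invr_ge0.
have -> : [set t | `|phi t - map_mx ratr qk.1| <= qk.2.+1%:R^-1] =
    \bigcap_j [set t | `|phi t 0 j - ratr (qk.1 0 j)| <= qk.2.+1%:R^-1].
  apply/seteqP; split => [t /= h j _ /=|t /= h].
    by apply: le_trans h; have := entry_le_norm (phi t - map_mx ratr qk.1) 0 j; rewrite !mxE.
  by apply: norm_le_entries => // i j; rewrite !mxE (ord1 i); exact: (h j I).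
apply: fin_bigcap_measurable => [|j _]; first exact: finite_finset.
have mg : measurable_fun setT (fun t => `|phi t 0 j - ratr (qk.1 0 j)|).
  apply: (@measurableT_comp _ _ _ _ _ _ (@Num.Def.normr R R)) => //; exact: measurable_funB.
have := mg measurableT _ (measurable_itv `]-oo, qk.2.+1%:R^-1]); rewrite setTI.
by congr measurable; apply/seteqP; split => t /=; rewrite in_itv.
Qed.

Lemma closed_preimage_measurable d (T : measurableType d) m (phi : T -> 'rV[R]_m)
    (A : set 'rV[R]_m) :
  (forall j, measurable_fun setT (fun t => phi t 0 j)) -> closed A ->
  measurable (phi @^-1` A).
Proof.
move=> mphi cA; rewrite -[A]setCK preimage_setC; apply: measurableC.
exact: (open_preimage_measurable mphi (closed_openC cA)).
Qed.

Lemma measurable_row_mx d (T : measurableType d) m (phi : T -> 'rV[R]_m) :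
  (forall j, measurable_fun setT (fun t => phi t 0 j)) ->
  forall j, measurable_fun setT
    (fun st : measurableTypeR R * T => row_mx (st.1)%:M (phi st.2) 0 j : R).
Proof.
move=> mphi j; case: (split_ordP j) => i ->.
  under eq_fun do rewrite row_mxEl mxE (ord1 i) eqxx mulr1n.
  exact: measurable_fst.
under eq_fun do rewrite row_mxEr.
exact: (measurableT_comp (mphi i) measurable_snd).
Qed.

Lemma affine_measurable d (T : measurableType d) m p (f : 'rV[R]_m -> R)
    (e : 'rV[R]_p -> 'rV[R]_m) (phi : T -> 'rV[R]_m) :
  (forall j, measurable_fun setT (fun t => phi t 0 j)) -> continuous f ->
  measurable [set t | forall k, exists q : 'rV[rat]_p, exists j,
    affine_at f e k j (map_mx ratr q) (phi t)].
Proof.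
move=> mphi fc.
have -> : [set t | forall k, exists q : 'rV[rat]_p, exists j,
    affine_at f e k j (map_mx ratr q) (phi t)] =
    \bigcap_k \bigcup_q \bigcup_j (phi @^-1` affine_at f e k j (map_mx ratr q)).
  apply/seteqP; split => [t /= H k _|t H k].
    by have [q [j h]] := H k; exists q => //; exists j.
  by have [q _ [j _ h]] := H k I; exists q, j.
apply: bigcapT_measurable => k.
apply: countable_bigcupT_measurable => [|q]; first exact: countableP.
apply: bigcupT_measurable => j.
by apply: closed_preimage_measurable => //; exact: closed_affine_at.
Qed.

Lemma norm_row_mx0l p q (h : 'rV[R]_q) : `|row_mx (0 : 'rV[R]_p) h| <= `|h|.
Proof.
apply: norm_le_entries => // i j; rewrite (ord1 i); case: (split_ordP j) => k ->.
  by rewrite row_mxEl mxE normr0.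
by rewrite row_mxEr entry_le_norm.
Qed.

Lemma norm_row_mx0r p q (h : 'rV[R]_p) : `|row_mx h (0 : 'rV[R]_q)| <= `|h|.
Proof.
apply: norm_le_entries => // i j; rewrite (ord1 i); case: (split_ordP j) => k ->.
  by rewrite row_mxEl entry_le_norm.
by rewrite row_mxEr mxE normr0.
Qed.

Lemma dot_row_mx p q (a b : 'rV[R]_p) (u v : 'rV[R]_q) :
  dot (row_mx a u) (row_mx b v) = dot a b + dot u v.
Proof.
rewrite /dot !big_ord1 big_split_ord /=; congr (_ + _); apply: eq_bigr => i _.
  by rewrite !row_mxEl.
by rewrite !row_mxEr.
Qed.

Lemma is_derive_epsilon (g : R -> R) s c (e : R) : is_derive s (1 : R) g c -> 0 < e ->
  exists2 r : R, 0 < r & forall u, `|u| < r -> `|g (s + u) - g s - c * u| <= e * `|u|.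
Proof.
move=> [dg <-] e0; have := dg; rewrite /derivable => /cvgrPdist_le/(_ _ e0).
case/nbhs_ballP => r /= r0 hr; exists r => // u ur.
have [->|u0] := eqVneq u 0; first by rewrite addr0 mulr0 subrr subr0 normr0 mulr0.
have := hr u; rewrite /ball /= sub0r normrN => /(_ ur u0).
rewrite -[X in X - _]/('D_1 g s) -(ler_pM2r (x := `|u|)) ?normr_gt0 // -normrM.
have -> : u%:A + s = s + u by rewrite /GRing.scale /= mulr1 addrC.
by rewrite distrC mulrBl /GRing.scale /= [u^-1 * _]mulrC mulfVK.
Qed.

Section Slices.
Variables (m : nat) (f : 'rV[R]_(1 + m) -> R) (L : R).
Hypothesis fL : forall y z, `|f y - f z| <= L * `|y - z|.

Lemma lipschitz_slice_r s y z :
  `|f (row_mx (s%:M : 'rV[R]_1) y) - f (row_mx s%:M z)| <= `|L| * `|y - z|.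
Proof.
apply: le_trans (fL _ _) _; rewrite opp_row_mx add_row_mx subrr.
apply: le_trans (ler_wpM2r _ (ler_norm L)) _ => //.
by rewrite ler_wpM2l // norm_row_mx0l.
Qed.

Lemma lipschitz_slice_l s t y :
  `|f (row_mx (s%:M : 'rV[R]_1) y) - f (row_mx t%:M y)| <= `|L| * `|s - t|.
Proof.
apply: le_trans (fL _ _) _; rewrite opp_row_mx add_row_mx subrr.
apply: le_trans (ler_wpM2r _ (ler_norm L)) _ => //.
rewrite ler_wpM2l //; apply: le_trans (norm_row_mx0r _ _) _.
by apply: norm_le_entries => // i j; rewrite (ord1 i) (ord1 j) !mxE eqxx !mulr1n.
Qed.

Lemma differentiable_slice_affine s y :
  differentiable (fun z => f (row_mx (s%:M : 'rV[R]_1) z)) y <->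
  forall k, exists q : 'rV[rat]_m, exists j,
    affine_at f (row_mx (0 : 'rV[R]_1)) k j (map_mx ratr q) (row_mx s%:M y).
Proof.
rewrite (differentiable_affine_at y (lipschitz_slice_r s)).
have E h : row_mx (s%:M : 'rV[R]_1) y + row_mx 0 h = row_mx s%:M (y + h).
  by rewrite add_row_mx addr0.
split=> H k; have [q [j h]] := H k; exists q, j => u hu.
  by rewrite E; exact: h.
by have := h u hu; rewrite E.
Qed.

(* Fubini: almost everywhere in [s], [f] is differentiable in [y] and derivable
   in [s]; at the density points of the closed sets where [f s] is nearly affine
   around [y], the two combine into differentiability. *)
Lemma differentiable_slices s y c :
  (forall k, exists q : 'rV[rat]_m, exists2 j, affine_at f (row_mx (0 : 'rV[R]_1)) k j (map_mx ratr q) (row_mx s%:M y)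
    & forall eta : R, 0 < eta -> exists2 r : R, 0 < r & forall u, `|u| <= r ->
        exists2 s', affine_at f (row_mx (0 : 'rV[R]_1)) k j (map_mx ratr q) (row_mx s'%:M y)
           & `|s' - (s + u)| <= eta * `|u|) ->
  is_derive s (1 : R) (fun t => f (row_mx (t%:M : 'rV[R]_1) y)) c ->
  differentiable f (row_mx s%:M y).
Proof.
move=> H dc; apply: (differentiable_approx fL) => k0.
set e0 := k0.+1%:R^-1; have e00 : 0 < e0 by rewrite invr_gt0.
have M0 : 0 < 2 * `|L| + 2 by rewrite ltr_wpDl // mulr_ge0.
(* Two Lipschitz errors |L| eta and two affine errors eta add up to [e0]. *)
pose eta := e0 / (2 * `|L| + 2).
have eta0 : 0 < eta by rewrite divr_gt0.
have [k hk] := invS_small eta0.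
have [q [j Aj /(_ eta eta0)[r1 r10 hr1]]] := H k.
have [r2 r20 hr2] := is_derive_epsilon dc eta0.
have j0 : 0 < j.+1%:R^-1 :> R by rewrite invr_gt0.
exists (row_mx c%:M (map_mx ratr q)), (Num.min r1 (Num.min (r2 / 2) j.+1%:R^-1)).
  by rewrite !lt_min r10 j0 divr_gt0.
move=> h; rewrite !le_min => /and3P[h1 h2 h3].
pose u := h 0 (lshift m 0); pose v := rsubmx h.
have hE : h = row_mx u%:M v.
  rewrite -[h in LHS]hsubmxK; congr row_mx.
  by rewrite [LHS]mx11_scalar mxE.
have uh : `|u| <= `|h| by exact: entry_le_norm.
have vh : `|v| <= `|h|.
  by apply: norm_le_entries => // i l; rewrite mxE (ord1 i) entry_le_norm.
have [s' As' ss'] := hr1 u (le_trans uh h1).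
have := hr2 u (le_lt_trans (le_trans uh h2) _) => /(_ _)/wrap[|hc].
  by rewrite ltr_pdivrMr // mulr_natr mulr2n ltrDl.
have := As' v (le_trans vh h3); rewrite add_row_mx addr0 => hv.
rewrite hE add_row_mx dot_row_mx.
have -> : (s%:M + u%:M : 'rV[R]_1) = (s + u)%:M by rewrite raddfD.
have := lipschitz_slice_l (s + u) s' (y + v).
have := lipschitz_slice_l s' (s + u) y.
have -> : dot (c%:M : 'rV[R]_1) u%:M = c * u.
  by rewrite /dot !big_ord1 !mxE eqxx !mulr1n.
rewrite -hE; set N := `|h|; set a := map_mx ratr q.
set f1 := f _; set f2 := f _; set f3 := f _; set f4 := f _; set f5 := f _.
move=> k1; rewrite [`|s + u - s'|]distrC => k2.
have k3 : `|L| * `|s' - (s + u)| <= `|L| * (eta * N).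
  by rewrite ler_wpM2l // (le_trans ss') // ler_wpM2l // ltW.
have k4 : `|f4 - f1 - dot a v| <= eta * N.
  by apply: le_trans hv _; apply: ler_pM => //; rewrite invr_ge0.
have k5 : `|f2 - f5 - c * u| <= eta * N by apply: le_trans hc _; rewrite ler_wpM2l // ltW.
(* From s + u pass to the nearby good slice s', move by [v] there, return to s + u, and finally move
   along the first axis. The slope on the slice s' is the one chosen at [s]. *)
have -> : f3 - f5 - (c * u + dot a v) =
  (f3 - f4) + (f4 - f1 - dot a v) + (f1 - f2) + (f2 - f5 - c * u) by ring.
have -> : e0 * N = `|L| * (eta * N) + eta * N + `|L| * (eta * N) + eta * N.
  have -> : e0 = eta * (2 * `|L| + 2) by rewrite /eta divfK // gt_eqF.
  by ring.
apply: le_trans (ler_normD _ _) _; apply: lerD => //.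
apply: le_trans (ler_normD _ _) _; apply: lerD; last exact: le_trans k1 k3.
apply: le_trans (ler_normD _ _) _; apply: lerD => //.
exact: le_trans k2 k3.
Qed.

End Slices.

End MeasurableMap.

Section ProductSigmaFinite.
Context d1 d2 (T1 : measurableType d1) (T2 : measurableType d2) {R : realType}.
Variable m1 : {sigma_finite_measure set T1 -> \bar R}.
Variable m2 : {sigma_finite_measure set T2 -> \bar R}.

Lemma product_sigma_finite : sigma_finite setT (m1 \x m2)%E.
Proof.
have [A AT mA] := sigma_finiteT m1; have [B BT mB] := sigma_finiteT m2.
exists (fun n => if @unpickle (nat * nat)%type n is Some ij then A ij.1 `*` B ij.2 else set0).
  apply/seteqP; split=> // -[x y] _.
  have [i _ Ax] : (\bigcup_i A i) x by rewrite -AT.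
  have [j _ By] : (\bigcup_i B i) y by rewrite -BT.
  by exists (pickle (i, j)); rewrite ?pickleK.
move=> n; case: (unpickle n) => [[i j]|]; last by rewrite measure0.
have [mAi Ai] := mA i; have [mBj Bj] := mB j.
split; first exact: measurableX.
by rewrite product_measure1E // lte_mul_pinfty // ge0_fin_numE.
Qed.

Lemma product_sigma_finite_measure : exists M : {sigma_finite_measure set (T1 * T2)%type -> \bar R},
  (M : set (T1 * T2) -> \bar R) = (m1 \x m2)%E.
Proof.
pose M : {sigma_finite_measure set (T1 * T2)%type -> \bar R} :=
  HB.pack (m1 \x m2)%E (Measure_isSigmaFinite.Build _ _ _ (m1 \x m2)%E product_sigma_finite).
by exists M.
Qed.
End ProductSigmaFinite.

(** * Rademacher's theorem by induction on the dimension *)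

Section Rademacher.
Context {R : realType}.
Local Notation leb := (@lebesgue_measure R).

Lemma ae_countable d (T : measurableType d) (mu : {measure set T -> \bar R})
    (I : countType) (P : I -> T -> Prop) :
  (forall i, {ae mu, forall t, P i t}) -> {ae mu, forall t, forall i, P i t}.
Proof.
move=> H; have : {ae mu, forall t, forall n : nat, if unpickle n is Some i then P i t else True}.
  apply: ae_foralln => n; case: (unpickle n) => [i|]; first exact: H.
  exact: aeW.
apply: (@filterS _ _ (ae_filter_ringOfSetsType mu)) => t h i.
by have := h (pickle i); rewrite pickleK.
Qed.

(** Stands for the Lebesgue measure on row vectors, replaced by a measure on an auxiliary space
    mapped by [phi]. Differentiability almost everywhere and balls of nonzero measure are the two
    facts used later; both pass to the product with a line. *)
Definition rademacher_map d (T : measurableType d) (mu : set T -> \bar R) m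
    (phi : T -> 'rV[R]_m) : Prop :=
  [/\ forall j, measurable_fun setT (fun t => phi t 0 j),
      forall (f : 'rV[R]_m -> R) (L : R), (forall y z, `|f y - f z| <= L * `|y - z|) ->
        {ae mu, forall t, differentiable f (phi t)} &
      forall z r, 0 < r -> ~ mu.-negligible [set t | `|phi t - z| < r]].

(** By induction the slice at each [s] is differentiable at almost every [phi t]; by Fubini, for
    almost every [t] this holds at almost every [s]. For such [t], almost every [s] is also a point
    of derivability along the first axis and a density point of the sets needed by
    [differentiable_slices]. *)
Lemma rademacher_step d (T : measurableType d) (mu : {sigma_finite_measure set T -> \bar R}) m
    (phi : T -> 'rV[R]_m) (f : 'rV[R]_(1 + m) -> R) (L : R) :
  rademacher_map mu phi -> (forall y z, `|f y - f z| <= L * `|y - z|) ->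
  {ae mu, forall t, {ae leb, forall s, differentiable f (row_mx s%:M (phi t))}}.
Proof.
move=> [mphi dphi _] fL; have fc := lipschitz_continuous fL.
pose G := [set st : measurableTypeR R * T |
  differentiable (fun y => f (row_mx (st.1)%:M y)) (phi st.2)].
have mB : measurable (~` G).
  apply: measurableC.
  have := affine_measurable (row_mx (0 : 'rV[R]_1)) (measurable_row_mx mphi) fc.
  congr measurable; apply/seteqP; split => st /=.
    by move/(differentiable_slice_affine fL).
  by move/(differentiable_slice_affine fL).
have : {ae mu, forall t, leb (ysection (~` G) t) = 0%E}.
  apply/product_null_ysection => //; apply/product_null_xsection => //.
  apply: aeW => s; apply: measure_negligible; first exact: measurable_xsection.
  apply: negligibleS (dphi _ _ (lipschitz_slice_r fL s)) => t.
  by rewrite /xsection /= inE.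
apply: (@filterS _ _ (ae_filter_ringOfSetsType mu)) => t t0; set y := phi t.
(* There are countably many sets [E x], so almost every [s] is a density point of all those that
   contain it. *)
pose E (x : nat * 'rV[rat]_m * nat) := [set s : measurableTypeR R |
   affine_at f (row_mx (0 : 'rV[R]_1)) x.1.1 x.2 (map_mx ratr x.1.2) (row_mx s%:M y)].
have mE x : measurable (E x).
  pose psi (s : measurableTypeR R) : 'rV[R]_(1 + m) := row_mx s%:M y.
  apply: (@closed_preimage_measurable _ _ _ _ psi); last exact: closed_affine_at.
  move=> j; case: (split_ordP j) => i ->.
    under eq_fun do rewrite row_mxEl mxE (ord1 i) eqxx mulr1n.
    exact: measurable_id.
  under eq_fun do rewrite row_mxEr.
  exact: measurable_cst.
have dE := ae_countable (fun x => density_point (mE x)).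
have dg := lipschitz_derivable_ae (fun s s' => lipschitz_slice_l fL s s' y).
have dy : {ae leb, forall s, differentiable (fun z => f (row_mx s%:M z)) y}.
  exists (ysection (~` G) t); split => //; first exact: measurable_ysection.
  by move=> s; rewrite /ysection /= inE.
apply: (@filterS3 _ _ (ae_filter_ringOfSetsType leb) _ _ _ _ _ dE dg dy) => s.
move=> {}dE {}dg /(differentiable_slice_affine fL) {}dy.
apply: (differentiable_slices fL _ (DeriveDef dg erefl)) => k.
have [q [j Aj]] := dy k; exists q, j => //.
exact: (dE (k, q, j)).
Qed.

Lemma rademacher_map_prod d (T : measurableType d)
    (mu : {sigma_finite_measure set T -> \bar R}) m (phi : T -> 'rV[R]_m) :
  rademacher_map mu phi ->
  rademacher_map (leb \x mu)%E
    (fun st : measurableTypeR R * T => row_mx (st.1)%:M (phi st.2) : 'rV[R]_(1 + m)).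
Proof.
move=> H; have [mphi dphi hphi] := H; have mPhi := measurable_row_mx mphi; split => //.
  move=> f L fL; have fc := lipschitz_continuous fL.
  have mD : measurable (~` [set st : measurableTypeR R * T |
      differentiable f (row_mx (st.1)%:M (phi st.2))]).
    apply: measurableC; have := affine_measurable id mPhi fc.
    by congr measurable; apply/seteqP; split => st /=; move/(differentiable_affine_at _ fL).
  apply/negligibleP => //; apply/product_null_ysection => //.
  apply: (@filterS _ _ (ae_filter_ringOfSetsType mu)) (rademacher_step H fL) => t st.
  apply: measure_negligible; first exact: measurable_ysection.
  by apply: negligibleS st => s; rewrite /ysection /= inE.
move=> z r r0 [B [mB B0 sB]].
pose z1 := z 0 (lshift m 0); pose z2 := rsubmx z.
(* For the sup norm a ball contains the product of an interval of positive length with [D], so it is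
   null only if [D] is. *)
pose D := phi @^-1` ball z2 r.
have mD : measurable D by apply: open_preimage_measurable => //; exact: ball_open.
apply: (hphi z2 r r0); exists D; split => //; last first.
  by move=> t; rewrite /D /= -ball_normE /= distrC.
have : (leb (ball z1 r) * mu D <= (leb \x mu) B)%E.
  rewrite -product_measure1E //; last exact: measurable_ball.
  apply: le_measure; rewrite ?inE //; first by apply: measurableX => //; exact: measurable_ball.
  move=> [s t] [/= hs ht]; apply: sB => /=.
  move: hs ht; rewrite /D /= -!ball_normE /= => hs ht.
  rewrite -[z]hsubmxK opp_row_mx add_row_mx -/z2.
  apply: (@le_lt_trans _ _ (Num.max `|z1 - s| `|z2 - phi t|)); last by rewrite gt_max hs ht.
  apply: norm_le_entries => [|i j]; first by rewrite le_max normr_ge0.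
  rewrite (ord1 i) le_max; case: (split_ordP j) => l ->.
    by rewrite row_mxEl (ord1 l) !mxE eqxx mulr1n distrC lexx.
  by rewrite row_mxEr (distrC z2) entry_le_norm orbT.
rewrite B0 lebesgue_measure_ball ?(ltW r0) //.
have : (0 <= mu D)%E by exact: measure_ge0.
case: (mu D) => [x| |] //; last by rewrite gt0_muley // lte_fin pmulrn_lgt0.
by rewrite -EFinM !lee_fin pmulr_rle0 ?pmulrn_lgt0 // => x0 x1; congr EFin; apply/le_anti/andP.
Qed.

Lemma rademacher_map_exists m : exists d (T : measurableType d)
  (mu : {sigma_finite_measure set T -> \bar R}) (phi : T -> 'rV[R]_m), rademacher_map mu phi.
Proof.
elim: m => [|m [d [T [mu [phi H]]]]]; last first.
  have [M ME] := product_sigma_finite_measure leb mu.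
  exists _, (measurableTypeR R * T)%type, M; eexists; rewrite ME.
  exact: rademacher_map_prod H.
(* Dimension 0: a single point with mass one, where every function is differentiable. *)
exists _, unit, (dirac tt), (fun=> 0); split=> [[]//|f L fL|z r r0].
  apply: aeW => t.
  apply: (@differentiable_epsilon _ _ _ _ 0) => e e0; exists 1 => // h _.
  by rewrite (thinmx0 h) addr0 subrr dot0l subrr !normr0 mulr0.
have -> : [set _ : unit | `|(0 : 'rV[R]_0) - z| < r] = setT.
  by apply/seteqP; split => // u _ /=; rewrite (thinmx0 z) subrr normr0.
move=> /negligibleP -/(_ measurableT); rewrite /= diracE mem_set // => /eqP.
by rewrite onee_eq0.
Qed.

End Rademacher.

(** * Lipschitz functions with zero gradient *)

Section Vanishing.
Context {R : realType}.
Local Notation leb := (@lebesgue_measure R).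

Lemma is_derive_of_epsilon (g : R -> R) (s c : R) :
  (forall e : R, 0 < e -> exists2 r : R, 0 < r &
    forall u, `|u| < r -> `|g (s + u) - g s - c * u| <= e * `|u|) ->
  is_derive s (1 : R) g c.
Proof.
move=> H; have cv : h^-1 *: (g (h *: (1 : R) + s) - g s) @[h --> 0^'] --> c.
  apply/cvgrPdist_le => e e0; have [r r0 hr] := H e e0.
  apply/nbhs_ballP; exists r => //= u; rewrite /ball /= sub0r normrN => ur u0.
  have := hr u ur; rewrite -ler_pdivrMr ?normr_gt0 // -normfV -normrM; congr (_ <= _).
  have -> : u *: (1 : R) + s = s + u by rewrite /GRing.scale /= mulr1 addrC.
  by rewrite distrC mulrBl mulfK // mulrC.
by apply: DeriveDef; [apply: cvgP cv | apply: cvg_lim cv].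
Qed.

(** On almost every line parallel to the first axis [f] has zero derivative almost everywhere, so it
    is constant, hence zero. A point with f z0 != 0 would have a whole ball of lines on which this
    fails, and that ball is not negligible. *)
Lemma lipschitz_gradient_ae0 m (f : 'rV[R]_(1 + m) -> R) (L C : R) :
  (forall y z, `|f y - f z| <= L * `|y - z|) -> (forall z, C < `|z| -> f z = 0) ->
  (forall z, differentiable f z -> gradient f z = 0) -> forall z, f z = 0.
Proof.
move=> fL fC df0 z0; apply: contrapT => fz0.
have [d [T [mu [phi H]]]] := @rademacher_map_exists R m; have [_ _ hphi] := H.
have fz : 0 < `|f z0| by rewrite normr_gt0; apply/eqP.
have [r r0 hr] := (continuous_epsilon f).1 (lipschitz_continuous fL) z0 `|f z0| fz.
apply: (hphi (rsubmx z0) r r0).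
have := rademacher_step H fL; apply: negligibleS => t /= tr h.
have dc : {ae leb, forall s, is_derive s (1 : R) (fun s => f (row_mx s%:M (phi t))) 0}.
  apply: (@filterS _ _ (ae_filter_ringOfSetsType leb)) h => s ds.
  apply: is_derive_of_epsilon => e e0.
  have [r' r'0 hr'] := gradient_epsilon ds e0; exists r' => // u ur.
  have := hr' (row_mx u%:M 0); rewrite df0 // dot0l mul0r add_row_mx addr0 -raddfD /=.
  have nu : `|row_mx (u%:M : 'rV[R]_1) (0 : 'rV[R]_m)| <= `|u|.
    apply: le_trans (norm_row_mx0r _ _) _.
    by apply: norm_le_entries => // i j; rewrite (ord1 i) (ord1 j) mxE eqxx mulr1n.
  move=> /(_ (le_lt_trans nu ur)) /le_trans; apply.
  by rewrite ler_wpM2l // ltW.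
have cst := lipschitz_derive0_const (fun s s' => lipschitz_slice_l fL s s' (phi t)) dc.
have f0 s : f (row_mx s%:M (phi t)) = 0.
  (* The point of the line with first coordinate |C| + 1 lies outside the support. *)
  rewrite (cst s (`|C| + 1)); apply: fC.
  apply: (@lt_le_trans _ _ (`|C| + 1)); first by rewrite ltr_pwDr // ler_norm.
  have := entry_le_norm (row_mx (`|C| + 1)%:M (phi t)) 0 (lshift m 0).
  rewrite row_mxEl mxE eqxx mulr1n; apply: le_trans.
  exact: ler_norm.
suff /hr : `|row_mx (z0 0 (lshift m 0))%:M (phi t) - z0| < r.
  by rewrite f0 sub0r normrN ltxx.
apply: le_lt_trans tr; apply: norm_le_entries => // i j; rewrite (ord1 i).
case: (split_ordP j) => l ->; first by rewrite (ord1 l) mxE row_mxEl !mxE eqxx mulr1n subrr normr0.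
by rewrite mxE row_mxEr; have := entry_le_norm (phi t - rsubmx z0) 0 l; rewrite !mxE.
Qed.

Lemma lipschitz_gradient0 m (f : 'rV[R]_m -> R) (L C : R) : (0 < m)%N ->
  (forall y z, `|f y - f z| <= L * `|y - z|) -> (forall z, C < `|z| -> f z = 0) ->
  (forall z, differentiable f z -> gradient f z = 0) -> forall z, f z = 0.
Proof. by case: m f => // m f _; exact: (@lipschitz_gradient_ae0 m). Qed.

Lemma lipschitz_norm (V W : normedModType R) (g : V -> W) : lipschitz g ->
  exists2 M : R, 0 <= M & forall x y, `|g x - g y| <= M * `|x - y|.
Proof.
move=> [A [Ar hA]]; exists (`|A| + 1); first by rewrite addr_ge0.
move=> x y; apply: (hA (`|A| + 1) _ (x, y)) => //.
by rewrite ltr_pwDr // ler_norm.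
Qed.

(** The gradients are Lipschitz and, by compactness of the supports, bounded, so products of their
    entries are Lipschitz. *)
Lemma poisson_lipschitz n (H K : 'rV[R]_(n + n) -> R) :
  C11 H -> compactly_supported H -> C11 K -> compactly_supported K ->
  exists L : R, forall x y, `|poisson H K x - poisson H K y| <= L * `|x - y|.
Proof.
move=> [cH /lipschitz_norm[M1 M10 lH]] sH [cK /lipschitz_norm[M2 M20 lK]] sK.
have [_ [B1 bH] _] := tame_C1 cH sH; have [_ [B2 bK] _] := tame_C1 cK sK.
exists (\sum_(k < n) (2 * (B1 * M2 + M1 * B2))) => x y.
rewrite !poisson_bracket /bracket -sumrB mulr_suml.
apply: le_trans (ler_norm_sum _ _ _) _; apply: ler_sum => k _.
have prod_lip i j : `|gradient H x 0 i * gradient K x 0 j - gradient H y 0 i * gradient K y 0 j|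
    <= (B1 * M2 + M1 * B2) * `|x - y|.
  rewrite (_ : _ - _ = gradient H x 0 i * (gradient K x 0 j - gradient K y 0 j) +
     (gradient H x 0 i - gradient H y 0 i) * gradient K y 0 j); last by ring.
  apply: le_trans (ler_normD _ _) _; rewrite !normrM mulrDl -mulrA.
  have entry_lip (V : 'rV[R]_(n + n) -> 'rV[R]_(n + n)) (M : R) l :
      (forall x y, `|V x - V y| <= M * `|x - y|) -> `|V x 0 l - V y 0 l| <= M * `|x - y|.
    by move=> lV; apply: le_trans (lV x y); have := entry_le_norm (V x - V y) 0 l; rewrite !mxE.
  apply: lerD; first apply: ler_pM => //.
  - exact: le_trans (entry_le_norm _ _ _) (bH x).
  - exact: entry_lip.
  rewrite mulrAC; apply: ler_pM => //; first exact: entry_lip.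
  exact: le_trans (entry_le_norm _ _ _) (bK y).
have := lerD (prod_lip (lshift n k) (rshift n k)) (prod_lip (rshift n k) (lshift n k)).
rewrite -mulrA mulr_natl mulr2n; apply: le_trans.
rewrite [X in `|X| <= _](_ : _ = (gradient H x 0 (lshift n k) * gradient K x 0 (rshift n k) -
    gradient H y 0 (lshift n k) * gradient K y 0 (rshift n k)) -
  (gradient H x 0 (rshift n k) * gradient K x 0 (lshift n k) -
    gradient H y 0 (rshift n k) * gradient K y 0 (lshift n k))); last by ring.
exact: ler_normB.
Qed.

End Vanishing.

Theorem proposition4p5 (R : realType) (n : nat) (H K : 'rV[R]_(n + n) -> R)
    (HC11 : C11 H) (Hsupp : compactly_supported H)
    (KC11 : C11 K) (Ksupp : compactly_supported K) :
  (C0_commute H K ->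
     forall x : 'rV[R]_(n + n), weak_lie_bracket H K x = [set 0]) /\
  ((forall x : 'rV[R]_(n + n), weak_lie_bracket H K x = [set 0]) ->
     (forall x : 'rV[R]_(n + n), poisson H K x = 0) /\ C0_commute H K).
Proof.
have [cH _] := HC11; have [cK _] := KC11; split=> [HK x|w0].
  by apply: weak_hamiltonian_vf0; exact: C0_commute_poisson0.
suff p0 : forall x, poisson H K x = 0 by split=> //; exact: C0_commute_poisson.
(* In dimension zero there is no line to follow, but the bracket is an empty sum. *)
have [n0|n0] := posnP n; first by move=> x; rewrite /poisson; subst n; rewrite big_ord0.
have [L pL] := poisson_lipschitz HC11 Hsupp KC11 Ksupp.
have [C HC] := gradient_support Hsupp.
apply: (lipschitz_gradient0 (C := C) _ pL) => [|z /HC[_ gz]|z dz].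
- by rewrite addn_gt0 n0.
- rewrite /poisson big1 // => k _.
  have gk j : partial j H z = 0 by move/rowP: gz => /(_ j); rewrite !mxE.
  by rewrite !gk !mul0r subrr.
(* Where the bracket is differentiable, its weak vector field is the singleton of the classical
   one. *)
- apply: hamiltonian_vf_eq0; have := w0 z; rewrite /weak_lie_bracket /weak_hamiltonian_vf.
  rewrite asboolT // => /seteqP[h _]; exact: h.
Qed.
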